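(* Let $m,n\in\mathbb{N}$ and let $\mathfrak{o}$ be a compact discrete valuation ring (of arbitrary characteristic) with residue field cardinality $q$. Then $$\zeta^{\triangleleft_{\mathrm{gr}}}_{L_{m,n}(\mathfrak{o})}(s)=\zeta_{\mathfrak{o}^{d(m,n)}}(s)\cdot I_n\left(q^{-1};\left(q^{i(n-i)-s\,b_i^{\triangleleft}(m,n)}\right)_{i=n-1}^{0}\right),$$ where, for $i\in\{0,1,\dots,n-1\}$, $$b_i^{\triangleleft}(m,n)=n-i+e(m,n)+\sum_{j=i+1}^{n}e(m,j).$$
   Context: $\mathbb{N}=\{1,2,\dots\}$, $\mathbb{N}_0=\mathbb{N}\cup\{0\}$. The Lie ring $L_{m,n}$: put $\mathbf{E}=\{\mathbf{e}\in\mathbb{N}_0^n \mid e_1+\dots+e_n=m-1\}$ and $\mathbf{F}=\{\mathbf{f}\in\mathbb{N}_0^n\mid f_1+\dots+f_n=m\}$. $L_{m,n}$ is the class-2-nilpotent Lie ring which is free as a $\mathbb{Z}$-module on the elements $x_{\mathbf{e}}$ ($\mathbf{e}\in\mathbf{E}$), $y_{\mathbf{f}}$ ($\mathbf{f}\in\mathbf{F}$), $z_1,\dots,z_n$, with $[x_{\mathbf{e}},y_{\mathbf{f}}]=-[y_{\mathbf f},x_{\mathbf e}]=z_i$ if $\mathbf{f}-\mathbf{e}$ is the $i$-th standard basis vector of $\mathbb{Z}^n$, $[x_{\mathbf{e}},y_{\mathbf{f}}]=0$ if $\mathbf{f}-\mathbf{e}$ is not a standard basis vector, and all other brackets of basis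 elements equal to $0$. $L_{m,n}(\mathfrak{o})=L_{m,n}\otimes_{\mathbb{Z}}\mathfrak{o}$. Numbers: $e(m,n)=\binom{n+m-2}{n-1}$, $f(m,n)=\binom{n+m-1}{n-1}$, $d(m,n)=e(m,n)+f(m,n)$. Graded ideal zeta function: write $L=L_{m,n}(\mathfrak{o})$ and $L'=[L,L]$. The associated graded $\mathfrak{o}$-Lie algebra is $\operatorname{gr}L=L^{(1)}\oplus L^{(2)}$ with $L^{(1)}=L/L'$, $L^{(2)}=L'$, and bracket induced by that of $L$ (so $[L^{(1)},L^{(1)}]\subseteq L^{(2)}$ and $L^{(2)}$ is central). An $\mathfrak{o}$-ideal $I$ of $\operatorname{gr}L$ is graded if $I=(I\cap L^{(1)})\oplus(I\cap L^{(2)})$. Then $\zeta^{\triangleleft_{\mathrm{gr}}}_{L_{m,n}(\mathfrak{o})}(s)=\sum_{I}|\operatorname{gr}L:I|^{-s}$, where $I$ ranges over the graded $\mathfrak{o}$-ideals of finite index in $\operatorname{gr}L$. $\zeta_{\mathfrak{o}^d}(s)$ is the Dirichlet series $\sum_{\Lambda}|\mathfrak{o}^d:\Lambda|^{-s}$ over all finite-index $\mathfrak{o}$-submodules $\Lambda\le\mathfrak{o}^d$; it equals $\prod_{i=0}^{d-1}(1-q^{i-s})^{-1}$. Igusa function of degree $n$: $$I_n(Y;X_1,\dots,X_n)=\sum_{I\subseteq\{1,\dots,n\}}\binom{n}{I}_Y\prod_{i\in I}\frac{X_i}{1-X_i},$$ where for $I=\{i_1<\dots<i_l\}$ one sets $\binom{n}{I}_Y=\binom{n}{i_l}_Y\binom{i_l}{i_{l-1}}_Y\cdots\binom{i_2}{i_1}_Y$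 (equal to $1$ for $I=\emptyset$) and $\binom{a}{b}_Y=\frac{\prod_{i=a-b+1}^{a}(1-Y^i)}{\prod_{i=1}^{b}(1-Y^i)}$. The notation $I_n(Y;(x_i)_{i=n-1}^{0})$ means $I_n(Y;x_{n-1},x_{n-2},\dots,x_0)$, i.e. $X_1=x_{n-1},\dots,X_n=x_0$. *)

(* Defs.v *)
From HB Require Import structures.
From mathcomp Require Import all_boot all_order all_algebra ring_quotient.
From mathcomp Require Import finmap complex.
From mathcomp Require Import all_classical all_reals all_analysis summability.

Set Implicit Arguments.
Unset Strict Implicit.
Unset Printing Implicit Defensive.

Import Order.TTheory GRing.Theory Num.Theory.
Import numFieldNormedType.Exports.
Local Open Scope classical_set_scope.
Local Open Scope ring_scope.
Local Open Scope quotient_scope.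
Local Open Scope complex_scope.
Local Open Scope card_scope.

Definition is_submodule (A : comNzRingType) (V : lmodType A) (N : set V) : Prop :=
  submod_closed (mem N).

Definition cosets (M : zmodType) (N : set M) : set (set M) :=
  [set [set y | N (y - x)] | x in [set: M]].

Definition finite_index (M : zmodType) (N : set M) : Prop :=
  finite_set (cosets N).

(* |M : N|. Meaningful only when [finite_index N]. *)
Definition submod_index (M : zmodType) (N : set M) : nat :=
  #|` fset_set (cosets N)|.

Section DiscreteValuationRing.
Variable o : idomainType.

Definition is_ideal (I : set o) : Prop := is_submodule (I : set o^o).

Definition principal (a : o) : set o := [set a * x | x in [set: o]].

Definition maximal_ideal (M : set o) : Prop :=
  [/\ is_ideal M, M <> [set: o] &
      forall J : set o, is_ideal J -> M `<=` J -> J = M \/ J = [set: o]].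

(* A principal ideal domain with exactly one nonzero maximal ideal. *)
Definition is_dvr : Prop :=
  (forall I : set o, is_ideal I -> exists a : o, I = principal a) /\
  (exists! M : set o, maximal_ideal M /\ M <> [set 0]).

Definition uniformizer (pi : o) : Prop := maximal_ideal (principal pi).

Definition residue_field_card (pi : o) (q : nat) : Prop :=
  cosets (principal pi) #= `I_q.

End DiscreteValuationRing.

(* The ring [o] carrying the [pi]-adic topology, in which the sets
   [x + pi ^+ k * o] form a base of neighbourhoods of [x]. *)
Definition adic (o : idomainType) (pi : o) : Type := o.

Section AdicTopology.
Variables (o : idomainType) (pi : o).

HB.instance Definition _ := Choice.on (adic pi).

Definition adic_open (U : set (adic pi)) : Prop :=
  forall x : o, U x -> exists k : nat, forall y : o, U (x + pi ^+ k * y).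

Lemma adic_openT : adic_open setT.
Proof. by move=> x _; exists 0%N. Qed.

Lemma adic_openI : setI_closed adic_open.
Proof.
move=> U W oU oW x [Ux Wx].
have [k Uk] := oU x Ux; have [l Wl] := oW x Wx.
exists (k + l)%N => y; split.
  by rewrite exprD -mulrA; apply: Uk.
by rewrite exprD [pi ^+ k * _]mulrC -mulrA; apply: Wl.
Qed.

Lemma adic_open_bigU (I : Type) (f : I -> set (adic pi)) :
  (forall i, adic_open (f i)) -> adic_open (\bigcup_i f i).
Proof.
move=> of_ x [i _ fix_]; have [k fk] := of_ i x fix_.
by exists k => y; exists i.
Qed.

HB.instance Definition _ := isOpenTopological.Build (adic pi)
  adic_openT adic_openI adic_open_bigU.

Definition adic_compact : Prop := compact [set: adic pi].

End AdicTopology.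

Section Span.
Variables (A : comNzRingType) (V : lmodType A) (G : set V).

Definition submod_span : {pred V} :=
  fun x => `[< forall N : set V, is_submodule N -> G `<=` N -> N x >].

Lemma submod_span_closed : submod_closed submod_span.
Proof.
split=> [|a u v].
  by apply/asboolP => N [N0 _] _; have := N0; rewrite inE.
rewrite !unfold_in => /asboolP su /asboolP sv; apply/asboolP => N mN GN.
have [_ NL] := mN; have := NL a u v; rewrite !inE; apply.
  exact: su.
exact: sv.
Qed.

HB.instance Definition _ := GRing.isSubmodClosed.Build A V submod_span
  submod_span_closed.

End Span.

Section SubmoduleType.
Variables (A : comNzRingType) (V : lmodType A) (G : set V).

(* The submodule spanned by G, as a module. *)
Record submod : Type :=
  Submod { submod_val : V; _ : submod_val \in submod_span G }.

HB.instance Definition _ := [isSub for submod_val].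
HB.instance Definition _ := [Choice of submod by <:].
HB.instance Definition _ := [SubChoice_isSubLmodule of submod by <:].

End SubmoduleType.

Section QuotientModule.
Variables (A : comNzRingType) (V : lmodType A) (G : set V).

(* The quotient of V by the submodule spanned by G. *)
Definition quotmod : Type := Quotient.quot (submod_span G).

HB.instance Definition _ := GRing.Zmodule.on quotmod.
HB.instance Definition _ := EqQuotient.on quotmod.

Definition quotmod_scale (a : A) (x : quotmod) : quotmod :=
  \pi_quotmod (a *: repr x).

Lemma quotmod_eqP (u v : V) :
  reflect (\pi_quotmod u = \pi_quotmod v) (u - v \in submod_span G).
Proof. by rewrite Quotient.idealrBE; apply: eqP. Qed.

Lemma pi_quotmod_scale (a : A) (v : V) :
  \pi_quotmod (a *: v) = quotmod_scale a (\pi_quotmod v).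
Proof.
apply/quotmod_eqP; rewrite -scalerBr rpredZ //.
by apply/quotmod_eqP; rewrite reprK.
Qed.

Lemma pi_quotmodD (u v : V) :
  \pi_quotmod (u + v) = \pi_quotmod u + \pi_quotmod v.
Proof. exact: (Quotient.pi_add (submod_span G)). Qed.

Lemma quotmod_scaleA (a b : A) (x : quotmod) :
  quotmod_scale a (quotmod_scale b x) = quotmod_scale (a * b) x.
Proof.
rewrite -[x]reprK -(pi_quotmod_scale b) -(pi_quotmod_scale a) scalerA.
exact: pi_quotmod_scale.
Qed.

Lemma quotmod_scale1 : left_id 1 quotmod_scale.
Proof.
by move=> x; rewrite -[x in LHS]reprK -pi_quotmod_scale scale1r reprK.
Qed.

Lemma quotmod_scaleDr : right_distributive quotmod_scale +%R.
Proof.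
move=> a x y; rewrite -[x]reprK -[y]reprK -pi_quotmodD -!pi_quotmod_scale.
by rewrite scalerDr pi_quotmodD.
Qed.

Lemma quotmod_scaleDl (x : quotmod) :
  {morph quotmod_scale^~ x : a b / a + b}.
Proof.
by move=> a b; rewrite -[x]reprK -!pi_quotmod_scale scalerDl pi_quotmodD.
Qed.

HB.instance Definition _ := GRing.Zmodule_isLmodule.Build A quotmod
  quotmod_scaleA quotmod_scale1 quotmod_scaleDr quotmod_scaleDl.

End QuotientModule.

Section AssociatedGraded.
Variables (A : comNzRingType) (V : lmodType A) (br : V -> V -> V).

Definition brackets : set V := [set w | exists u v, w = br u v].

Lemma br_derived (u v : V) : br u v \in submod_span brackets.
Proof. by apply/asboolP => N _; apply; exists u, v. Qed.

(* The derived subalgebra V' is the submodule spanned by [brackets]. *)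
Definition gr : lmodType A := (quotmod brackets * submod brackets)%type.

(* [repr] picks representatives in [V] of the classes in [V / V']. *)
Definition gr_bracket (p q : gr) : gr :=
  (0, Submod (br_derived (repr p.1) (repr q.1))).

Definition gr1 : set gr := [set p | p.2 = 0].
Definition gr2 : set gr := [set p | p.1 = 0].

Definition is_lie_ideal (I : set gr) : Prop :=
  is_submodule I /\ forall p q : gr, I q -> I (gr_bracket p q).

Definition is_graded (I : set gr) : Prop :=
  I = [set p + q | p in I `&` gr1 & q in I `&` gr2].

End AssociatedGraded.

Section LieRing.
Variables m n : nat.

(* An entry of a vector of nonnegative integers of sum [k] is at most [k]. *)
Definition multi_index (k : nat) : finType :=
  {e : {ffun 'I_n -> 'I_k.+1} | (\sum_i (e i : nat) == k)%N}%type.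

(* [inl (inl e)], [inl (inr f)] and [inr i] stand for x_e, y_f and z_i. *)
Definition lie_basis : finType :=
  (multi_index m.-1 + multi_index m + 'I_n)%type.

Definition differ_by (e : multi_index m.-1) (f : multi_index m) (i : 'I_n) :=
  [forall j, val f j == val e j + (j == i) :> nat]%N.

(* The coefficient of [c] in the bracket of the basis elements [a] and [b]. *)
Definition structure_constant (a b c : lie_basis) : int :=
  match a, b, c with
  | inl (inl e), inl (inr f), inr i => if differ_by e f i then 1 else 0
  | inl (inr f), inl (inl e), inr i => if differ_by e f i then -1 else 0
  | _, _, _ => 0
  end.

(* [lie_ring int] with [lie_bracket] is L_{m,n}; tensoring this free Z-module
   with [A] keeps the basis and the structure constants. *)
Definition lie_ring (A : comNzRingType) : lmodType A :=
  {ffun lie_basis -> A^o}%type.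

Definition lie_bracket (A : comNzRingType) (u v : lie_ring A) : lie_ring A :=
  [ffun c => \sum_a \sum_b u a * v b * (structure_constant a b c)%:~R].

End LieRing.

Section Zeta.
Variable R : realType.

(* [x] to the power [z], for [x > 0]. *)
Definition cpow (x : R) (z : R[i]) : R[i] :=
  (x `^ complex.Re z)%:C *
  (cos (complex.Im z * ln x) +i* sin (complex.Im z * ln x)).

(* The sum of |M : N|^-s over the members N of F of finite index converges
   unconditionally (equivalently, absolutely) to Z. *)
Definition zeta_value (M : zmodType) (F : set (set M)) (s Z : R[i]) : Prop :=
  partial_sum (fun N : set M =>
    if N \in F `&` @finite_index M
    then (cpow (submod_index N)%:R (- s) : R[i]^o) else 0)
  @ totally --> (Z : R[i]^o).

Definition free_module_zeta_value (o : comNzRingType) (d : nat)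
    (s Z : R[i]) : Prop :=
  zeta_value (@is_submodule o 'rV[o]_d) s Z.

Definition graded_ideal_zeta_value (o : comNzRingType) (m n : nat)
    (s Z : R[i]) : Prop :=
  zeta_value
    [set I : set (gr (@lie_bracket m n o)) | is_lie_ideal I /\ is_graded I]
    s Z.

End Zeta.

Section Igusa.
Variable K : fieldType.

Definition gauss_binomial (Y : K) (a b : nat) : K :=
  (\prod_((a - b + 1)%N <= i < (a + 1)%N) (1 - Y ^+ i)) /
  (\prod_(1%N <= i < (b + 1)%N) (1 - Y ^+ i)).

Fixpoint gauss_chain (Y : K) (a : nat) (l : seq nat) : K :=
  if l is b :: l' then gauss_binomial Y a b * gauss_chain Y b l' else 1.

(* [i : 'I_n] stands for the element [i.+1] of {1, ..., n}; [rev] lists the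
   elements of [I] in decreasing order. *)
Definition gauss_multinomial (Y : K) (n : nat) (I : {set 'I_n}) : K :=
  gauss_chain Y n (rev [seq (val i).+1 | i <- enum I]).

Definition igusa (n : nat) (Y : K) (X : nat -> K) : K :=
  \sum_(I : {set 'I_n}) gauss_multinomial Y I *
    \prod_(i in I) (X i.+1 / (1 - X i.+1)).

End Igusa.

Definition e_num (m n : nat) : nat := 'C(n + m - 2, n - 1)%N.
Definition f_num (m n : nat) : nat := 'C(n + m - 1, n - 1)%N.
Definition d_num (m n : nat) : nat := (e_num m n + f_num m n)%N.

Definition b_num (m n i : nat) : nat :=
  (n - i + e_num m n + \sum_(i + 1 <= j < n + 1) e_num m j)%N.

(* Main.v *)
Require Import Defs.
From mathcomp Require Import all_boot all_order all_algebra ring_quotient.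
From mathcomp Require Import finmap complex.
From mathcomp Require Import all_classical all_reals all_analysis summability.
From mathcomp Require Import ring lra zify.

(** Write [V1] and [V2] for the free modules on the [x_e, y_f] and on the [z_i].
A graded ideal is a pair [L1 + L2] of submodules of [V1] and [V2] such that
[L1] lies in the centralizer of [L2], the set of all [x] in [V1] with
[[V1, x]] inside [L2] ([graded_idealP]).  For [L2] of finite index the
centralizer is again free of full rank ([lattice_free]), so its submodules
correspond to those of [V1], and the sum over ideals factors as

  (sum over [N] in [V1] of [|V1 : N|^-s]) *
  (sum over [L2] in [V2] of [(|V2 : L2| * |V1 : centralizer L2|)^-s]).

The first factor is the zeta function of the free module of rank [d(m,n)], and
the point is to evaluate the second one.

The centralizer splits into a condition on the coefficients of the [x_e] and one
on those of the [y_f].  The first says that all multiples [a_e *: v] lie in [L2]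
([cond_xE]: a form of the Gauss lemma).  The second says that all vectors
[(b_(e + e_i))_i] lie in [L2]; reading [b] as a linear form on polynomials of
degree [m], a change of the variables carries the condition for [L2] to that for
the transformed lattice ([level_cond_y_elementary]).  Hence the exponent of
[|V2 : L2| * |V1 : centralizer L2|] is invariant under transvections of [V2], and
when the coordinates in a nonempty set [C] are multiplied by the uniformizer it
grows by [#|C|], plus the number of [e], plus the number of [f] whose support
meets [C]: this is [b_i(m,n)] with [i = n - #|C|] ([lie_scaling_weight]).

For any weight of that kind the sum over lattices is an Igusa function
([coef_series_igusa]).  Process the coordinates one at a time, putting [k] into
[C] if the [k]-th coordinates of the lattice lie in the maximal ideal, and into
[A] otherwise, after a transvection that makes the lattice contain the [k]-th
unit vector.  Counting the lattices that are so brought to a given one yields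
the Pascal rule for Gaussian binomials ([class_sum_pivot]); once [C] and [A]
exhaust the coordinates, the lattice is obtained from another one by scaling the
coordinates in [C] ([class_sum_scale]).  This gives a recursion in the number
of remaining coordinates, which is that of the Igusa function
([igusa_recursion]).

On the analytic side all indices are powers of [q], so that each Dirichlet
series is a power series in [T = q ^ (-s)] with nonnegative coefficients.
Unconditional convergence is finiteness of the sum of the moduli, which is a sum
of extended nonnegative reals and may be split and rearranged at will; the value
is then found from explicit relations between the partial sums.  A convergent
product of two such series with positive terms forces both factors to converge,
which is how the convergence of the free module zeta function follows. *)

Set Implicit Arguments.
Unset Strict Implicit.
Unset Printing Implicit Defensive.
Import Order.TTheory GRing.Theory Num.Theory.
Import numFieldNormedType.Exports.
Local Open Scope classical_set_scope.
Local Open Scope card_scope.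
Local Open Scope quotient_scope.
Local Open Scope complex_scope.
Local Open Scope ring_scope.

(** * Submodules and uniformizers *)

Lemma submoduleP (A : comNzRingType) (V : lmodType A) (N : set V) :
  is_submodule N <-> N 0 /\ forall a u v, N u -> N v -> N (a *: u + v).
Proof.
rewrite /is_submodule /submod_closed; split=> [[N0 NL]|[N0 NL]].
  split; first by move: N0; rewrite inE.
  by move=> a u v Nu Nv; have := NL a u v; rewrite !inE; apply.
by split=> [|a u v]; rewrite !inE //; apply: NL.
Qed.

Section SubmoduleTheory.
Variables (A : comNzRingType) (V : lmodType A) (N : set V).
Hypothesis sN : is_submodule N.

Lemma sm0 : N 0. Proof. by case/submoduleP: sN. Qed.
Lemma smZ a u : N u -> N (a *: u).
Proof.
by case/submoduleP: sN => N0 NL Nu; rewrite -[_ *: _]addr0; apply: NL.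
Qed.
Lemma smD u v : N u -> N v -> N (u + v).
Proof.
by case/submoduleP: sN => N0 NL Nu Nv; rewrite -[u]scale1r; apply: NL.
Qed.
Lemma smN u : N u -> N (- u).
Proof. by move=> Nu; rewrite -scaleN1r; apply: smZ. Qed.
Lemma smB u v : N u -> N v -> N (u - v).
Proof. by move=> Nu Nv; apply: smD => //; apply: smN. Qed.
Lemma sm_sum (I : Type) (r : seq I) (P : pred I) (F : I -> V) :
  (forall i, P i -> N (F i)) -> N (\sum_(i <- r | P i) F i).
Proof. by move=> h; elim/big_ind: _ => //; [apply: sm0 | apply: smD]. Qed.
Lemma smDr u v : N v -> N (u + v) -> N u.
Proof. by move=> Nv Nuv; rewrite -[u](addrK v); apply: smB. Qed.
End SubmoduleTheory.

Definition local_parameter (o : idomainType) (pi : o) : Prop :=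
  [/\ pi != 0, pi \isn't a GRing.unit &
      forall x : o, x \is a GRing.unit \/ exists y, x = pi * y].

Lemma principal_ideal (o : idomainType) (a : o) : is_ideal (principal a).
Proof.
apply/submoduleP; split; first by exists 0; rewrite ?mulr0.
move=> b u v [x _ <-] [y _ <-]; exists (b * x + y) => //.
by rewrite mulrDr [b *: _]/(_ * _) mulrCA.
Qed.

(** A nonunit is contained in a maximal ideal, and uniqueness of the nonzero one
    leaves only the multiples of [pi]. *)
Lemma dvr_local_parameter (o : idomainType) (pi : o) :
  is_dvr o -> uniformizer pi -> local_parameter pi.
Proof.
move=> [pid [M [[maxM Mn0] uniqM]]] maxpi.
have properpi : principal pi <> [set: o] by case: maxpi.
have pin0 : pi != 0.
  apply/eqP => pi0; case: maxM => idM MT maxM.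
  case: maxpi => _ _ /(_ M idM) [||//].
  - rewrite pi0 => x [y _ <-]; rewrite mul0r; exact: (sm0 idM).
  - move=> Mpi; apply: Mn0; rewrite Mpi pi0; apply/seteqP; split=> x /=.
      by move=> [y _ <-]; rewrite mul0r.
    by move=> ->; exists 0; rewrite ?mulr0.
have Mpi : M = principal pi.
  apply: uniqM; split=> // pi0; have : principal pi pi by exists 1; rewrite ?mulr1.
  by rewrite pi0 /= => /eqP; rewrite (negPf pin0).
have piNunit : pi \isn't a GRing.unit.
  apply/negP => upi; apply: properpi; apply/seteqP; split=> // x _.
  by exists (pi^-1 * x); rewrite ?mulrA ?divrr ?mul1r.
split=> // x; case: (boolP (x \is a GRing.unit)) => [|xNu]; [by left | right].
(* Zorn: the ideals containing [x] but not 1; the empty set is allowed so that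
   every chain has an upper bound. *)
pose P (I : set o) := I = set0 \/ [/\ is_ideal I, I x & ~ I 1].
have [|I [PI maxI]] := @Zorn_bigcup _ P.
  move=> F FP totF.
  have [[I [FI /eqP In0]]|no] :=
      pselect (exists I, F I /\ I <> set0); last first.
    left; apply/seteqP; split=> // y [I FI Iy].
    by case: no; exists I; split=> // I0; rewrite I0 in Iy.
  have PFI J y : F J -> J y -> [/\ is_ideal J, J x & ~ J 1].
    by move=> FJ Jy; case: (FP _ FJ) => [J0|//]; move: Jy; rewrite J0.
  have [y Iy] : exists y, I y by apply/set0P.
  have [idI Ix nI1] := PFI _ _ FI Iy.
  right; split; [|by exists I|]; last by move=> [J FJ J1]; case: (PFI _ _ FJ J1).
  apply/submoduleP; split; first by exists I => //; exact: (sm0 idI).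
  move=> a u v [J FJ Ju] [K FK Kv].
  have [idJ _ _] := PFI _ _ FJ Ju; have [idK _ _] := PFI _ _ FK Kv.
  have [JK|KJ] := totF _ _ FJ FK.
    by exists K => //; apply: (smD idK) => //; apply: (smZ idK); apply: JK.
  by exists J => //; apply: (smD idJ); [apply: (smZ idJ)|apply: KJ].
have idx := principal_ideal x.
have x1 : ~ principal x 1.
  move=> [y _ xy]; move/negP: xNu; apply; apply/unitrP; exists y.
  by rewrite mulrC xy.
have xx : principal x x by exists 1; rewrite ?mulr1.
have [I0|[idI Ix nI1]] := PI.
  case: (maxI (principal x)); last by right.
  by rewrite I0; split=> // /(_ x xx).
have mI : maximal_ideal I.
  split=> //; first by move=> IT; apply: nI1; rewrite IT.
  move=> J idJ IJ; have [J1|J1] := pselect (J 1).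
    right; apply/seteqP; split=> // y _.
    by rewrite -[y]mulr1; apply: (smZ idJ).
  have [->|neq] := pselect (J = I); first by left.
  case: (maxI J); last by right; split=> //; apply: IJ.
  by split=> // JI; apply: neq; apply/seteqP.
have [->|/eqP xn0] := eqVneq x 0; first by exists 0; rewrite mulr0.
have IM : M = I by apply: uniqM; split=> // I0; move: Ix; rewrite I0.
by move: Ix; rewrite -IM Mpi => -[y _ <-]; exists y.
Qed.

(** * Indices *)

(** Cosets are classified by a map to ['I_K], which composes with linear maps
    and products more easily than the set of cosets does. *)
Definition has_index (M : zmodType) (N : set M) (K : nat) : Prop :=
  exists f : M -> 'I_K,
    (forall i, exists x, f x = i) /\ (forall x y, f x = f y <-> N (x - y)).

Lemma has_index_fin (M : zmodType) (N : set M) (T : finType) (f : M -> T) :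
  (forall i, exists x, f x = i) -> (forall x y, f x = f y <-> N (x - y)) ->
  has_index N #|T|.
Proof.
move=> fs ff; exists (fun x => enum_rank (f x)); split=> [i|x y].
  by have [x fx] := fs (enum_val i); exists x; rewrite fx enum_valK.
by rewrite -ff; split=> [/enum_rank_inj|->].
Qed.

Lemma has_index_gt0 (M : zmodType) (N : set M) K : has_index N K -> (0 < K)%N.
Proof. by case: K => // -[f _]; case: (f 0). Qed.

Definition subgroup (M : zmodType) (N : set M) : Prop :=
  N 0 /\ forall x y, N x -> N y -> N (x - y).

Lemma submodule_subgroup (A : comNzRingType) (V : lmodType A) (N : set V) :
  is_submodule N -> subgroup N.
Proof. by move=> sN; split; [apply: sm0 | move=> x y; apply: smB]. Qed.

Lemma eq_coset (M : zmodType) (N : set M) x y : subgroup N ->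
  [set z | N (z - x)] = [set z | N (z - y)] <-> N (x - y).
Proof.
move=> [N0 NB]; split=> [e|Nxy].
  have : [set z | N (z - x)] x by rewrite /= subrr.
  by rewrite e.
apply/seteqP; split=> z /= Nz.
  by have := NB _ _ Nz (NB _ _ N0 Nxy); rewrite sub0r opprK addrA subrK.
by have := NB _ _ Nz Nxy; rewrite opprB addrA subrK.
Qed.

Lemma has_index_cosets (M : zmodType) (N : set M) K : subgroup N ->
  has_index N K <-> cosets N #= `I_K.
Proof.
move=> sN; split=> [[f [fs ff]]|/card_set_bijP[g [gf gi gs]]].
  apply/card_set_bijP; exists (fun C => f (xget 0 C) : nat).
  have rep x : N (xget 0 [set z | N (z - x)] - x).
    by case: xgetP => [y _ //|/(_ x)]; rewrite /= subrr; case: sN.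
  have frep x : f (xget 0 [set z | N (z - x)]) = f x by apply/ff.
  split=> [C [x _ <-]|C D|i iK] /=.
  - exact: ltn_ord.
  - rewrite !inE => -[x _ <-] [y _ <-]; rewrite !frep => /val_inj/ff.
    by move/(eq_coset _ _ sN).
  - have [x fx] := fs (Ordinal iK); exists [set z | N (z - x)]; first by exists x.
    by rewrite /= frep fx.
pose co (x : M) := [set y | N (y - x)].
have cK x : (g (co x) < K)%N by apply: gf; exists x.
exists (fun x => Ordinal (cK x)); split=> [i|x y].
  have [C [x _ <-] gC] := gs i (ltn_ord i); exists x; exact: val_inj.
rewrite -(eq_coset _ _ sN); split=> [[gxy]|e]; last first.
  by apply: val_inj; rewrite /= /co e.
by apply: gi => //; rewrite inE; [exists x | exists y].
Qed.

Lemma has_index_finite (M : zmodType) (N : set M) K : subgroup N ->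
  has_index N K -> finite_index N /\ submod_index N = K.
Proof.
move=> sN /(has_index_cosets _ sN) cK; split; first by exists K.
by rewrite /submod_index; exact: card_fset_set.
Qed.

Lemma finite_has_index (M : zmodType) (N : set M) : subgroup N ->
  finite_index N -> has_index N (submod_index N).
Proof.
move=> sN [K cK]; have hK := (has_index_cosets _ sN).2 cK.
by have [_ ->] := has_index_finite sN hK.
Qed.

Lemma has_index_preimage (U V : zmodType) (h : U -> V) (N : set V) K :
  {morph h : x y / x - y} -> (forall v, exists u, h u = v) ->
  has_index N K -> has_index (h @^-1` N) K.
Proof.
move=> hB hs [f [fs ff]]; exists (f \o h); split=> [i|x y] /=.
  by have [v <-] := fs i; have [u <-] := hs v; exists u.
by rewrite ff hB.
Qed.

Lemma has_index_setX (U V : zmodType) (N : set U) (P : set V) a b :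
  has_index N a -> has_index P b ->
  has_index [set x : U * V | N x.1 /\ P x.2] (a * b).
Proof.
move=> [f [fs ff]] [g [gs gg]].
have -> : (a * b)%N = #|{: 'I_a * 'I_b}| by rewrite card_prod !card_ord.
apply: (has_index_fin (f := fun x => (f x.1, g x.2))) => [[i j]|x y] /=.
  by have [x <-] := fs i; have [y <-] := gs j; exists (x, y).
by rewrite -ff -gg; split=> [[-> ->]|[-> ->]].
Qed.

(** The tower law, [U / N] being identified with [h(U) / h(N)]: a coset is located
    by its class modulo [h(U)] and by the class of the difference from a chosen
    representative. *)
Lemma has_index_image (U V : zmodType) (h : U -> V) (N : set U) a b :
  {morph h : x y / x - y} -> injective h -> has_index (range h) a ->
  has_index N b -> has_index (h @` N) (a * b).
Proof.
move=> hB hi [f [fs ff]] [g [gs gg]].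
have [rep frep] := choice fs.
have /choice[co hco] : forall v, exists u, h u = v - rep (f v).
  by move=> v; have /ff[u _ <-] : f v = f (rep (f v)); [rewrite frep|exists u].
have -> : (a * b)%N = #|{: 'I_a * 'I_b}| by rewrite card_prod !card_ord.
apply: (has_index_fin (f := fun v => (f v, g (co v)))) => [[i j]|x y] /=.
  have [u <-] := gs j; exists (rep i + h u).
  have fi : f (rep i + h u) = i.
    by rewrite -[RHS]frep; apply/ff; exists u => //; rewrite addrAC subrr add0r.
  congr (_, _) => //; congr g; apply: hi.
  by rewrite hco fi addrAC subrr add0r.
split=> [[fxy /gg Ng]|[u Nu hu]].
  by exists (co x - co y) => //; rewrite hB !hco fxy opprB addrA subrK.
have fxy : f x = f y by apply/ff; exists u.
congr (_, _) => //; apply/gg; suff -> : co x - co y = u by [].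
by apply: hi; rewrite hB !hco hu fxy opprB addrA subrK.
Qed.

Lemma has_index_setT (M : zmodType) : has_index [set: M] 1.
Proof.
by exists (fun=> ord0); split=> [i|x y]; [exists 0; rewrite (ord1 i) | split].
Qed.

Lemma residue_has_index (o : idomainType) (pi : o) q :
  residue_field_card pi q -> has_index (principal pi) q.
Proof.
move=> h; apply/has_index_cosets => //.
exact: (submodule_subgroup (principal_ideal pi)).
Qed.

(** * Lattices in free modules *)

Section LinearMaps.
Variables (A : comNzRingType) (U V : lmodType A) (f : U -> V).
Hypothesis lf : linear f.

Lemma lin0 : f 0 = 0.
Proof. by have := lf (-1) 0 0; rewrite !scaler0 add0r scaleN1r addNr. Qed.
Lemma linD : {morph f : x y / x + y}.
Proof. by move=> x y; have := lf 1 x y; rewrite !scale1r. Qed.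
Lemma linZ a : {morph f : x / a *: x}.
Proof. by move=> x; have := lf a x 0; rewrite lin0 !addr0. Qed.
Lemma linB : {morph f : x y / x - y}.
Proof. by move=> x y; rewrite linD -[- y]scaleN1r linZ scaleN1r. Qed.
Lemma lin_inj : (forall x, f x = 0 -> x = 0) -> injective f.
Proof.
by move=> f0 x y fxy; apply/subr0_eq/f0; rewrite linB fxy subrr.
Qed.

Lemma submodule_image (N : set U) : is_submodule N -> is_submodule (f @` N).
Proof.
move=> sN; apply/submoduleP; split; first by exists 0; [apply: sm0 | apply: lin0].
move=> a _ _ [x Nx <-] [y Ny <-]; exists (a *: x + y); last by rewrite lf.
by apply: smD => //; apply: smZ.
Qed.

Lemma submodule_preimage (N : set V) : is_submodule N -> is_submodule (f @^-1` N).
Proof.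
move=> sN; apply/submoduleP; split; first by rewrite /= lin0; apply: sm0.
by move=> a x y Nx Ny; rewrite /= lf; apply: smD => //; apply: smZ.
Qed.
End LinearMaps.

Lemma submodule_setT (A : comNzRingType) (V : lmodType A) :
  is_submodule [set: V].
Proof. by apply/submoduleP; split. Qed.

(** Boundedness by a power of [pi] replaces finiteness of the index: the two are
    equivalent in free modules of finite rank, but this form passes to images and
    preimages under linear maps. *)
Definition lattice (o : idomainType) (pi : o) (V : lmodType o) (L : set V) :=
  is_submodule L /\ exists M, forall v, L (pi ^+ M *: v).

Section LocalParameter.
Variables (o : idomainType) (pi : o).
Hypothesis lp : local_parameter pi.

Lemma lp_neq0 : pi != 0. Proof. by case: lp. Qed.

Lemma not_principal1 : ~ principal pi 1.
Proof.
case: lp => _ /negP piN _ [x _ px]; apply: piN; apply/unitrP; exists x.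
by rewrite mulrC px.
Qed.

Lemma unit_not_principal x : x \is a GRing.unit <-> ~ principal pi x.
Proof.
have idp := principal_ideal pi; split=> [ux px|npx].
  apply: not_principal1; rewrite -(mulVr ux); exact: (smZ idp _ px).
by case: lp => _ _ /(_ x)[//|[y xy]]; case: npx; exists y.
Qed.

Lemma unit_1sub_expr d : (0 < d)%N -> 1 - pi ^+ d \is a GRing.unit.
Proof.
case: d => // d _; apply/unit_not_principal => -[x _ px].
apply: not_principal1; exists (x + pi ^+ d) => //.
by rewrite mulrDr px exprS subrK.
Qed.

(** By pigeonhole two of the vectors [pi ^+ j *: v], [j <= K], agree modulo a
    submodule of index [K]. *)
Lemma finite_index_lattice (V : lmodType o) (L : set V) K :
  is_submodule L -> has_index L K -> forall v, L (pi ^+ K *: v).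
Proof.
move=> sL [f [fs ff]] v.
have : ~~ injectiveb [ffun j : 'I_K.+1 => f (pi ^+ j *: v)].
  apply/negP => /injectiveP/leq_card; rewrite !card_ord; by rewrite ltnn.
move=> /injectivePn [j [l jl]]; rewrite !ffunE => fjl.
wlog {jl} jl : j l fjl / (j < l)%N.
  move=> hw; have [jl'|lj|/val_inj e] := ltngtP j l; first exact: (hw _ _ fjl).
    exact: (hw _ _ (esym fjl)).
  by rewrite e eqxx in jl.
have Lj : L (pi ^+ j *: v).
  have /(ff _ _).1 := fjl.
  rewrite -[in pi ^+ l](subnKC (ltnW jl)) exprD -scalerBl -[X in X - _]mulr1.
  rewrite -mulrBr mulrC -scalerA => /(smZ sL (1 - pi ^+ (l - j))^-1).
  rewrite [_ *: (_ *: (_ *: _))]scalerA mulVr ?scale1r //.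
  by rewrite unit_1sub_expr // subn_gt0.
have jK : (j <= K)%N by rewrite -ltnS.
by rewrite -(subnKC jK) exprD mulrC -scalerA; apply: smZ.
Qed.

Lemma lattice_finite_index (V : lmodType o) (L : set V) :
  is_submodule L -> finite_index L -> lattice pi L.
Proof.
move=> sL fL; split=> //; exists (submod_index L); apply: finite_index_lattice => //.
exact: (finite_has_index (submodule_subgroup sL)).
Qed.

Lemma lattice_setT (V : lmodType o) : lattice pi [set: V].
Proof. by split; [apply: submodule_setT | exists 0%N]. Qed.
End LocalParameter.

Section FreeModule.
Variables (o : idomainType) (I : finType).
Local Notation V := {ffun I -> o^o}.
Implicit Types (u v w : V) (k : I) (C : {set I}).

Definition unit_vec k : V := [ffun i => (i == k)%:R].

Definition scale_on (pi : o) (C : {set I}) v : V :=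
  [ffun i => if i \in C then pi * v i else v i].

Definition transvection k u v : V := v + v k *: u.

Definition kill k v : V := v - v k *: unit_vec k.

Lemma sum_unit_vec v : v = \sum_k v k *: unit_vec k.
Proof.
apply/ffunP => i; rewrite sum_ffunE (bigD1 i) //= !ffunE eqxx.
rewrite big1 ?addr0 => [|j ji]; first by rewrite [_ *: _]mulr1.
by rewrite !ffunE eq_sym (negPf ji) [_ *: _]mulr0.
Qed.

Lemma killE k v i : kill k v i = if i == k then 0 else v i.
Proof.
rewrite !ffunE; case: eqP => [->|_]; first by rewrite [_ *: _]mulr1 subrr.
by rewrite [_ *: _]mulr0 subr0.
Qed.

Lemma killK k v : kill k v + v k *: unit_vec k = v.
Proof. by rewrite subrK. Qed.

Lemma kill_id k v : v k = 0 -> kill k v = v.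
Proof. by rewrite /kill => ->; rewrite scale0r subr0. Qed.

Lemma linear_scale_on pi C : linear (scale_on pi C).
Proof.
move=> a u v; apply/ffunP => i; rewrite !ffunE; case: ifP => // _.
by rewrite mulrDr; congr (_ + _); rewrite [LHS]mulrCA.
Qed.

Lemma linear_kill k : linear (kill k).
Proof.
move=> a u v; apply/ffunP => i.
have e : (a *: kill k u + kill k v) i = a *: kill k u i + kill k v i.
  by rewrite !ffunE.
rewrite e !killE; case: ifP => _; rewrite ?scaler0 ?addr0 //.
by rewrite !ffunE.
Qed.

Lemma linear_transvection k u : linear (transvection k u).
Proof.
move=> a v w; rewrite /transvection !ffunE scalerDr scalerA scalerDl.
by rewrite addrACA.
Qed.

Lemma transvection_coord k u v : u k = 0 -> transvection k u v k = v k.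
Proof. by move=> uk; rewrite !ffunE uk [_ *: _]mulr0 addr0. Qed.

Lemma transvectionD k u w v : w k = 0 ->
  transvection k u (transvection k w v) = transvection k (u + w) v.
Proof.
move=> wk; rewrite {1}/transvection transvection_coord // /transvection.
by rewrite scalerDr -addrA [_ *: w + _]addrC.
Qed.

Lemma transvection0 k v : transvection k 0 v = v.
Proof. by rewrite /transvection scaler0 addr0. Qed.

Lemma transvectionK k u : u k = 0 -> cancel (transvection k u) (transvection k (- u)).
Proof. by move=> uk v; rewrite transvectionD // addNr transvection0. Qed.

Lemma transvectionVK k u : u k = 0 -> cancel (transvection k (- u)) (transvection k u).
Proof.
move=> uk v; rewrite transvectionD ?subrr ?transvection0 //.
by rewrite ffunE uk oppr0.
Qed.

Lemma transvection_image k u (L : set V) : u k = 0 ->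
  transvection k u @` L = transvection k (- u) @^-1` L.
Proof.
move=> uk; apply/seteqP; split=> [_ [v Lv <-]|v Lv] /=.
  by rewrite transvectionK.
by exists (transvection k (- u) v) => //; rewrite transvectionVK.
Qed.

Lemma transvection_image_setT k u : u k = 0 ->
  transvection k u @` [set: V] = [set: V].
Proof. by move=> uk; rewrite transvection_image. Qed.

Lemma scale_on0 pi v : scale_on pi finset.set0 v = v.
Proof. by apply/ffunP => i; rewrite ffunE finset.in_set0. Qed.

Lemma scale_onU1 pi k C v : k \notin C ->
  scale_on pi (k |: C)%SET v = scale_on pi [set k]%SET (scale_on pi C v).
Proof.
move=> kC; apply/ffunP => i; rewrite !ffunE !inE.
by case: eqP => [->|_] //=; rewrite (negPf kC).
Qed.

Lemma scale_on_unit_vec pi C k : k \notin C ->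
  scale_on pi C (unit_vec k) = unit_vec k.
Proof.
move=> kC; apply/ffunP => i; rewrite !ffunE.
by case: eqP => [->|_]; [rewrite (negPf kC)|rewrite mulr0 if_same].
Qed.

Lemma scale_on_inj pi C : pi != 0 -> injective (scale_on pi C).
Proof.
move=> pi0; apply: lin_inj => [|v v0]; first exact: linear_scale_on.
apply/ffunP => i; have := congr1 (fun w : V => w i) v0; rewrite !ffunE.
by case: ifP => // _ /eqP; rewrite mulf_eq0 (negPf pi0) => /eqP.
Qed.

Lemma range_scale_on pi C :
  range (scale_on pi C) = [set v | forall i, i \in C -> principal pi (v i)].
Proof.
apply/seteqP; split=> [_ [v _ <-] i iC|v vC] /=.
  by rewrite ffunE iC; exists (v i).
have /choice[w hw] : forall i, exists x, if i \in C then pi * x = v i else x = v i.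
  move=> i; case iC: (i \in C); last by exists (v i).
  by have [x _ <-] := vC i iC; exists x.
exists [ffun i => w i] => //; apply/ffunP => i; rewrite !ffunE.
by have := hw i; case: ifP.
Qed.

Lemma has_index_scale_on pi C q : pi != 0 -> has_index (principal pi) q ->
  has_index (range (scale_on pi C)) (q ^ #|C|).
Proof.
move=> pi0 hq; move: {2}#|C| (erefl #|C|) => n; elim: n C => [|n IHn] C cC.
  have -> : range (scale_on pi C) = [set: V].
    rewrite (finset.cards0_eq cC); apply/seteqP; split=> // v _.
    by exists v; rewrite ?scale_on0.
  by rewrite cC; apply: has_index_setT.
have [k kC] : exists k, k \in C by apply/finset.set0Pn; rewrite -card_gt0 cC.
rewrite -(finset.setD1K kC); set D := (C :\ k)%SET.
have kD : k \notin D by rewrite !inE eqxx.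
have cD : #|D| = n by have := finset.cardsD1 k C; rewrite cC kC => -[].
rewrite finset.cardsU1 kD expnD expn1.
have -> : range (scale_on pi (k |: D)%SET) =
          scale_on pi [set k]%SET @` range (scale_on pi D).
  apply/seteqP; split=> [_ [v _ <-]|_ [_ [v _ <-] <-]].
    by exists (scale_on pi D v); [exists v | rewrite scale_onU1].
  by exists v; rewrite ?scale_onU1.
apply: has_index_image; [exact: (linB (linear_scale_on _ _))
  |exact: scale_on_inj | | exact: IHn].
rewrite range_scale_on.
have -> : (fun v : V => [set v | forall i, i \in [set k]%SET -> principal pi (v i)] v) =
          (fun v : V => v k) @^-1` principal pi.
  by apply/seteqP; split=> v /= vk; [apply: vk; rewrite inE|
    move=> i; rewrite inE => /eqP->].
apply: has_index_preimage => //; first by move=> u v; rewrite !ffunE.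
by move=> x; exists (x *: unit_vec k); rewrite !ffunE eqxx [_ *: _]mulr1.
Qed.
End FreeModule.

Section LatticeClass.
Variables (o : idomainType) (pi : o) (q : nat) (I : finType).
Hypothesis lp : local_parameter pi.
Hypothesis hq : has_index (principal pi) q.
Local Notation V := {ffun I -> o^o}.
Implicit Types (u v w : V) (k : I) (C A : {set I}) (L : set V).

(** Moving the indices one by one into [C] or [A] enumerates all lattices: [C]
    collects the indices without a pivot, [A] those whose pivot has been
    straightened to a unit vector. *)
Definition lattice_class C A : set (set V) :=
  [set L | [/\ lattice pi L, forall k, k \in A -> L (unit_vec o k)
             & forall v l, L v -> l \in C -> principal pi (v l)]].

Definition has_pivot k L : Prop := exists2 w, L w & w k = 1.

(** A lattice with a pivot at [k] is the image under a transvection along [k] of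
    its saturation, which contains the [k]-th unit vector ([saturate_eq]). *)
Definition saturate k L : set V := [set v | L (kill k v)].

(** If the [k]-th coordinates do not all lie in the maximal ideal, one of them is
    a unit. *)
Lemma lattice_class_pivot C A k L : lattice_class C A L ->
  lattice_class (k |: C)%SET A L \/ has_pivot k L.
Proof.
move=> [lL LA LC]; have sL := lL.1.
have [[w Lw /(unit_not_principal lp) uw]|npiv] :=
    pselect (exists2 w, L w & ~ principal pi (w k)).
  right; exists ((w k)^-1 *: w); first exact: smZ.
  by rewrite ffunE [_ *: _]mulVr.
left; split=> // v l Lv; rewrite !inE => /orP[/eqP->|]; last exact: LC.
by have [//|npv] := pselect (principal pi (v k)); case: npiv; exists v.
Qed.

Lemma has_pivotN C A k L : lattice_class (k |: C)%SET A L -> ~ has_pivot k L.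
Proof.
move=> [_ _ LC] [w Lw wk]; apply: (not_principal1 lp); rewrite -wk.
by apply: LC; rewrite ?inE ?eqxx.
Qed.

Lemma saturate_eq k L w : is_submodule L -> L w -> w k = 1 ->
  L = transvection k (kill k w) @` saturate k L.
Proof.
move=> sL Lw wk; have e v : kill k v + v k *: w = transvection k (kill k w) v.
  rewrite /transvection {1}/kill -addrA; congr (_ + _).
  by rewrite /kill scalerBr wk scale1r addrC.
apply/seteqP; split=> [x Lx|_ [y Ly <-]]; last first.
  by rewrite -e; apply: smD => //; apply: smZ.
exists (x - x k *: kill k w).
  rewrite /saturate /= (linB (linear_kill k)) (linZ (linear_kill k)).
  rewrite (@kill_id _ _ k (kill k w)) ?killE ?eqxx //.
  rewrite /kill wk scale1r scalerBr opprB addrA subrK.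
  by apply: smB => //; apply: smZ.
rewrite /transvection.
suff -> : (x - x k *: kill k w) k = x k by rewrite subrK.
have -> : (x - x k *: kill k w) k = x k - x k *: kill k w k by rewrite !ffunE.
by rewrite killE eqxx scaler0 subr0.
Qed.

Lemma saturate_class C A k L : k \notin C ->
  lattice_class C A L -> lattice_class C (k |: A)%SET (saturate k L).
Proof.
move=> kC [[sL [M hM]] LA LC]; split.
- split; first exact: (submodule_preimage (linear_kill k)).
  by exists M => v; rewrite /saturate /= (linZ (linear_kill k)).
- move=> l; rewrite !inE /saturate /= => /orP[/eqP->|lA].
    rewrite /kill !ffunE eqxx scale1r subrr; exact: sm0.
  have [->|kl] := eqVneq l k.
    by rewrite /kill !ffunE eqxx scale1r subrr; exact: sm0.
  by rewrite kill_id ?ffunE; [apply: LA | rewrite eq_sym (negPf kl)].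
- move=> v l Lv lC; have := LC _ _ Lv lC; rewrite killE.
  by case: eqP => // e; rewrite -e lC in kC.
Qed.

Lemma unsaturate_class C A k L u : k \notin A -> u k = 0 ->
  (forall l, l \in C -> principal pi (u l)) ->
  lattice_class C (k |: A)%SET L ->
  lattice_class C A (transvection k u @` L).
Proof.
move=> kA uk uC [[sL [M hM]] LA LC]; split.
- split; first exact: (submodule_image (linear_transvection k u)).
  exists M => v; rewrite transvection_image //=.
  by rewrite (linZ (linear_transvection k _)).
- move=> l lA; exists (unit_vec o l); first by apply: LA; rewrite !inE lA orbT.
  rewrite /transvection ffunE; case: eqP => [e|_]; first by rewrite -e e lA in kA *.
  by rewrite scale0r addr0.
- move=> _ l [v Lv <-] lC; rewrite !ffunE; have idp := principal_ideal pi.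
  by apply: (smD idp); [apply: LC | apply: (smZ idp); apply: uC].
Qed.

Lemma has_pivot_transvection C A k L u : u k = 0 ->
  lattice_class C (k |: A)%SET L -> has_pivot k (transvection k u @` L).
Proof.
move=> uk [_ LA _]; exists (transvection k u (unit_vec o k)).
  by exists (unit_vec o k) => //; apply: LA; rewrite !inE eqxx.
by rewrite transvection_coord // ffunE eqxx.
Qed.

Lemma saturate_unit_vec k L v : is_submodule L -> L (unit_vec o k) ->
  L (kill k v) <-> L v.
Proof.
move=> sL Lk; split=> Lv; last by apply: smB => //; apply: smZ.
by rewrite -(killK k v); apply: smD => //; apply: smZ.
Qed.

Lemma saturate_transvection k L u : u k = 0 -> is_submodule L ->
  L (unit_vec o k) -> saturate k (transvection k u @` L) = L.
Proof.
move=> uk sL Lk; rewrite transvection_image //; apply/seteqP.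
suff e v : saturate k (transvection k (- u) @^-1` L) v <-> L v.
  by split=> v /e.
rewrite /saturate /= /transvection killE eqxx scale0r addr0.
exact: saturate_unit_vec.
Qed.

Lemma eq_transvection_image k L u w : u k = 0 -> w k = 0 ->
  is_submodule L -> L (unit_vec o k) ->
  transvection k u @` L = transvection k w @` L <-> L (u - w).
Proof.
move=> uk wk sL Lk; split=> [e|Luw].
  have : (transvection k u @` L) (transvection k u (unit_vec o k)).
    by exists (unit_vec o k).
  rewrite e transvection_image //= transvectionD // addrC.
  rewrite /transvection ffunE eqxx scale1r [unit_vec _ _ + _]addrC.
  exact: (smDr sL Lk).
have sub (x y : V) : x k = 0 -> y k = 0 -> L (x - y) ->
    transvection k x @` L `<=` transvection k y @` L.
  move=> xk yk Lxy _ [v Lv <-]; rewrite transvection_image //= transvectionD //.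
  by rewrite addrC; apply: smD => //; apply: smZ.
apply/seteqP; split; apply: sub => //.
by rewrite -opprB; apply: smN.
Qed.

(** By [saturate_eq], a lattice with saturation [L] is given by any of its vectors
    with [k]-th coordinate 1; the constraint [C] makes the other coordinates of
    that vector those of some [scale_on pi C u]. *)
Lemma pivot_fiber C A k L : k \notin C -> k \notin A ->
  lattice_class C (k |: A)%SET L ->
  [set L' | [/\ lattice_class C A L', has_pivot k L' & saturate k L' = L]] =
  range (fun u => transvection k (kill k (scale_on pi C u)) @` L).
Proof.
move=> kC kA LL; have [[sL _] LA LC] := LL.
have Lk : L (unit_vec o k) by apply: LA; rewrite !inE eqxx.
apply/seteqP; split=> [L' [L'CA [w L'w wk] satL']|_ [u _ <-]] /=.
  have [[sL' _] _ L'C] := L'CA.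
  have [u uw] : exists u, scale_on pi C u = kill k w.
    suff : range (scale_on pi C) (kill k w) by case=> u _; exists u.
    rewrite range_scale_on => i iC; rewrite killE; case: eqP => [e|_].
      by rewrite -e iC in kC.
    exact: L'C.
  exists u => //; rewrite uw kill_id ?killE ?eqxx // -satL'.
  by rewrite -(saturate_eq sL' L'w wk).
have uk : kill k (scale_on pi C u) k = 0 by rewrite killE eqxx.
split; [|exact: (has_pivot_transvection _ LL)|exact: saturate_transvection].
apply: unsaturate_class => // l lC; rewrite killE ffunE lC.
by case: eqP => [_|_]; [apply: (sm0 (principal_ideal pi)) | exists (u l)].
Qed.

Lemma pivot_fiber_eq C A k L u v : lattice_class C (k |: A)%SET L ->
  transvection k (kill k (scale_on pi C u)) @` L =
  transvection k (kill k (scale_on pi C v)) @` L <->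
  (scale_on pi C @^-1` L) (u - v).
Proof.
move=> [[sL _] LA _].
have Lk : L (unit_vec o k) by apply: LA; rewrite !inE eqxx.
rewrite eq_transvection_image ?killE ?eqxx //.
rewrite -(linB (linear_kill k)) -(linB (linear_scale_on pi C)).
exact: saturate_unit_vec.
Qed.

Lemma class_scale_on C A L : lattice_class C A L ->
  L = scale_on pi C @` (scale_on pi C @^-1` L).
Proof.
move=> [_ _ LC]; apply/seteqP; split=> [v Lv|_ [v Lv <-] //].
have : range (scale_on pi C) v.
  by rewrite range_scale_on => i iC; apply: LC.
by move=> [u _ uv]; exists u => //=; rewrite uv.
Qed.

(** Scaling on [C] gains one power of [pi]: on the unit vectors in [C] it supplies
    a factor [pi], and the others lie in [L]. *)
Lemma scale_on_split C L v M : is_submodule L ->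
  (forall k, k \notin C -> L (unit_vec o k)) ->
  (forall v, L (pi ^+ M.+1 *: v)) -> L (scale_on pi C (pi ^+ M *: v)).
Proof.
move=> sL LA hM; rewrite [X in scale_on _ _ X]sum_unit_vec.
elim/big_ind: _ => [|x y Lx Ly|k _].
- by rewrite (lin0 (linear_scale_on _ _)); apply: sm0.
- by rewrite (linD (linear_scale_on _ _)); apply: smD.
rewrite (linZ (linear_scale_on _ _)); have [kC|kC] := boolP (k \in C); last first.
  by rewrite scale_on_unit_vec //; apply: smZ => //; apply: LA.
suff -> : (pi ^+ M *: v) k *: scale_on pi C (unit_vec o k) =
          v k *: (pi ^+ M.+1 *: unit_vec o k) by apply: smZ.
apply/ffunP => i; rewrite !ffunE; case: eqP => [->|_].
  by rewrite kC /GRing.scale /= exprSr; ring.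
by rewrite mulr0 if_same /GRing.scale /= !mulr0.
Qed.

Lemma scale_on_class C L : lattice_class finset.set0 (~: C)%SET L ->
  lattice_class C (~: C)%SET (scale_on pi C @` L).
Proof.
move=> [[sL [M hM]] LA _]; split.
- split; first exact: (submodule_image (linear_scale_on _ _)).
  exists M.+1 => v; exists (pi ^+ M *: scale_on pi (~: C)%SET v); first exact: hM.
  apply/ffunP => i; rewrite !ffunE inE.
  by case: (i \in C); rewrite /= /GRing.scale /= exprS; ring.
- move=> k kC; exists (unit_vec o k); first exact: LA.
  by rewrite scale_on_unit_vec // -finset.in_setC.
- by move=> _ l [v Lv <-] lC; rewrite ffunE lC; exists (v l).
Qed.

Lemma class_preimage C L : lattice_class C (~: C)%SET L ->
  lattice_class finset.set0 (~: C)%SET (scale_on pi C @^-1` L).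
Proof.
move=> [[sL [M hM]] LA LC]; split; last by move=> v l _; rewrite inE.
- split; first exact: (submodule_preimage (linear_scale_on _ _)).
  exists M => v /=; apply: scale_on_split => // [k kC|w].
    by apply: LA; rewrite inE.
  by rewrite exprS -scalerA; apply: smZ.
- by move=> k kC /=; rewrite scale_on_unit_vec; [apply: LA | rewrite inE in kC].
Qed.

(** Every lattice arises from the whole module by transvections and partial
    scalings: pivots dispose of the indices outside some set [C], and undoing the
    scaling on [C] lowers the exponent [M] for which [pi ^+ M] maps the module
    into the lattice. *)
Lemma lattice_rect (P : set V -> Prop) :
  P [set: V] ->
  (forall k u L, u k = 0 -> lattice pi L -> P L -> P (transvection k u @` L)) ->
  (forall C L, C != finset.set0 -> lattice_class finset.set0 (~: C)%SET L ->
     P L -> P (scale_on pi C @` L)) ->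
  forall L, lattice pi L -> P L.
Proof.
move=> PT Ptr Psc L [sL [M hM]]; elim: M L sL hM => [|M IHM] L sL hM.
  suff -> : L = [set: V] by [].
  by apply/seteqP; split=> // v _; rewrite -[v]scale1r; apply: hM.
suff: forall n C A L, (#|~: (C :|: A)| <= n)%N -> (C :&: A = finset.set0)%SET ->
    (forall v, L (pi ^+ M.+1 *: v)) -> lattice_class C A L -> P L.
  move/(_ #|I| finset.set0 finset.set0); apply=> //; first exact: max_card.
    by rewrite finset.setI0.
  by split; [split=> //; exists M.+1 | move=> k; rewrite inE
            | move=> v l _; rewrite inE].
move=> {L sL hM} n; elim: n => [|n IHn] C A L nCA CA hM LCA.
  have AC : A = (~: C)%SET.
    apply/eqP; rewrite finset.eqEsubset -finset.disjoints_subset.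
    rewrite -finset.setI_eq0 finset.setIC CA eqxx /=.
    move: nCA; rewrite leqn0 finset.cards_eq0 finset.setCU => /eqP e.
    by rewrite -[A]finset.setCK -finset.disjoints_subset -finset.setI_eq0 e.
  move: LCA; rewrite AC => LC; rewrite (class_scale_on LC).
  have [C0|Cn0] := eqVneq C finset.set0.
    have [[sL _] LA _] := LC.
    suff -> : scale_on pi C @` (scale_on pi C @^-1` L) = [set: V] by [].
    rewrite -(class_scale_on LC); apply/seteqP; split=> // v _.
    rewrite (sum_unit_vec v); apply: sm_sum => // i _; apply: smZ => //.
    by apply: LA; rewrite C0 !inE.
  apply: Psc => //; first exact: class_preimage.
  have [[sL _] LA _] := LC.
  apply: IHM => [|v /=]; first exact: (submodule_preimage (linear_scale_on _ _)).
  by apply: scale_on_split => // k kC; apply: LA; rewrite inE.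
have [e|/finset.set0Pn[k]] := eqVneq (~: (C :|: A))%SET finset.set0.
  by apply: (IHn C A) => //; rewrite e finset.cards0.
rewrite !inE negb_or => /andP[kC kA].
have lt D B : (~: (D :|: B) = (~: (C :|: A)) :\ k)%SET -> (#|~: (D :|: B)| <= n)%N.
  move=> ->; have := finset.cardsD1 k (~: (C :|: A)).
  rewrite !inE negb_or kC kA /= => e.
  by move: nCA; rewrite e.
have [LC|[w Lw wk]] := lattice_class_pivot k LCA.
  apply: (IHn (k |: C)%SET A) => //.
    by apply: lt; apply/setP => i; rewrite !inE -orbA negb_or.
  apply/setP => i; have := congr1 (fun D : {set I} => i \in D) CA; rewrite !inE.
  by case: eqP => [->|//]; rewrite (negPf kA) andbF.
have [lL _ _] := LCA.
rewrite (saturate_eq lL.1 Lw wk); apply: Ptr.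
- by rewrite killE eqxx.
- by case: (saturate_class kC LCA).
apply: (IHn C (k |: A)%SET); last exact: saturate_class.
- by apply: lt; apply/setP => i; rewrite !inE orbCA negb_or.
- apply/setP => i; have := congr1 (fun D : {set I} => i \in D) CA; rewrite !inE.
  by case: eqP => [->|//]; rewrite (negPf kC).
- by move=> v; rewrite /saturate /= (linZ (linear_kill k)).
Qed.

(** Transvections and partial scalings are injective linear maps whose images
    have indices powers of [q], and every lattice is reached by them. *)
Lemma lattice_free L : lattice pi L ->
  (exists th : V -> V, [/\ linear th, injective th & L = range th]) /\
  exists e, has_index L (q ^ e).
Proof.
move: L; apply: lattice_rect.
- split; last by exists 0%N; apply: has_index_setT.
  by exists id; split=> //; apply/seteqP; split=> // v _; exists v.
- move=> k u L uk _ [[th [lth ith ->]] [j hj]]; split.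
    exists (transvection k u \o th); split.
    + by move=> a x y /=; rewrite lth (linear_transvection k u).
    + exact: (inj_comp (can_inj (transvectionK uk)) ith).
    + apply/seteqP; split=> [_ [_ [v _ <-] <-]|_ [v _ <-]]; first by exists v.
      by exists (th v) => //; exists v.
  exists j; rewrite -[(q ^ j)%N]mul1n; apply: has_index_image => //.
  + exact: (linB (linear_transvection k u)).
  + exact: (can_inj (transvectionK uk)).
  + by rewrite transvection_image_setT //; apply: has_index_setT.
- move=> C L _ _ [[th [lth ith ->]] [j hj]]; split.
    exists (scale_on pi C \o th); split.
    + by move=> a x y /=; rewrite lth linear_scale_on.
    + exact: (inj_comp (scale_on_inj (lp_neq0 lp)) ith).
    + apply/seteqP; split=> [_ [_ [v _ <-] <-]|_ [v _ <-]]; first by exists v.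
      by exists (th v) => //; exists v.
  exists (#|C| + j)%N; rewrite expnD; apply: has_index_image => //.
  + exact: (linB (linear_scale_on _ _)).
  + exact: (scale_on_inj (lp_neq0 lp)).
  + exact: has_index_scale_on (lp_neq0 lp) hq.
Qed.
End LatticeClass.

(** * Sums over lattices *)

Section Esum.
Variables (R : realType) (T : choiceType).
Local Open Scope ereal_scope.

Lemma esumZl (S : set T) (a : T -> \bar R) (c : R) : (0 < c)%R ->
  (forall i, 0 <= a i) ->
  \esum_(i in S) (c%:E * a i) = c%:E * \esum_(i in S) a i.
Proof.
have le (d : R) (b : T -> \bar R) : (0 < d)%R -> (forall i, 0 <= b i) ->
    \esum_(i in S) (d%:E * b i) <= d%:E * \esum_(i in S) b i.
  move=> d0 b0; apply: ge_ereal_sup => _ [F [finF FS] <-].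
  rewrite -ge0_mule_fsumr //.
    apply: lee_wpmul2l; first by rewrite lee_fin ltW.
  by apply: esum_ge; exists F.
move=> c0 a0; apply/eqP; rewrite eq_le le //=.
have ca0 i : 0 <= c%:E * a i by apply: mule_ge0; rewrite // lee_fin ltW.
have cV0 : (0 < c^-1)%R by rewrite invr_gt0.
have := le _ _ cV0 ca0.
rewrite (eq_esum (b := a)) => [h|i _]; last first.
  by rewrite muleA -EFinM mulVf ?mul1e // gt_eqF.
have := @lee_wpmul2l _ c%:E _ _ _ h.
by rewrite muleA -EFinM divff ?mul1e ?gt_eqF //; apply; rewrite lee_fin ltW.
Qed.

Lemma esum_const (S : set T) (K : nat) (c : \bar R) : S #= `I_K -> 0 <= c ->
  \esum_(i in S) c = K%:R%:E * c.
Proof.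
move=> SK c0; have finS : finite_set S by exists K.
rewrite esum_fset //; rewrite fsbig_finite //= big_const_seq count_predT.
rewrite (card_fset_set SK); elim: K {SK} => [|K IH] /=; first by rewrite mul0e.
by rewrite IH -natr1 EFinD ge0_muleDl ?lee_fin // mul1e addeC.
Qed.
End Esum.

(** Summation over the graph of [h], in either order. *)
Lemma esum_fibers (R : realType) (T U : choiceType) (h : T -> U) (P : set T)
    (Q : set U) (a : T -> \bar R) :
  (forall x, P x -> Q (h x)) -> (forall x, 0 <= a x)%E ->
  \esum_(i in P) a i = \esum_(j in Q) \esum_(i in P `&` h @^-1` [set j]) a i.
Proof.
move=> PQ a0; rewrite esum_esum //.
apply: (@reindex_esum _ _ _ _ _ (fun ji : U * T => ji.2) a); split.
- by move=> [j i] /= [_ []].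
- by move=> [j i] [j' i']; rewrite !inE /= => -[_ [_ <-]] [_ [_ <-]] ->.
- by move=> i Pi; exists (h i, i) => //; split; [apply: PQ | split].
Qed.

Lemma range_card (U : zmodType) (T : Type) (N : set U) (g : U -> T) K :
  has_index N K -> (forall x y, g x = g y <-> N (x - y)) -> range g #= `I_K.
Proof.
move=> [f [fs ff]] gN.
pose rep t := xget (0 : U) [set u | g u = t].
have repK u : g (rep (g u)) = g u by rewrite /rep; case: xgetP => [y _ //|/(_ u)] [].
apply/card_set_bijP; exists (fun t => f (rep t) : nat); split.
- by move=> t _ /=; exact: ltn_ord.
- move=> s t; rewrite !inE => -[u _ <-] [v _ <-] /val_inj /ff/gN.
  by rewrite !repK.
- move=> i iK; have [u fu] := fs (Ordinal iK); exists (g u); first by exists u.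
  suff -> : f (rep (g u)) = f u by rewrite fu.
  by apply/ff/gN.
Qed.

Section LatticeSum.
Variables (R : realType) (o : idomainType) (pi : o) (q : nat) (I : finType).
Hypothesis lp : local_parameter pi.
Hypothesis hq : has_index (principal pi) q.
Local Notation V := {ffun I -> o^o}.
Variables (wt : set V -> nat) (beta : nat -> nat).

(** The sum of a function of the weight over all lattices only needs the weight
    to be invariant under transvections and to grow by [beta #|C|] when the
    coordinates in [C] are multiplied by [pi]. *)
Definition scaling_weight : Prop :=
  [/\ wt [set: V] = 0,
      forall k (u : V) L, u k = 0 -> lattice pi L ->
        wt (transvection k u @` L) = wt L &
      forall C L, lattice_class pi finset.set0 (~: C)%SET L ->
        wt (scale_on pi C @` L) = (beta #|C| + wt L)%N].
Hypothesis hwt : scaling_weight.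

Local Open Scope ereal_scope.

(** The factor [submod_index L ^ #|A|] makes the recursions close up: moving an
    index [k] to [A] multiplies the terms by the number of transvections along
    [k] that lead to different lattices, which is the index up to a power of
    [q]. *)
Definition class_sum (C A : {set I}) (G : nat -> \bar R) : \bar R :=
  \esum_(L in lattice_class pi C A) ((submod_index L ^ #|A|)%:R%:E * G (wt L)).

Lemma q_gt0 : (0 < q)%N. Proof. exact: has_index_gt0 hq. Qed.

Lemma q_gt1 : (1 < q)%N.
Proof.
rewrite ltn_neqAle (has_index_gt0 hq) andbT; apply/eqP => q1.
move: hq; rewrite -q1 => -[f [_ ff]]; apply: (not_principal1 lp).
by rewrite -[1%R]subr0; apply/ff; rewrite [f 1%R]ord1 [f 0%R]ord1.
Qed.

Lemma lattice_index (L : set V) : lattice pi L -> has_index L (submod_index L).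
Proof.
move=> lL; have [_ [e he]] := lattice_free lp hq lL.
by have [_ ->] := has_index_finite (submodule_subgroup lL.1) he.
Qed.

Lemma submod_index_transvection k (u : V) L : u k = 0%R -> lattice pi L ->
  submod_index (transvection k u @` L) = submod_index L.
Proof.
move=> uk lL; have hL : has_index (transvection k u @` L) (1 * submod_index L).
  apply: has_index_image; [exact: linB (linear_transvection k u)
    |exact: can_inj (transvectionK uk) | | exact: lattice_index].
  by rewrite transvection_image_setT //; apply: has_index_setT.
have sL := submodule_image (linear_transvection k u) lL.1.
have [_ ->] := has_index_finite (submodule_subgroup sL) hL.
by rewrite mul1n.
Qed.

Lemma submod_index_scale_on C (L : set V) : lattice pi L ->
  submod_index (scale_on pi C @` L) = (q ^ #|C| * submod_index L)%N.
Proof.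
move=> lL.
have hL : has_index (scale_on pi C @` L) (q ^ #|C| * submod_index L).
  apply: has_index_image; [exact: linB (linear_scale_on pi C)
    |exact: scale_on_inj (lp_neq0 lp) | | exact: lattice_index].
  exact: has_index_scale_on (lp_neq0 lp) hq.
have sL := submodule_image (linear_scale_on pi C) lL.1.
by have [_ ->] := has_index_finite (submodule_subgroup sL) hL.
Qed.

(** A lattice outside the first class on the right has a pivot at [k]; grouping
    these by their saturation [L], each fiber consists of [|V : L| * q ^ -#|C|]
    lattices of the same weight. *)
Lemma class_sum_pivot (C A : {set I}) k (G : nat -> \bar R) :
  (forall i, 0 <= G i) -> k \notin C -> k \notin A ->
  class_sum C A G = class_sum (k |: C)%SET A G +
    ((q ^ #|C|)%:R^-1)%:E * class_sum C (k |: A)%SET G.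
Proof.
move=> G0 kC kA; rewrite /class_sum.
have F0 (B : {set I}) (L : set V) : 0 <= (submod_index L ^ #|B|)%:R%:E * G (wt L).
  by apply: mule_ge0.
rewrite (esumID (lattice_class pi (k |: C)%SET A)) //; congr (_ + _).
  congr esum; apply/seteqP; split=> [L [] //|L LkC]; split=> //.
  case: LkC => lL LA LC; split=> // v l Lv lC; apply: LC => //.
  by rewrite !inE lC orbT.
have fibE L : lattice_class pi C (k |: A)%SET L ->
    (lattice_class pi C A `&` ~` lattice_class pi (k |: C)%SET A) `&`
      saturate k @^-1` [set L] =
    range (fun u => transvection k (kill k (scale_on pi C u)) @` L).
  move=> LL; rewrite -(pivot_fiber kC kA LL); apply/seteqP.
  split=> [L' [[L'CA nL'] satL']|L' [L'CA piv satL']]; split=> //.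
    by have [] := lattice_class_pivot lp k L'CA.
  by split=> // /(has_pivotN lp).
rewrite (@esum_fibers _ _ _ (saturate k) _ (lattice_class pi C (k |: A)%SET)) //;
  last by move=> L [LCA _]; apply: saturate_class.
rewrite -esumZl //; last by rewrite invr_gt0 ltr0n expn_gt0 q_gt0.
apply: eq_esum => L LL.
have [lL LA LC] := LL; have Lk : L (unit_vec o k) by apply: LA; rewrite !inE eqxx.
pose N := scale_on pi C @^-1` L.
have LN : L = scale_on pi C @` N := class_scale_on LL.
have sN : is_submodule N := submodule_preimage (linear_scale_on pi C) lL.1.
have lN : lattice pi N.
  have [sL [M hM]] := lL; split=> //; exists M => v.
  by rewrite /N /= (linZ (linear_scale_on pi C)).
have cardL : submod_index L = (q ^ #|C| * submod_index N)%N.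
  by rewrite [in LHS]LN submod_index_scale_on.
rewrite fibE //; have constE L' :
    range (fun u => transvection k (kill k (scale_on pi C u)) @` L) L' -> (submod_index L' ^ #|A|)%:R%:E * G (wt L') =
    (submod_index L ^ #|A|)%:R%:E * G (wt L).
  move=> [u _ <-].
  by rewrite submod_index_transvection ?killE ?eqxx //; case: hwt => _ -> //;
    rewrite killE eqxx.
rewrite (eq_esum constE) (@esum_const _ _ _ (submod_index N)) //; last first.
  apply: range_card (lattice_index lN) _ => u v.
  exact: pivot_fiber_eq LL.
rewrite !muleA -!EFinM; congr (_%:E * _).
rewrite finset.cardsU1 kA expnS [in RHS]cardL -natrM mulnC !natrM.
rewrite -mulrA mulKf; last by rewrite pnatr_eq0 -lt0n expn_gt0 q_gt0.
by rewrite mulrC -cardL.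
Qed.

(** When [C] and [A] exhaust the indices, a lattice is the image under scaling by
    [pi] on [C] of a lattice with no constraint on [C]. *)
Lemma class_sum_scale C (G : nat -> \bar R) : (forall i, 0 <= G i) ->
  class_sum C (~: C)%SET G = (q ^ (#|C| * #|(~: C)%SET|))%:R%:E *
    class_sum finset.set0 (~: C)%SET (fun i => G (beta #|C| + i)%N).
Proof.
move=> G0; rewrite /class_sum -esumZl; [|by rewrite ltr0n expn_gt0 q_gt0|].
  rewrite (@reindex_esum _ _ _ (lattice_class pi finset.set0 (~: C)%SET)
     (lattice_class pi C (~: C)%SET) (fun L => scale_on pi C @` L)).
    apply: eq_esum => L LL; have [lL _ _] := LL; case: hwt => _ _ hsc.
    rewrite submod_index_scale_on // hsc // expnMn -expnM natrM EFinM.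
    by rewrite -muleA.
  split=> [L LL|L L' _ _|L LL]; first exact: scale_on_class.
    have inj := scale_on_inj (lp_neq0 lp).
    move=> e; apply/seteqP; split=> v Lv.
      have : (scale_on pi C @` L') (scale_on pi C v) by rewrite -e; exists v.
      by move=> [w L'w /inj <-].
    have : (scale_on pi C @` L) (scale_on pi C v) by rewrite e; exists v.
    by move=> [w L'w /inj <-].
  exists (scale_on pi C @^-1` L); first exact: class_preimage.
  by rewrite -(class_scale_on LL).
by move=> L; apply: mule_ge0.
Qed.

Lemma class_sum_full (G : nat -> \bar R) : (forall i, 0 <= G i) ->
  class_sum finset.set0 finset.setT G = G 0%N.
Proof.
move=> G0; rewrite /class_sum.
have -> : lattice_class pi finset.set0 finset.setT = [set [set: V]].
  apply/seteqP; split=> [L [[sL _] LA _]|_ ->] /=.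
    apply/seteqP; split=> // v _; rewrite (sum_unit_vec v).
    by apply: sm_sum => // i _; apply: smZ => //; apply: LA; rewrite inE.
  by split=> //; [apply: lattice_setT | move=> v l _; rewrite inE].
rewrite esum_set1; last by apply: mule_ge0.
have [_ ->] := has_index_finite (submodule_subgroup (submodule_setT V))
                                (has_index_setT V).
by rewrite exp1n mul1e; case: hwt => ->.
Qed.
End LatticeSum.

(** * Convergence of the sums over lattices *)

Lemma esum_levels (R : realType) (T : choiceType) (P : set T) (w : T -> R)
    (h : T -> nat) (g : nat -> R) :
  (forall x, 0 <= w x) -> (forall k, 0 <= g k) ->
  (\esum_(i in P) (w i * g (h i))%:E =
   \sum_(0 <= k <oo) ((\esum_(i in P `&` h @^-1` [set k]) (w i)%:E) * (g k)%:E))%E.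
Proof.
move=> w0 g0; rewrite nneseries_esumT; last first.
  by move=> k; apply: mule_ge0; rewrite ?lee_fin //; apply: esum_ge0 => x _; rewrite lee_fin.
rewrite (@esum_fibers _ _ _ h _ [set: nat]) //; last by move=> x; rewrite lee_fin mulr_ge0.
apply: eq_esum => k _.
have [g0k|gk] := eqVneq (g k) 0.
  by rewrite g0k mule0 esum1 // => i [_ /= ->]; rewrite g0k mulr0.
rewrite muleC -esumZl; [|by rewrite lt_neqAle eq_sym gk g0|by move=> i; rewrite lee_fin].
by apply: eq_esum => i [_ /= ->]; rewrite -EFinM mulrC.
Qed.

Section LatticeSeries.
Variables (R : realType) (o : idomainType) (pi : o) (q : nat) (I : finType).
Hypothesis lp : local_parameter pi.
Hypothesis hq : has_index (principal pi) q.
Local Notation V := {ffun I -> o^o}.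
Variables (wt : set V -> nat) (beta : nat -> nat).
Hypothesis hwt : scaling_weight pi wt beta.
Local Notation E := (@class_sum R o pi I wt).
Implicit Types (C A D : {set I}) (L : set V).
Local Open Scope ereal_scope.

(** The coefficient of [t ^ k] in [class_sum C A], as a power series in [t]. *)
Definition class_coef (C A : {set I}) (k : nat) : \bar R :=
  \esum_(L in lattice_class pi C A `&` wt @^-1` [set k]) (submod_index L ^ #|A|)%:R%:E.

Lemma class_coef_ge0 C A k : 0 <= class_coef C A k.
Proof. by apply: esum_ge0. Qed.

Lemma class_sum_series C A (g : nat -> R) : (forall k, (0 <= g k)%R) ->
  E C A (EFin \o g) = \sum_(0 <= k <oo) (class_coef C A k * (g k)%:E).
Proof.
move=> g0; rewrite -(@esum_levels _ _ _ (fun L => (submod_index L ^ #|A|)%:R%R)) //.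
Qed.

(** Coefficients are sums against an indicator function, so that the recursions
    of [class_sum] apply to them. *)
Definition delta (k : nat) : nat -> R := fun i => (i == k)%:R%R.

Lemma class_coefE C A k : class_coef C A k = E C A (EFin \o delta k).
Proof.
rewrite /class_coef esum_mkcondr; apply: eq_esum => L _ /=; rewrite /delta.
have -> : (L \in wt @^-1` [set k]) = (wt L == k).
  by apply/idP/eqP; rewrite inE.
by case: eqP => _; rewrite ?mule1 ?mule0.
Qed.

Lemma le_class_sum C A (G H : nat -> \bar R) : (forall i, G i <= H i) ->
  E C A G <= E C A H.
Proof. by move=> GH; apply: le_esum => L _; apply: lee_wpmul2l. Qed.

Lemma class_sum_ge0 C A (G : nat -> \bar R) : (forall i, 0 <= G i) -> 0 <= E C A G.
Proof. by move=> G0; apply: esum_ge0 => L _; apply: mule_ge0. Qed.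

Lemma class_sumZ C A (c : R) (G : nat -> \bar R) : (0 < c)%R ->
  (forall i, 0 <= G i) -> E C A (fun i => c%:E * G i) = c%:E * E C A G.
Proof.
move=> c0 G0; rewrite /class_sum -esumZl //; last by move=> L; apply: mule_ge0.
by apply: eq_esum => L _; rewrite muleCA.
Qed.

(** Every step of the pivot recursion at most doubles a bound that holds for the
    classes where all indices are assigned. *)
Lemma class_sum_le_ends (G : nat -> \bar R) (u : R) : (forall i, 0 <= G i) ->
  (forall D, E D (~: D)%SET G <= u%:E) ->
  forall C A, (C :&: A = finset.set0)%SET ->
  E C A G <= ((2 ^ #|~: (C :|: A)|)%:R * u)%:E.
Proof.
move=> G0 ends C A; move: {2}#|~: (C :|: A)| (erefl #|~: (C :|: A)|) => n.
elim: n C A => [|n IHn] C A nCA CA; rewrite nCA.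
  suff -> : A = (~: C)%SET by rewrite expn0 mul1r.
  apply/eqP; rewrite finset.eqEsubset -finset.disjoints_subset.
  rewrite -finset.setI_eq0 finset.setIC CA eqxx /=.
  move/eqP: nCA; rewrite finset.cards_eq0 finset.setCU => /eqP e.
  by rewrite -[A]finset.setCK -finset.disjoints_subset -finset.setI_eq0 e.
have /finset.set0Pn[k] : (~: (C :|: A))%SET != finset.set0.
  by rewrite -finset.cards_eq0 nCA.
rewrite !inE negb_or => /andP[kC kA].
have cardD D B : (~: (D :|: B) = (~: (C :|: A)) :\ k)%SET -> #|~: (D :|: B)| = n.
  move=> ->; have := finset.cardsD1 k (~: (C :|: A)).
  by rewrite !inE negb_or kC kA nCA => -[].
rewrite (class_sum_pivot lp hq hwt G0 kC kA) expnS natrM mulr_natl mulr2n mulrDl EFinD.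
apply: leeD.
  rewrite -(cardD (k |: C)%SET A) ?IHn ?cardD //.
  - by apply/setP => i; rewrite !inE -orbA negb_or.
  - apply/setP => i; have := congr1 (fun D : {set I} => i \in D) CA; rewrite !inE.
    by case: eqP => [->|//]; rewrite (negPf kA) andbF.
  - by apply/setP => i; rewrite !inE -orbA negb_or.
have e : (~: (C :|: (k |: A)) = (~: (C :|: A)) :\ k)%SET.
  by apply/setP => i; rewrite !inE orbCA negb_or.
apply: (@le_trans _ _ (1%:E * E C (k |: A)%SET G)).
  apply: lee_wpmul2r; first exact: class_sum_ge0.
  by rewrite lee_fin invf_le1 ?ler1n ?ltr0n expn_gt0 (q_gt0 hq).
rewrite mul1e -(cardD _ _ e) IHn ?cardD //.
apply/setP => i; have := congr1 (fun D : {set I} => i \in D) CA; rewrite !inE.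
by case: eqP => [->|//]; rewrite (negPf kC).
Qed.

Hypothesis beta_gt0 : forall j, (0 < j)%N -> (0 < beta j)%N.
Local Notation n := #|I|.

(** The bound [2 ^ n] is proved for the series truncated below degree [K], by
    induction on [K]: scaling by a nonempty [C] raises the degree, so the sums at
    the ends of the pivot recursion involve a shorter truncation, a factor [t],
    and a power of [q] that the smallness of [t] absorbs. *)
Lemma class_sum_lty (t : R) : (0 < t)%R -> (t * ((q ^ (n * n)) * 2 ^ n)%:R <= 1)%R ->
  E finset.set0 finset.set0 (fun k => (t ^+ k)%:E) < +oo.
Proof.
move=> t0 t1; pose g K k : R := if (k < K)%N then (t ^+ k)%R else 0%R.
have g0 K k : (0 <= g K k)%R by rewrite /g; case: ifP => // _; rewrite exprn_ge0 ?ltW.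
have tle1 : (t <= 1)%R.
  apply: le_trans t1; rewrite ler_peMr ?(ltW t0) //.
  by rewrite (ler_nat R 1) muln_gt0 !expn_gt0 (q_gt0 hq).
have bd K A : E finset.set0 A (EFin \o g K) <= (2 ^ n)%:R%:E.
  elim: K A => [|K IHK] A.
    by rewrite /class_sum esum1 ?lee_fin // => L _ /=; rewrite mule0.
  have := @class_sum_le_ends (EFin \o g K.+1) 1%R; move/(_ _ _ finset.set0 A).
  rewrite finset.set0I finset.set0U mulr1 => h.
  apply: le_trans (h _ _ _) _ => //; last first.
  - by rewrite lee_fin ler_nat leq_exp2l // max_card.
  - move=> D; have [->|D0] := eqVneq D finset.set0.
      rewrite finset.setC0 (class_sum_full hwt) /=; last by move=> i; rewrite lee_fin.
      by rewrite /g expr0.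
    rewrite (class_sum_scale lp hq hwt); last by move=> i; rewrite lee_fin.
    have le1 : E finset.set0 (~: D)%SET (fun i => (EFin \o g K.+1) (beta #|D| + i)%N)
        <= t%:E * (2 ^ n)%:R%:E.
      apply: (@le_trans _ _ (E finset.set0 (~: D)%SET (fun i => t%:E * (g K i)%:E))).
        apply: le_class_sum => i /=; rewrite -EFinM lee_fin /g.
        have b1 : (0 < beta #|D|)%N by apply: beta_gt0; rewrite card_gt0.
        case: ifP => [iK|_]; last by apply: mulr_ge0 (g0 K i); exact: ltW.
        have -> : (i < K)%N by lia.
        by rewrite -exprS ler_wiXn2l ?(ltW t0) //; lia.
      rewrite class_sumZ //; last by move=> i; rewrite lee_fin.
      by apply: lee_wpmul2l (IHK _); rewrite lee_fin ltW.
    apply: le_trans (lee_wpmul2l _ le1) _ => //.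
    rewrite -!EFinM lee_fin; apply: le_trans t1.
    rewrite mulrCA ler_pM2l // -natrM ler_nat leq_mul2r; apply/orP; right.
    by rewrite leq_pexp2l ?(q_gt0 hq) // leq_mul // max_card.
  - by move=> i; rewrite lee_fin.
rewrite -[X in E _ _ X]/(EFin \o fun k => (t ^+ k)%R).
rewrite class_sum_series; last by move=> k; rewrite exprn_ge0 ?ltW.
apply: (@le_lt_trans _ _ (2 ^ n)%:R%:E); last by rewrite ltry.
apply: lime_le.
  by apply: is_cvg_nneseries => k _ _; apply: mule_ge0; rewrite ?class_coef_ge0 //
     lee_fin exprn_ge0 ?ltW.
near=> K; apply: le_trans (bd K finset.set0); rewrite class_sum_series //.
apply: (@le_trans _ _ (\sum_(0 <= k < K) (class_coef finset.set0 finset.set0 k * (g K k)%:E))).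
  by rewrite !big_mkord; apply: lee_sum => k _; rewrite /g ltn_ord.
by apply: nneseries_lim_ge => k _ _; apply: mule_ge0; rewrite ?class_coef_ge0 // lee_fin.
Unshelve. all: by end_near. Qed.

Section Convergent.
Variable t : R.
Hypothesis t0 : (0 < t)%R.
Local Notation G := (fun k : nat => (t ^+ k)%:E).
Hypothesis fin : E finset.set0 finset.set0 G < +oo.

Let G0 i : 0 <= G i. Proof. by rewrite lee_fin exprn_ge0 ?ltW. Qed.

(** Both terms of the pivot recursion are nonnegative, so that finiteness for
    empty [C] and [A] passes to each class reached from there. *)
Lemma class_sum_fin C A : (C :&: A = finset.set0)%SET -> E C A G < +oo.
Proof.
move=> CA; have step C' A' k : k \notin C' -> k \notin A' -> E C' A' G < +oo ->
    E (k |: C')%SET A' G < +oo /\ E C' (k |: A')%SET G < +oo.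
  move=> kC kA; rewrite (class_sum_pivot lp hq hwt G0 kC kA) => h.
  have q0 : (0 < (q ^ #|C'|)%:R^-1 :> R)%R by rewrite invr_gt0 ltr0n expn_gt0 (q_gt0 hq).
  have e0 : 0 <= E (k |: C')%SET A' G by exact: class_sum_ge0.
  have e1 : 0 <= E C' (k |: A')%SET G by exact: class_sum_ge0.
  split; first by apply: le_lt_trans h; rewrite leeDl // mule_ge0 // lee_fin ltW.
  have : (q ^ #|C'|)%:R^-1%:E * E C' (k |: A')%SET G < +oo.
    by apply: le_lt_trans h; rewrite leeDr.
  by rewrite !ltey_eq; case: (E C' _ _) e1 => //=; rewrite gt0_muley ?lte_fin.
have finC : forall D : {set I}, E D finset.set0 G < +oo.
  move=> D; move: {2}#|D| (erefl #|D|) => d; elim: d D => [|d IHd] D cD.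
    by rewrite (finset.cards0_eq cD).
  have /finset.set0Pn[k kD] : D != finset.set0 by rewrite -finset.cards_eq0 cD.
  rewrite -(finset.setD1K kD); apply: (step _ _ _ _ _ _).1; rewrite ?inE ?eqxx //.
  by apply: IHd; have := finset.cardsD1 k D; rewrite kD cD => -[].
move: {2}#|A| (erefl #|A|) => d; elim: d A CA => [|d IHd] A CA cA.
  by rewrite (finset.cards0_eq cA).
have /finset.set0Pn[k kA] : A != finset.set0 by rewrite -finset.cards_eq0 cA.
have kC : k \notin C.
  apply/negP => kC; have := congr1 (fun D : {set I} => k \in D) CA.
  by rewrite !inE kC kA.
rewrite -(finset.setD1K kA); apply: (step _ _ _ _ _ _).2; rewrite ?inE ?eqxx //.
apply: IHd; last by have := finset.cardsD1 k A; rewrite kA cA => -[].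
apply/eqP; rewrite -finset.subset0 -CA; apply: finset.setIS; exact: finset.subsetDl.
Qed.

(** The sum [E] over the lattices containing the unit vectors in [A] satisfies
    [1 + X * E <= E] with [X] the left-hand side: the whole module contributes 1,
    and does not belong to the class with all other coordinates in the maximal
    ideal, which contributes [X * E]. *)
Lemma scale_ratio_lt1 A : (0 < #|~: A|)%N ->
  ((q ^ (#|~: A| * #|A|))%:R * t ^+ beta #|~: A| < 1)%R.
Proof.
move=> A0; set X := (_ * _)%R.
have fA := class_sum_fin (finset.set0I A).
have X0 : (0 <= X)%R by rewrite mulr_ge0 // exprn_ge0 // ltW.
have hE : 1 + X%:E * E finset.set0 A G <= E finset.set0 A G.
  have -> : X%:E * E finset.set0 A G = E (~: A)%SET A G.
    have := class_sum_scale lp hq hwt (~: A)%SET G0.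
    rewrite finset.setCK => ->; rewrite /X EFinM -muleA; congr (_ * _).
    rewrite -class_sumZ ?exprn_gt0 //; apply: eq_esum => L _.
    by rewrite exprD EFinM.
  rewrite [leRHS](esumID (lattice_class pi (~: A)%SET A)); last first.
    by move=> L _; apply: mule_ge0.
  rewrite [leRHS]addeC; apply: leeD; last first.
    have -> // : lattice_class pi finset.set0 A `&` lattice_class pi (~: A)%SET A =
            lattice_class pi (~: A)%SET A.
    apply/seteqP; split=> [L []//|L LA]; split=> //; case: LA => lL LA _.
    by split=> // v l _; rewrite inE.
  apply: esum_ge; exists [set [set: V]].
    split=> // _ ->; split.
      by split=> //; [exact: lattice_setT | move=> v l _; rewrite inE].
    move=> [_ _ LC]; have /card_gt0P[k kA] := A0.
    apply: (not_principal1 lp); have := LC (unit_vec o k) k Logic.I kA.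
    by rewrite ffunE eqxx.
  rewrite fsbig_set1.
  have [_ ->] := has_index_finite (submodule_subgroup (submodule_setT V))
                                  (has_index_setT V).
  by rewrite exp1n mul1e; case: hwt => ->; rewrite expr0.
rewrite ltNge; apply/negP => X1.
have e0 : 0 <= E finset.set0 A G by exact: class_sum_ge0.
move: fA e0 hE; case: (E finset.set0 A G) => // r _; rewrite lee_fin => r0.
rewrite -EFinM -EFinD lee_fin => h.
have := ler_wpM2r r0 X1; rewrite mul1r => h2.
by have := lt_le_trans (ltr_pwDl ltr01 h2) h; rewrite ltxx.
Qed.

Lemma class_coef_fin C A k : (C :&: A = finset.set0)%SET ->
  class_coef C A k \is a fin_num.
Proof.
move=> /class_sum_fin; rewrite -[X in E _ _ X]/(EFin \o fun k => (t ^+ k)%R).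
rewrite class_sum_series; last by move=> i; rewrite exprn_ge0 ?ltW.
move=> h; rewrite ge0_fin_numE ?class_coef_ge0 //.
have : class_coef C A k * (t ^+ k)%:E < +oo.
  apply: le_lt_trans h; have := @nneseries_lim_ge R
    (fun k => class_coef C A k * (t ^+ k)%:E) xpredT 0%N k.+1.
  move=> /(_ (fun i _ _ => _))h; apply: le_trans (h _).
    by rewrite big_nat_recr //= leeDr // big_mkord sume_ge0 // => i _;
       apply: mule_ge0; rewrite ?class_coef_ge0.
  by move=> i; apply: mule_ge0; rewrite ?class_coef_ge0.
have := class_coef_ge0 C A k; case: (class_coef C A k) => // [r *|]; first by rewrite ltry.
by move=> _; rewrite gt0_mulye // lte_fin exprn_gt0.
Qed.
End Convergent.
End LatticeSeries.

(** * The Igusa function *)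

Section GaussBinomial.
Variables (K : fieldType) (Y : K).

(** The Gaussian binomial coefficient, by the Pascal rule that the pivot
    recursion produces; [gauss_binomialE] identifies the two. *)
Fixpoint qbin (a b : nat) : K :=
  match a, b with
  | _, 0 => 1
  | 0, _.+1 => 0
  | a'.+1, b'.+1 => qbin a' b' * Y ^+ (a' - b') + qbin a' b'.+1
  end.

Lemma qbin0 a : qbin a 0 = 1. Proof. by case: a. Qed.
Lemma qbinS a b : qbin a.+1 b.+1 = qbin a b * Y ^+ (a - b) + qbin a b.+1.
Proof. by []. Qed.

Arguments qbin : simpl never.

Lemma qbin_small a b : (a < b)%N -> qbin a b = 0.
Proof.
elim: a b => [|a IHa] [|b] // ab; rewrite qbinS !IHa ?mul0r ?addr0 //.
exact: ltnW.
Qed.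

Lemma qbinn a : qbin a a = 1.
Proof.
by elim: a => // a IHa; rewrite qbinS IHa subnn mulr1 qbin_small ?addr0.
Qed.

Definition qfact (a : nat) : K := \prod_(1 <= i < a.+1) (1 - Y ^+ i).

Lemma qfactS a : qfact a.+1 = qfact a * (1 - Y ^+ a.+1).
Proof. by rewrite /qfact big_nat_recr. Qed.

Lemma qbin_fact a b : (b <= a)%N -> qbin a b * (qfact b * qfact (a - b)) = qfact a.
Proof.
elim: a b => [|a IHa] [|b] // ab.
- by rewrite mul1r /qfact !big_geq // mulr1.
- by rewrite mul1r subn0 /qfact [X in X * _]big_geq // mul1r.
rewrite qbinS subSS mulrDl (qfactS a) qfactS.
have -> : qbin a b * Y ^+ (a - b) * (qfact b * (1 - Y ^+ b.+1) * qfact (a - b)) =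
    qbin a b * (qfact b * qfact (a - b)) * (Y ^+ (a - b) * (1 - Y ^+ b.+1)) by ring.
rewrite IHa //; move: ab; rewrite ltnS leq_eqVlt => /orP[/eqP<-|ab].
  by rewrite subnn qbin_small // mul0r addr0 expr0 mul1r.
have e : (a - b = (a - b.+1).+1)%N by lia.
have -> : qbin a b.+1 * (qfact b * (1 - Y ^+ b.+1) * qfact (a - b)) =
    qbin a b.+1 * (qfact b.+1 * qfact (a - b.+1)) * (1 - Y ^+ (a - b)).
  by rewrite qfactS e qfactS; ring.
rewrite IHa // -mulrDr; congr (_ * _); rewrite mulrBr -exprD.
have -> : (a - b + b.+1 = a.+1)%N by lia.
ring.
Qed.

Hypothesis Y1 : forall i, (0 < i)%N -> 1 - Y ^+ i != 0.

Lemma qfact_neq0 a : qfact a != 0.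
Proof. by rewrite /qfact big_add1 big_mkord; apply/prodf_neq0 => i _; apply: Y1. Qed.

Lemma gauss_binomialE a b : (b <= a)%N -> gauss_binomial Y a b = qbin a b.
Proof.
move=> ba; rewrite /gauss_binomial !addn1 -/(qfact b).
apply: (mulIf (qfact_neq0 b)); rewrite divfK ?qfact_neq0 //.
apply: (mulIf (qfact_neq0 (a - b))); rewrite -mulrA qbin_fact // mulrC /qfact.
by rewrite -big_cat_nat //= ltnS leq_subr.
Qed.

Variable X : nat -> K.
Local Notation psi k := (X k / (1 - X k)).

Definition igusa_word m (J : {set 'I_m}) : seq nat := [seq (val i).+1 | i <- enum J].

(** Allowing the chain to start at [a] and the indices to stop at [m] makes the
    largest index removable. *)
Definition igusa_sum (a m : nat) : K :=
  \sum_(J : {set 'I_m}) gauss_chain Y a (rev (igusa_word J)) *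
    \prod_(x <- igusa_word J) psi x.

Lemma igusaE n : igusa n Y X = igusa_sum n n.
Proof.
by apply: eq_bigr => J _; rewrite /igusa_word big_map big_enum.
Qed.

Lemma igusa_sum0 a : igusa_sum a 0 = 1.
Proof.
rewrite /igusa_sum (bigD1 finset.set0) //= [X in _ + X]big1 => [|J J0].
  by rewrite addr0 /igusa_word finset.enum_set0 /= big_nil mulr1.
by case/finset.set0Pn: J0 => -[].
Qed.

Lemma igusa_word_recr m (J : {set 'I_m.+1}) :
  igusa_word J = igusa_word [set i | widen_ord (leqnSn m) i \in J]%SET ++
                 (if ord_max \in J then [:: m.+1] else [::]).
Proof.
rewrite /igusa_word {1}/enum_mem -enumT enum_ordSr.
rewrite filter_rcons filter_map.
have -> : [seq x <- enum 'I_m | preim (widen_ord (leqnSn m)) (mem J) x] =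
          enum [set i | widen_ord (leqnSn m) i \in J]%SET.
  by rewrite [RHS]/enum_mem -enumT; apply: eq_filter => i; rewrite /= inE.
have -> : mem J ord_max = (ord_max \in J) by [].
case: (ord_max \in J).
  by rewrite map_rcons -cats1 -map_comp.
by rewrite cats0 -map_comp.
Qed.

Lemma igusa_sumS a m :
  igusa_sum a m.+1 = igusa_sum a m +
    gauss_binomial Y a m.+1 * psi m.+1 * igusa_sum m.+1 m.
Proof.
pose wd := widen_ord (leqnSn m).
pose ext (p : {set 'I_m} * bool) : {set 'I_m.+1} :=
  if p.2 then ord_max |: (wd @: p.1) else wd @: p.1.
have wdmax i : (wd i == ord_max) = false.
  by apply/eqP => /(congr1 val) /= e; have := ltn_ord i; rewrite e ltnn.
have wdI : injective wd by move=> i j /(congr1 val) /= /val_inj.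
have maxwd (J : {set 'I_m}) : (ord_max \in wd @: J) = false.
  by apply/imsetP => -[i _ /esym/eqP]; rewrite wdmax.
have extK : cancel ext (fun J => ([set i | wd i \in J], ord_max \in J))%SET.
  move=> [J []]; rewrite /ext /=; congr (_, _).
  - by apply/setP => i; rewrite !inE wdmax (mem_imset _ _ wdI).
  - by rewrite !inE eqxx.
  - by apply/setP => i; rewrite !inE (mem_imset _ _ wdI).
  - exact: maxwd.
have Kext : cancel (fun J : {set 'I_m.+1} => ([set i | wd i \in J], ord_max \in J))%SET ext.
  move=> /= J; have im i : (i \in wd @: [set i | wd i \in J]%SET) =
      (i \in J) && (i != ord_max).
    apply/imsetP/andP => [[k + ->]|[iJ im]]; first by rewrite inE wdmax.
    have im' : (i < m)%N.
      rewrite ltn_neqAle -ltnS ltn_ord andbT; apply: contra im => /eqP e.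
      by apply/eqP/val_inj.
    have e : i = wd (Ordinal im') by exact: val_inj.
    by exists (Ordinal im') => //; rewrite inE -e.
  apply/setP => i; rewrite /ext /=; case: ifP => mJ; rewrite ?inE im.
    by case: eqP => [->|_]; rewrite ?mJ ?andbT.
  by case: eqP => [->|_]; rewrite ?mJ ?andbT.
rewrite {1}/igusa_sum (reindex ext) /=; last first.
  by exists (fun J : {set 'I_m.+1} => ([set i | wd i \in J], ord_max \in J)%SET) => J _.
rewrite -(pair_bigA _ (fun J b => gauss_chain Y a (rev (igusa_word (ext (J, b)))) *
   \prod_(x <- igusa_word (ext (J, b))) psi x)) /=.
rewrite [igusa_sum a m]/igusa_sum [igusa_sum m.+1 m]/igusa_sum mulr_sumr -big_split /=.
apply: eq_bigr => J _; rewrite big_bool /= addrC.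
have := extK (J, true); have := extK (J, false).
rewrite !igusa_word_recr => -[-> ->] [-> ->]; rewrite cats0; congr (_ + _).
rewrite rev_cat big_cat big_seq1 /=; ring.
Qed.

Lemma igusa_sumE a m :
  igusa_sum a m = 1 + \sum_(k < m) gauss_binomial Y a k.+1 * psi k.+1 * igusa_sum k.+1 k.
Proof.
elim: m => [|m IHm]; first by rewrite igusa_sum0 big_ord0 addr0.
by rewrite igusa_sumS IHm big_ord_recr /= addrA.
Qed.

(** Peeling off the largest index of the set gives the recursion that the sum
    over lattices satisfies. *)
Lemma igusa_recursion n : X 0 = 1 -> (0 < n)%N ->
  (forall k, (0 < k <= n)%N -> X k != 1) ->
  igusa n Y X * (1 - X n) = \sum_(i < n) qbin n i * X i * igusa i Y X.
Proof.
move=> X0 n0 X1.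
have rec k : (0 < k <= n)%N -> psi k * igusa_sum k k.-1 = X k * igusa k Y X.
  case: k => // k /X1 Xk; rewrite igusaE igusa_sumS gauss_binomialE // qbinn mul1r /=.
  field.
  by rewrite subr_eq0 eq_sym.
have e : igusa n Y X = 1 + \sum_(k < n) qbin n k.+1 * X k.+1 * igusa k.+1 Y X.
  rewrite igusaE igusa_sumE; congr (_ + _); apply: eq_bigr => k _.
  by rewrite gauss_binomialE // -mulrA (rec k.+1) ?ltn_ord // mulrA.
case: n n0 X1 rec e => // n _ X1 rec.
rewrite big_ord_recr /= qbinn mul1r => e.
rewrite big_ord_recl qbin0 X0 !mul1r.
have -> : igusa 0 Y X = 1 by rewrite igusaE igusa_sum0.
by rewrite mulrBr mulr1 {1}e addrA [X in _ - X]mulrC addrK.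
Qed.
End GaussBinomial.

(** The solution of the pivot recursion with [r] indices in [C], [N] indices
    not yet assigned, and value [g i] once all indices are assigned and [i] of
    them lie in [C]. *)
Definition pivot_value (K : fieldType) (Y : K) (g : nat -> K) (r N : nat) : K :=
  \sum_(s < N.+1) qbin Y N s * Y ^+ (r * (N - s)) * g (r + s)%N.

Lemma pivot_value0 (K : fieldType) (Y : K) g r : pivot_value Y g r 0 = g r.
Proof. by rewrite /pivot_value big_ord1 qbin0 subnn muln0 !mul1r addn0. Qed.

Lemma pivot_valueS (K : fieldType) (Y : K) g r N :
  pivot_value Y g r N.+1 = pivot_value Y g r.+1 N + Y ^+ r * pivot_value Y g r N.
Proof.
rewrite /pivot_value big_ord_recl qbin0 mul1r subn0 addn0.
have -> : \sum_(i < N.+1) qbin Y N.+1 (lift ord0 i) *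
    Y ^+ (r * (N.+1 - lift ord0 i)) * g (r + lift ord0 i)%N =
    \sum_(i < N.+1) qbin Y N i * Y ^+ (r.+1 * (N - i)) * g (r.+1 + i)%N +
    \sum_(i < N.+1) qbin Y N i.+1 * Y ^+ (r * (N - i)) * g (r + i.+1)%N.
  rewrite -big_split; apply: eq_bigr => i _.
  rewrite lift0 qbinS subSS [RHS]/= addSnnS mulSn exprD; ring.
rewrite addrCA; congr (_ + _); rewrite mulr_sumr [in LHS]big_ord_recr.
rewrite [X in _ + X = _]/= qbin_small // !mul0r addr0 big_ord_recl qbin0 mul1r subn0 addn0.
rewrite mulrA -exprD -mulnS; congr (_ + _); apply: eq_bigr => i _.
rewrite lift0 !mulrA; congr (_ * _).
have -> : (N - i = (N - i.+1).+1)%N by have := ltn_ord i; lia.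
by rewrite mulnS exprD; ring.
Qed.

(** * Power series with nonnegative coefficients *)

Section ComplexLimits.
Variable R : realType.
Implicit Types (u v : nat -> R[i]) (l m c : R[i]).

(** The norm of a complex number is a complex number; limits and bounds are
    taken of its real part. *)
Definition modulus (z : R[i]) : R := complex.Re `|z|.

Lemma modulusE z : `|z| = (modulus z)%:C.
Proof. by rewrite /modulus; case: z => x y. Qed.

Lemma modulus_ge0 z : 0 <= modulus z.
Proof. by rewrite -lecR -modulusE normr_ge0. Qed.

Lemma modulusM z1 z2 : modulus (z1 * z2) = modulus z1 * modulus z2.
Proof. by apply: complexI; rewrite rmorphM /= -!modulusE normrM. Qed.

Lemma modulusX z k : modulus (z ^+ k) = modulus z ^+ k.
Proof. by apply: complexI; rewrite rmorphXn /= -!modulusE normrX. Qed.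

Lemma modulusD z1 z2 : modulus (z1 + z2) <= modulus z1 + modulus z2.
Proof. by rewrite -lecR rmorphD /= -!modulusE ler_normD. Qed.

Lemma modulus_sum (J : Type) (r : seq J) (P : pred J) (F : J -> R[i]) :
  modulus (\sum_(i <- r | P i) F i) <= \sum_(i <- r | P i) modulus (F i).
Proof.
rewrite -lecR -modulusE rmorph_sum /=; apply: le_trans (ler_norm_sum _ _ _) _.
by apply: ler_sum => i _; rewrite modulusE.
Qed.

Lemma modulusR (x : R) : 0 <= x -> modulus x%:C = x.
Proof. by move=> x0; apply: complexI; rewrite -modulusE ger0_norm // lecR. Qed.

Lemma modulus0_eq0 z : modulus z = 0 -> z = 0.
Proof. by move=> z0; apply/eqP; rewrite -normr_eq0 modulusE z0. Qed.

(** Convergence to a given limit, expressed by a real sequence so that the order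
    of the reals can be used. *)
Definition clim u l : Prop := (fun K => modulus (l - u K)) @ \oo --> (0 : R).

Lemma clim_squeeze u l (d : nat -> R) : d @ \oo --> (0 : R) ->
  (forall K, modulus (l - u K) <= d K) -> clim u l.
Proof.
move=> d0 ud; apply: (@squeeze_cvgr _ _ _ _ (fun=> 0) d) => //.
  by near=> K; rewrite modulus_ge0 ud.
exact: cvg_cst.
Unshelve. all: by end_near. Qed.

Lemma climP u l : clim u l ->
  forall r : R, 0 < r -> exists N, forall K, (N <= K)%N -> modulus (l - u K) < r.
Proof.
move=> /cvgrPdist_lt h r r0; have [N _ hN] := h r r0; exists N => K NK.
by have := hN K NK; rewrite sub0r normrN ger0_norm ?modulus_ge0.
Qed.

Lemma climI u l : (forall r : R, 0 < r ->
  exists N, forall K, (N <= K)%N -> modulus (l - u K) < r) -> clim u l.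
Proof.
move=> h; apply/cvgrPdist_lt => r r0; have [N hN] := h r r0; exists N => // K NK.
by rewrite sub0r normrN ger0_norm ?modulus_ge0 ?hN.
Qed.

Lemma clim_uniq u l m : clim u l -> clim u m -> l = m.
Proof.
move=> ul um; apply/subr0_eq/modulus0_eq0/eqP.
rewrite eq_le modulus_ge0 andbT leNgt; apply/negP => d0.
have d2 : 0 < modulus (l - m) / 2 by lra.
have [N hN] := climP ul d2; have [N' hN'] := climP um d2.
have := hN (maxn N N') (leq_maxl _ _); have := hN' (maxn N N') (leq_maxr _ _).
set w := u _; have := modulusD (l - w) (- (m - w)).
rewrite opprB addrA subrK.
have -> : modulus (w - m) = modulus (m - w).
  by apply: complexI; rewrite -!modulusE distrC.
lra.
Qed.

Lemma clim_cst l : clim (fun=> l) l.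
Proof.
apply: (@clim_squeeze _ _ (fun=> 0)) => [|K]; first exact: cvg_cst.
by rewrite subrr modulusR.
Qed.

Lemma climD u v l m : clim u l -> clim v m -> clim (fun K => u K + v K) (l + m).
Proof.
move=> ul vm; apply: (@clim_squeeze _ _ (fun K => modulus (l - u K) + modulus (m - v K))).
  by rewrite -[0 in X in _ --> X]addr0; exact: cvgD.
move=> K; apply: le_trans (modulusD _ _).
by rewrite opprD addrACA.
Qed.

Lemma climM u v l m : clim u l -> clim v m -> clim (fun K => u K * v K) (l * m).
Proof.
move=> ul vm; pose d K := modulus (l - u K); pose e K := modulus (m - v K).
apply: (@clim_squeeze _ _ (fun K => d K * modulus m + (modulus l + d K) * e K)).
  have -> : 0 = 0 * modulus m + (modulus l + 0) * 0 :> R by rewrite mulr0 mul0r addr0.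
  apply: cvgD; first by apply: cvgM => //; exact: cvg_cst.
  by apply: cvgM => //; apply: cvgD => //; exact: cvg_cst.
move=> K; have -> : l * m - u K * v K = (l - u K) * m + u K * (m - v K) by ring.
apply: le_trans (modulusD _ _) _; rewrite !modulusM lerD2l ler_wpM2r ?modulus_ge0 //.
have := modulusD l (- (l - u K)); rewrite opprB addrCA subrr addr0.
have -> : modulus (u K - l) = d K by apply: complexI; rewrite -!modulusE distrC.
by [].
Qed.

Lemma climZ u l c : clim u l -> clim (fun K => c * u K) (c * l).
Proof. by apply: climM; apply: clim_cst. Qed.

Lemma climB u v l m : clim u l -> clim v m -> clim (fun K => u K - v K) (l - m).
Proof.
move=> ul vm; have := climD ul (climZ (-1) vm); rewrite mulN1r.
by under [X in clim X _]funext do rewrite mulN1r.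
Qed.

Lemma clim_subn u l b : clim u l -> clim (fun K => u (K - b)%N) l.
Proof.
move=> ul; apply: climI => r /(climP ul)[N hN].
by exists (N + b)%N => K NK; apply: hN; lia.
Qed.
End ComplexLimits.

Lemma sum_triangle (V : zmodType) (F : nat -> nat -> V) N :
  \sum_(k < N) \sum_(i < k.+1) F i (k - i)%N =
  \sum_(i < N) \sum_(j < N) if (i + j < N)%N then F i j else 0.
Proof.
transitivity (\sum_(k < N) \sum_(i < N) if (i <= k)%N then F i (k - i)%N else 0).
  apply: eq_bigr => k _; rewrite -big_mkcond /=.
  by rewrite (big_ord_widen N (fun i => F i (k - i)%N)) //.
rewrite exchange_big; apply: eq_bigr => i _; rewrite -!big_mkcond /=.
rewrite -(big_mkord (fun k => i <= k)%N (fun k => F i (k - i)%N)).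
rewrite -(big_mkord (fun j => i + j < N)%N (F i)).
rewrite (@big_cat_nat _ _ _ i 0 N) //= ?(ltnW (ltn_ord i)) //.
rewrite big_nat_cond big1 ?add0r => [|k]; last by lia.
rewrite [RHS](@big_cat_nat _ _ _ (N - i)%N 0 N) //= ?leq_subr //.
rewrite [X in _ = _ + X]big_nat_cond [X in _ = _ + X]big1 ?addr0; last by move=> j; lia.
rewrite -{1}[nat_of_ord i]add0n big_addn.
rewrite big_nat_cond [RHS]big_nat_cond; apply: eq_big => [k|k _]; first lia.
by rewrite addnK.
Qed.
Section PowerSeries.
Variable R : realType.
Implicit Types (a w z : nat -> R) (T : R[i]) (t : R).

Definition psum a T (K : nat) : R[i] := \sum_(k < K) (a k)%:C * T ^+ k.

Definition psummable a t : Prop := cvgn (series (fun k => a k * t ^+ k)).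

Lemma psummable_ereal a t : 0 <= t -> (forall k, 0 <= a k) ->
  (\sum_(0 <= k <oo) (a k * t ^+ k)%:E < +oo)%E -> psummable a t.
Proof.
move=> t0 a0 fin.
have at0 k : (0 <= (a k * t ^+ k)%:E)%E by rewrite lee_fin mulr_ge0 // exprn_ge0.
have := @summable_cvg R xpredT (fun k => (a k * t ^+ k)%:E) (fun k _ => at0 k).
apply; rewrite /esum.summable.
rewrite (_ : xpredT = [set: nat] :> set nat); last by apply/seteqP.
rewrite -nneseries_esumT; last by move=> k; exact: abse_ge0.
by rewrite (eq_eseriesr (g := fun k => (a k * t ^+ k)%:E)) // => k _; rewrite gee0_abs.
Qed.

(** The bound [d K] is the tail of the series after [K] terms, hence independent
    of the upper end [M]. *)
Lemma psummable_tail a t : 0 <= t -> (forall k, 0 <= a k) -> psummable a t ->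
  exists2 d : nat -> R, d @ \oo --> (0 : R) &
    forall K M, \sum_(K <= k < M) a k * t ^+ k <= d K.
Proof.
move=> t0 a0 sa; set u := fun k => a k * t ^+ k; set L := limn (series u).
exists (fun K => L - series u K).
  by rewrite -(subrr L); apply: cvgB => //; exact: cvg_cst.
move=> K M; have u0 k : 0 <= u k by rewrite mulr_ge0 // exprn_ge0.
have nd : {homo series u : m n / (m <= n)%N >-> m <= n}.
  by apply/nondecreasing_seqP => n; rewrite seriesEnat /= big_nat_recr //= lerDl.
rewrite lerBrDl; have [KM|MK] := leqP K M.
  rewrite /series /= -big_cat_nat //=.
  exact: (nondecreasing_cvgn_le nd sa M).
rewrite big_geq ?addr0 ?(ltnW MK) //.
exact: (nondecreasing_cvgn_le nd sa K).
Qed.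

Section Fixed.
Variables (T : R[i]) (t : R).
Hypothesis Tt : modulus T = t.

Let t0 : 0 <= t. Proof. by rewrite -Tt modulus_ge0. Qed.

Lemma modulus_term a k : 0 <= a k -> modulus ((a k)%:C * T ^+ k) = a k * t ^+ k.
Proof. by move=> ak; rewrite modulusM modulusX Tt modulusR. Qed.

Lemma psum_diff a K b : psum a T (K + b) - psum a T K =
  \sum_(K <= k < K + b) (a k)%:C * T ^+ k.
Proof.
rewrite /psum -!(big_mkord xpredT (fun k => (a k)%:C * T ^+ k)).
by rewrite (@big_cat_nat _ _ _ K 0) ?leq_addr //= addrAC subrr add0r.
Qed.

(** Terms of a summable series tend to zero, so a shift does not change the
    limit behaviour of the partial sums. *)
Lemma psum_shift a b : (forall k, 0 <= a k) -> psummable a t ->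
  clim (fun K => psum a T K - psum a T (K - b)) 0.
Proof.
move=> a0 sa; have [d d0 hd] := psummable_tail t0 a0 sa.
apply: climI => r r0.
have /cvgrPdist_lt/(_ r r0)[N _ hN] := d0.
exists (N + b)%N => K NK; have e : (K = K - b + b)%N by lia.
rewrite {1}e psum_diff sub0r.
have -> : modulus (- \sum_(K - b <= k < K - b + b) (a k)%:C * T ^+ k) =
          modulus (\sum_(K - b <= k < K - b + b) (a k)%:C * T ^+ k).
  by apply: complexI; rewrite -!modulusE normrN.
apply: le_lt_trans (modulus_sum _ _ _) _.
rewrite (eq_bigr (fun k => a k * t ^+ k)) => [|k _]; last exact: modulus_term.
apply: le_lt_trans (hd _ _) _; apply: le_lt_trans (ler_norm _) _.
by have := hN (K - b)%N; rewrite sub0r normrN; apply => /=; lia.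
Qed.

End Fixed.

(** Cauchy product: a truncation of the series [a] at [N >= 2 * K] contains all
    terms of [psum w T K * psum z T K], and the other terms have total degree at
    least [K], so that they are dominated by a tail of [a]. *)
Lemma psum_mul a w z T t W Z : modulus T = t ->
  (forall k, 0 <= w k) -> (forall k, 0 <= z k) ->
  (forall k, a k = \sum_(i < k.+1) w i * z (k - i)%N) -> psummable a t ->
  clim (psum w T) W -> clim (psum z T) Z -> clim (psum a T) (W * Z).
Proof.
move=> Tt w0 z0 aE sa wW zZ.
have t0 : 0 <= t by rewrite -Tt modulus_ge0.
have a0 k : 0 <= a k by rewrite aE sumr_ge0 // => i _; rewrite mulr_ge0.
pose F i j := ((w i)%:C * T ^+ i) * ((z j)%:C * T ^+ j).
have aF N : psum a T N = \sum_(i < N) \sum_(j < N) if (i + j < N)%N then F i j else 0.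
  rewrite -sum_triangle; apply: eq_bigr => k _; rewrite aE rmorph_sum mulr_suml.
  apply: eq_bigr => i _; rewrite rmorphM /F mulrACA -exprD subnKC //.
  by rewrite -ltnS.
have [d d0 hd] := psummable_tail t0 a0 sa.
have step K N : (K + K <= N)%N ->
    modulus (psum w T K * psum z T K - psum a T N) <= d K.
  move=> KN; have -> : psum w T K * psum z T K = \sum_(i < N) \sum_(j < N)
      if (i < K)%N && (j < K)%N then F i j else 0.
    rewrite mulr_suml (big_ord_widen N (fun i => (w i)%:C * T ^+ i * psum z T K));
      last by lia.
    rewrite big_mkcond; apply: eq_bigr => i _.
    case: ifP => iK; last by rewrite big1.
    by rewrite mulr_sumr (big_ord_widen N (fun j => F i j)) ?big_mkcond //; lia.
  rewrite aF -sumrB; under eq_bigr do rewrite -sumrB.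
  apply: le_trans (hd K N).
  pose f i j := (w i * t ^+ i) * (z j * t ^+ j).
  have Ff i j : modulus (F i j) = f i j by rewrite modulusM !(modulus_term Tt).
  have f0 i j : 0 <= f i j by rewrite -Ff modulus_ge0.
  have -> : \sum_(K <= k < N) a k * t ^+ k =
      \sum_(i < N) \sum_(j < N) if (i + j < N)%N then
        (if (K <= i + j)%N then f i j else 0) else 0.
    rewrite -(sum_triangle (fun i j => if (K <= i + j)%N then f i j else 0)).
    rewrite (big_nat_widenl _ 0) // big_mkcond /= big_mkord; apply: eq_bigr => k _.
    rewrite aE mulr_suml; case: ifP => Kk; last first.
      by rewrite big1 // => i _; have ik := leq_ord i; rewrite subnKC // Kk.
    apply: eq_bigr => i _; have ik := leq_ord i; rewrite subnKC // Kk /f mulrACA.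
    by rewrite -exprD subnKC.
  apply: le_trans (modulus_sum _ _ _) _; apply: ler_sum => i _.
  apply: le_trans (modulus_sum _ _ _) _; apply: ler_sum => j _.
  case: ifP => h1; case: ifP => h2; try case: ifP => h3; try (exfalso; lia);
    rewrite ?subrr ?subr0 ?sub0r ?modulusR // ?Ff //.
  by have -> : modulus (- F i j) = modulus (F i j);
      [apply: complexI; rewrite -!modulusE normrN | rewrite Ff].
have hP := climM wW zZ; apply: climI => r r0.
have r2 : 0 < r / 2 by lra.
have [N1 hN1] := climP hP r2; have /cvgrPdist_lt/(_ _ r2)[N2 _ hN2] := d0.
exists (N1 + N2 + (N1 + N2))%N => N NN; set K := (N1 + N2)%N in NN.
have := hN1 K (leq_addr _ _); have := hN2 K (leq_addl _ _).
rewrite sub0r normrN => /(le_lt_trans (ler_norm _)) dK h1.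
have := modulusD (W * Z - psum w T K * psum z T K) (psum w T K * psum z T K - psum a T N).
rewrite addrA subrK => /le_lt_trans; apply.
have := step K N NN; lra.
Qed.
End PowerSeries.

(** * Sums over lattices as Igusa functions *)

Lemma psumS (R : realType) (a : nat -> R) (T : R[i]) K :
  psum a T K.+1 = psum a T K + (a K)%:C * T ^+ K.
Proof. by rewrite /psum big_ord_recr. Qed.

Section ClassSeries.
Variables (R : realType) (o : idomainType) (pi : o) (q : nat) (I : finType).
Hypothesis lp : local_parameter pi.
Hypothesis hq : has_index (principal pi) q.
Local Notation V := {ffun I -> o^o}.
Variables (wt : set V -> nat) (beta : nat -> nat).
Hypothesis hwt : scaling_weight pi wt beta.
Variables (T : R[i]) (t : R).
Hypothesis t0 : 0 < t.
Hypothesis Tt : modulus T = t.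
Hypothesis fin :
  (@class_sum R o pi I wt finset.set0 finset.set0 (fun k => (t ^+ k)%:E) < +oo)%E.
Implicit Types (C A : {set I}).

Definition coef C A (k : nat) : R := fine (@class_coef R o pi I wt C A k).

Lemma coef_ge0 C A k : 0 <= coef C A k.
Proof. by apply: fine_ge0; apply: class_coef_ge0. Qed.

Let cfin C A k : (C :&: A = finset.set0)%SET ->
  class_coef R pi wt C A k \is a fin_num.
Proof. exact: (class_coef_fin lp hq hwt t0 fin). Qed.

Lemma coef_psummable C A : (C :&: A = finset.set0)%SET -> psummable (coef C A) t.
Proof.
move=> CA; apply: psummable_ereal; [exact: ltW | exact: coef_ge0 |].
apply: le_lt_trans (class_sum_fin lp hq hwt t0 fin CA).
rewrite -[X in class_sum _ _ _ _ X]/(EFin \o fun k => (t ^+ k)).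
rewrite class_sum_series; last by move=> k; rewrite exprn_ge0 ?ltW.
rewrite le_eqVlt; apply/orP; left; apply/eqP; apply: eq_eseriesr => k _.
by rewrite EFinM /coef fineK // cfin.
Qed.

Lemma coef_pivot C A k i : (C :&: A = finset.set0)%SET -> k \notin C -> k \notin A ->
  coef C A i = coef (k |: C)%SET A i + (q%:R ^+ #|C|)^-1 * coef C (k |: A)%SET i.
Proof.
move=> CA kC kA.
have d1 : ((k |: C) :&: A = finset.set0)%SET.
  apply/setP => j; have := congr1 (fun D : {set I} => j \in D) CA; rewrite !inE.
  by case: eqP => [->|//]; rewrite (negPf kA) andbF.
have d2 : (C :&: (k |: A) = finset.set0)%SET.
  apply/setP => j; have := congr1 (fun D : {set I} => j \in D) CA; rewrite !inE.
  by case: eqP => [->|//]; rewrite (negPf kC).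
rewrite /coef class_coefE (class_sum_pivot lp hq hwt _ kC kA) -?class_coefE.
  by rewrite fineD ?fineM ?fin_numM ?cfin //= natrX.
by move=> j; rewrite lee_fin.
Qed.

Lemma coef_scale C i : coef C (~: C)%SET i = q%:R ^+ (#|C| * #|~: C|) *
  (if (beta #|C| <= i)%N then coef finset.set0 (~: C)%SET (i - beta #|C|) else 0).
Proof.
rewrite /coef class_coefE (class_sum_scale lp hq hwt); last by move=> j; rewrite lee_fin.
have -> : class_sum pi wt finset.set0 (~: C)%SET
    (fun j => (EFin \o delta R i) (beta #|C| + j)%N) =
    if (beta #|C| <= i)%N then class_coef R pi wt finset.set0 (~: C)%SET (i - beta #|C|)
    else 0%E.
  case: ifP => [bi|bi].
    rewrite class_coefE; apply: eq_esum => L _; rewrite /= /delta.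
    by congr (_ * (_ : bool)%:R%:E)%E; lia.
  rewrite /class_sum esum1 // => L _; rewrite /= /delta.
  by rewrite (_ : (_ + _ == i)%N = false) ?mule0 //; lia.
case: ifP => _; last by rewrite mule0 mulr0.
by rewrite fineM ?cfin ?finset.set0I //= natrX.
Qed.

Lemma coef_full i : coef finset.set0 finset.setT i = (i == 0)%:R.
Proof.
rewrite /coef class_coefE (class_sum_full hwt); last by move=> j; rewrite lee_fin.
by rewrite /= /delta eq_sym.
Qed.

Local Notation Y := ((q%:R : R[i])^-1).

Definition scale_ratio (j : nat) : R[i] := q%:R ^+ (j * (#|I| - j)) * T ^+ beta j.

Lemma beta0 : beta 0 = 0%N.
Proof.
case: hwt => wT _ /(_ finset.set0 [set: V]); rewrite finset.cards0 wT.
have -> : scale_on pi finset.set0 @` [set: V] = [set: V].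
  by apply/seteqP; split=> // v _; exists v; rewrite ?scale_on0.
rewrite wT addn0 => <- //; split=> //; first exact: lattice_setT.
by move=> v l _; rewrite inE.
Qed.

Lemma scale_ratio0 : scale_ratio 0 = 1.
Proof. by rewrite /scale_ratio mul0n beta0 !expr0 mulr1. Qed.

Lemma modulus_scale_ratio j : modulus (scale_ratio j) = q%:R ^+ (j * (#|I| - j)) * t ^+ beta j.
Proof.
rewrite modulusM !modulusX Tt; congr (_ ^+ _ * _).
by apply: complexI; rewrite -modulusE normr_nat rmorph_nat.
Qed.

(** Its modulus is below 1, as the lattice sum converges. *)
Lemma scale_ratio_neq1 j : (0 < j <= #|I|)%N -> scale_ratio j != 1.
Proof.
move=> /andP[j0 jI]; pose D := [set x in take j (enum I)]%SET.
have cD : #|D| = j.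
  rewrite cardsE (card_uniqP _) ?size_take_min -?cardE; first exact/minn_idPl.
  by rewrite take_uniq ?enum_uniq.
have := @scale_ratio_lt1 R o pi q I lp hq wt beta hwt t t0 fin (~: D)%SET.
rewrite finset.setCK cD finset.cardsCs finset.setCK cD => /(_ j0) h.
apply/eqP => e; have := modulus_scale_ratio j; rewrite e.
have -> : modulus (1 : R[i]) = 1 by rewrite -(@modulusR R 1).
by move=> h2; move: h; rewrite natrX -h2 ltxx.
Qed.

Lemma psum_pivot C A k K : (C :&: A = finset.set0)%SET -> k \notin C -> k \notin A ->
  psum (coef C A) T K =
  psum (coef (k |: C)%SET A) T K + Y ^+ #|C| * psum (coef C (k |: A)%SET) T K.
Proof.
move=> CA kC kA; rewrite /psum mulr_sumr -big_split; apply: eq_bigr => i _ /=.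
rewrite (coef_pivot i CA kC kA) rmorphD rmorphM mulrDl mulrA; congr (_ + _ * _ * _).
by rewrite rmorphV /= ?rmorphXn /= ?rmorph_nat ?exprVn // unitfE expf_neq0 // pnatr_eq0
   -lt0n (q_gt0 hq).
Qed.

Lemma psum_scale C K : psum (coef C (~: C)%SET) T K =
  scale_ratio #|C| * psum (coef finset.set0 (~: C)%SET) T (K - beta #|C|).
Proof.
have cC : (#|I| - #|C| = #|~: C|)%N by rewrite [RHS]finset.cardsCs finset.setCK.
elim: K => [|K IH]; first by rewrite sub0n /psum !big_ord0 mulr0.
rewrite psumS IH coef_scale.
case: ifP => bK; last first.
  have -> : (K - beta #|C| = K.+1 - beta #|C|)%N by lia.
  by rewrite mulr0 rmorph0 mul0r addr0.
rewrite subSn // psumS mulrDr; congr (_ + _).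
have -> : T ^+ K = T ^+ beta #|C| * T ^+ (K - beta #|C|) by rewrite -exprD subnKC.
rewrite rmorphM rmorphXn rmorph_nat /scale_ratio cC; ring.
Qed.

(** The pivot recursion, taken to the limit: only the limits at the ends of the
    recursion have to be known.  Stated for any family [F] above a set [A0], to
    allow a correction to the partial sums at [A0] itself. *)
Lemma pivot_clim A0 (F : {set I} -> {set I} -> nat -> R[i]) (g : nat -> R[i]) :
  (forall C A k K, A0 \subset A -> (C :&: A = finset.set0)%SET ->
     k \notin C -> k \notin A ->
     F C A K = F (k |: C)%SET A K + Y ^+ #|C| * F C (k |: A)%SET K) ->
  (forall C, C \subset ~: A0 -> clim (F C (~: C)%SET) (g #|C|)) ->
  forall C A, A0 \subset A -> (C :&: A = finset.set0)%SET ->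
    clim (F C A) (pivot_value Y g #|C| #|~: (C :|: A)|).
Proof.
move=> rec ends C A; move: {2}#|~: (C :|: A)| (erefl #|~: (C :|: A)|) => N.
elim: N C A => [|N IHN] C A nCA A0A CA; rewrite nCA.
  have AC : A = (~: C)%SET.
    apply/eqP; rewrite finset.eqEsubset -finset.disjoints_subset.
    rewrite -finset.setI_eq0 finset.setIC CA eqxx /=.
    move/eqP: nCA; rewrite finset.cards_eq0 finset.setCU => /eqP e.
    by rewrite -[A]finset.setCK -finset.disjoints_subset -finset.setI_eq0 e.
  by rewrite pivot_value0 AC; apply: ends; rewrite -finset.setCS finset.setCK -AC.
have /finset.set0Pn[k] : (~: (C :|: A))%SET != finset.set0.
  by rewrite -finset.cards_eq0 nCA.
rewrite !inE negb_or => /andP[kC kA].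
have cardD D B : (~: (D :|: B) = (~: (C :|: A)) :\ k)%SET -> #|~: (D :|: B)| = N.
  move=> ->; have := finset.cardsD1 k (~: (C :|: A)).
  by rewrite !inE negb_or kC kA nCA => -[].
have d1 : ((k |: C) :&: A = finset.set0)%SET.
  apply/setP => j; have := congr1 (fun D : {set I} => j \in D) CA; rewrite !inE.
  by case: eqP => [->|//]; rewrite (negPf kA) andbF.
have d2 : (C :&: (k |: A) = finset.set0)%SET.
  apply/setP => j; have := congr1 (fun D : {set I} => j \in D) CA; rewrite !inE.
  by case: eqP => [->|//]; rewrite (negPf kC).
have e1 : #|~: (k |: C :|: A)| = N.
  by apply: cardD; apply/setP => i; rewrite !inE -orbA negb_or.
have e2 : #|~: (C :|: (k |: A))| = N.
  by apply: cardD; apply/setP => i; rewrite !inE orbCA negb_or.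
have -> : F C A = fun K => F (k |: C)%SET A K + Y ^+ #|C| * F C (k |: A)%SET K.
  by apply/funext => K; apply: rec.
rewrite pivot_valueS; apply: climD; last apply: climZ.
  have := IHN _ _ e1 A0A d1; by rewrite e1 finset.cardsU1 kC.
have := IHN _ _ e2 (fintype.subset_trans A0A (finset.subsetUr _ _)) d2.
by rewrite e2.
Qed.

(** Let [S] be the limit for [A], with [j] indices outside [A].  Running the
    pivot recursion to its end expresses [S] by the classes [(C, ~: C)] with [C]
    outside [A].  Scaling identifies the one with [#|C| = j] with
    [scale_ratio j * S], and the smaller ones are known by induction, so that [S]
    satisfies the recursion of the Igusa function. *)
Lemma coef_series_igusa A :
  clim (psum (coef finset.set0 A) T) (igusa #|~: A| Y scale_ratio).
Proof.
have Y1 i : (0 < i)%N -> 1 - Y ^+ i != 0.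
  move=> i0; have q1 := q_gt1 lp hq.
  rewrite subr_eq0 eq_sym exprVn invr_eq1 -natrX pnatr_eq1.
  by rewrite -(expn0 q) eqn_exp2l // -lt0n.
move: {2}#|~: A| (erefl #|~: A|) => j; elim/ltn_ind: j A => j IHj A Aj; rewrite Aj.
have [j0|j0] := posnP j.
  have AT : A = finset.setT.
    by rewrite -[A]finset.setCK (finset.cards0_eq (etrans Aj j0)) finset.setC0.
  rewrite j0 AT igusaE igusa_sum0; apply: climI => r r0.
  exists 1%N => -[|K] // _; rewrite /psum big_ord_recl coef_full expr0 mulr1 big1.
    by rewrite addr0 subrr modulusR.
  by move=> i _; rewrite coef_full mul0r.
(* The class with [C = ~: A] is subtracted, so that convergence of [F] follows
   from the induction hypothesis before that of the series itself is known. *)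
pose F C B K := psum (coef C B) T K -
  (if B == A then psum (coef (~: A)%SET A) T K else 0).
pose g i := if (i < j)%N then scale_ratio i * igusa i Y scale_ratio else 0.
have hF : clim (F finset.set0 A) (pivot_value Y g 0 j).
  have := @pivot_clim A F g; rewrite -[X in pivot_value _ _ _ X]Aj.
  move=> /(_ _ _ finset.set0 A); rewrite finset.cards0 finset.set0U; apply=> //;
    last by rewrite finset.set0I.
  - move=> C B k K AB CB kC kB; rewrite /F (psum_pivot K CB kC kB).
    have -> : (k |: B == A)%SET = false.
      apply/eqP => e; move: kB; by rewrite (fintype.subsetP AB) // -e !inE eqxx.
    by rewrite subr0 addrAC.
  - move=> C CA; rewrite /F /g.
    have [e|ne] := eqVneq (~: C)%SET A.
      have cC : #|C| = j by rewrite -Aj -e finset.setCK.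
      rewrite -e finset.setCK cC ltnn; under [X in clim X _]funext do rewrite subrr.
      exact: clim_cst.
    have Cj : (#|C| < j)%N.
      rewrite -Aj proper_card // finset.properEneq CA andbT.
      by apply: contra ne => /eqP->; rewrite finset.setCK.
    rewrite Cj; under [X in clim X _]funext do rewrite subr0 psum_scale.
    apply: climZ; apply: clim_subn.
    have := IHj _ Cj (~: C)%SET; rewrite finset.setCK; exact.
have vE : pivot_value Y g 0 j = \sum_(i < j) qbin Y j i * scale_ratio i * igusa i Y scale_ratio.
  rewrite /pivot_value big_ord_recr /= /g add0n ltnn mulr0 addr0.
  by apply: eq_bigr => i _; rewrite add0n ltn_ord mul0n expr0 mulr1 mulrA.
have jI : (j <= #|I|)%N by rewrite -Aj max_card.
have rj : 1 - scale_ratio j != 0 by rewrite subr_eq0 eq_sym scale_ratio_neq1 // j0.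
have irec : igusa j Y scale_ratio * (1 - scale_ratio j) = pivot_value Y g 0 j.
  rewrite vE igusa_recursion ?scale_ratio0 // => k /andP[k0 kj].
  by rewrite scale_ratio_neq1 // k0 (leq_trans kj).
pose S K := psum (coef finset.set0 A) T K.
have sS : psummable (coef finset.set0 A) t by apply: coef_psummable; rewrite finset.set0I.
(* The series differs from its shift by a null sequence, which turns the
   relation between partial sums into [F = (1 - scale_ratio j) * S] in the limit. *)
have hS := psum_shift Tt (beta j) (coef_ge0 finset.set0 A) sS.
have := climZ (1 - scale_ratio j)^-1 (climB hF (climZ (scale_ratio j) hS)).
rewrite mulr0 subr0 -irec mulrCA mulVf // mulr1.
congr clim; apply/funext => K; rewrite /F eqxx.
have -> : psum (coef (~: A)%SET A) T K = scale_ratio j * S (K - beta j)%N.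
  by have := psum_scale (~: A)%SET K; rewrite finset.setCK Aj.
rewrite /S; move: (psum _ _ K) (psum _ _ (K - _)) (scale_ratio j) rj => x y r r1.
by apply: (mulfI r1); rewrite mulrA divff // mul1r; ring.
Qed.
End ClassSeries.

(** * Multi-indices *)

Section MultiIndex.
Variable n : nat.

Definition mval k (e : multi_index n k) (j : 'I_n) : nat := val e j.

Lemma mval_inj k (e f : multi_index n k) : mval e =1 mval f -> e = f.
Proof. by move=> ef; apply/val_inj/ffunP => j; apply/val_inj/ef. Qed.

Lemma mval_sum k (e : multi_index n k) : (\sum_j mval e j = k)%N.
Proof. exact/eqP/(valP e). Qed.

Lemma multi_index_ex k (c : 'I_n -> nat) : (\sum_j c j = k)%N ->
  exists e : multi_index n k, mval e =1 c.
Proof.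
move=> ck; have cj j : (c j < k.+1)%N by rewrite ltnS -ck (bigD1 j) //= leq_addr.
have ce : (\sum_j (([ffun j => Ordinal (cj j)] : {ffun 'I_n -> 'I_k.+1}) j : nat) == k)%N.
  by apply/eqP; rewrite -[RHS]ck; apply: eq_bigr => j _; rewrite ffunE.
by exists (exist (fun e : {ffun 'I_n -> 'I_k.+1} => \sum_i e i == k)%N _ ce) => j; rewrite /mval /= ffunE.
Qed.

(** The exponent vector of a monomial times the variable [i]. *)
Definition raise (i : 'I_n) (f : 'I_n -> nat) : 'I_n -> nat :=
  fun j => (f j + (j == i))%N.

Lemma sum_raise i f : (\sum_j raise i f j = (\sum_j f j).+1)%N.
Proof.
rewrite big_split /= -addn1; congr (_ + _)%N.
by rewrite (bigD1 i) //= eqxx big1 // => j /negPf->.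
Qed.

Lemma raiseC i j f : raise i (raise j f) = raise j (raise i f).
Proof. by apply/funext => l; rewrite /raise addnAC. Qed.

Lemma raise_ex k (e : multi_index n k) i :
  exists f : multi_index n k.+1, mval f =1 raise i (mval e).
Proof. by apply: multi_index_ex; rewrite sum_raise mval_sum. Qed.

Lemma lower_ex k (f : multi_index n k.+1) i : (0 < mval f i)%N ->
  exists e : multi_index n k, mval f =1 raise i (mval e).
Proof.
move=> fi; have [|e he] := @multi_index_ex k (fun j => mval f j - (j == i))%N.
  apply/succn_inj; rewrite -(sum_raise i) -[RHS](mval_sum f); apply: eq_bigr => j _.
  by rewrite /raise; case: eqP => [->|_]; rewrite ?subn0 ?addn0 // subnK.
exists e => j; rewrite /raise he; case: eqP => [->|_]; rewrite ?subn0 ?addn0 //.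
by rewrite subnK.
Qed.

Lemma differ_byP m (e : multi_index n m.-1) (f : multi_index n m) i :
  reflect (mval f =1 raise i (mval e)) (differ_by e f i).
Proof. by apply: (iffP forallP) => h j; apply/eqP; exact: h. Qed.

Definition supported_in (A : {set 'I_n}) k : {set multi_index n k} :=
  [set e | [forall j, (j \notin A) ==> (mval e j == 0)]].

Lemma supported_inP (A : {set 'I_n}) k (e : multi_index n k) :
  reflect (forall j, j \notin A -> mval e j = 0%N) (e \in supported_in A k).
Proof.
rewrite inE; apply: (iffP forallP) => h j; first by move=> jA; apply/eqP/(implyP (h j)).
by apply/implyP => /h->.
Qed.

(** Divisibility by the variable [i] splits the monomials; the quotients have
    degree one less. *)
Lemma card_supportedS (A : {set 'I_n}) k i : i \in A ->
  (#|supported_in A k.+1| = #|supported_in (A :\ i) k.+1| + #|supported_in A k|)%N.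
Proof.
move=> iA; have /choice[g hg] := fun e : multi_index n k => raise_ex e i.
have ginj : injective g.
  move=> e e' gee; apply: mval_inj => j; apply: (@addIn (j == i)).
  by have := hg e j; rewrite gee hg.
rewrite -(card_imset _ ginj) -cardsUI.
have -> : (supported_in (A :\ i) k.+1 :&: [set g x | x in supported_in A k] = finset.set0)%SET.
  apply/setP => f; rewrite [in RHS]inE; apply/negbTE/negP; rewrite inE => /andP[/supported_inP h].
  move=> /imsetP[e _ fe]; have := h i; rewrite !inE eqxx fe hg /raise eqxx addn1.
  by move=> /(_ isT).
rewrite cards0 addn0; congr #|pred_of_set _|; apply/setP => f; rewrite [RHS]inE.
apply/idP/orP => [/supported_inP fA|[/supported_inP fA|/imsetP[e /supported_inP eA ->]]].
- have [fi0|fi] := posnP (mval f i).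
    left; apply/supported_inP => j; rewrite !inE negb_and negbK.
    by move=> /orP[/eqP->|/fA].
  right; have [e fe] := lower_ex fi; apply/imsetP; exists e; last first.
    by apply: mval_inj => j; rewrite fe hg.
  apply/supported_inP => j jA; have := fA j jA; rewrite fe /raise; lia.
- by apply/supported_inP => j jA; apply: fA; rewrite !inE (negPf jA) andbF.
- apply/supported_inP => j jA; rewrite hg /raise eA // add0n.
  by case: eqP => // e0; rewrite e0 iA in jA.
Qed.

Lemma card_supported_set0 k : #|supported_in finset.set0 k.+1| = 0%N.
Proof.
apply/eqP; rewrite cards_eq0; apply/eqP/setP => e; rewrite [RHS]inE.
apply/negbTE/negP => /supported_inP h; have := mval_sum e.
by rewrite big1 // => j _; apply: h; rewrite inE.
Qed.

Lemma card_supported0 (A : {set 'I_n}) : #|supported_in A 0| = 1%N.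
Proof.
have [|e0 he0] := @multi_index_ex 0 (fun=> 0%N); first by rewrite big1.
have -> : supported_in A 0 = [set e0]%SET; last by rewrite cards1.
have z (e : multi_index n 0) j : mval e j = 0%N.
  apply/eqP; rewrite -leqn0 -[X in (_ <= X)%N](mval_sum e).
  by rewrite [leqRHS](bigD1 j) //= leq_addr.
apply/setP => e; rewrite [RHS]inE; apply/supported_inP/eqP => [_|_ j _]; last exact: z.
by apply: mval_inj => j; rewrite !z.
Qed.

Lemma card_supported (A : {set 'I_n}) k :
  #|supported_in A k| = 'C(#|A| + k - 1, k)%N.
Proof.
move: {2}#|A| (erefl #|A|) => a; elim: a A k => [|a IHa] A k cA.
  rewrite cA (cards0_eq cA); case: k => [|k]; first by rewrite card_supported0 bin0.
  by rewrite card_supported_set0 bin_small // add0n subn1.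
elim: k => [|k IHk]; first by rewrite card_supported0 bin0.
have /set0Pn[i iA] : A != finset.set0 by rewrite -cards_eq0 cA.
have cAi : #|A :\ i| = a by have := cardsD1 i A; rewrite iA cA => -[].
rewrite (card_supportedS _ iA) IHk IHa // cAi cA.
by rewrite !addSn !subn1 /= addnS binS.
Qed.

Lemma card_multi_index k : #|multi_index n k| = 'C(n + k - 1, k)%N.
Proof.
have <- : #|supported_in finset.setT k| = #|multi_index n k|.
  apply: eq_card => e; rewrite [RHS]inE; apply/supported_inP => j.
  by rewrite inE.
by rewrite card_supported cardsT card_ord.
Qed.

(** Hockey-stick summation: the monomials divisible by a variable in [A] are
    counted by [e_num m #|A|], and the others are supported in a smaller set. *)
Lemma card_supported_sum m (A : {set 'I_n}) : (0 < m)%N ->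
  #|supported_in A m| = (\sum_(1 <= l < #|A|.+1) e_num m l)%N.
Proof.
case: m => // k _; move: {2}#|A| (erefl #|A|) => a; elim: a A => [|a IHa] A cA.
  by rewrite (cards0_eq cA) card_supported_set0 cards0 big_geq.
have /set0Pn[i iA] : A != finset.set0 by rewrite -cards_eq0 cA.
have cAi : #|A :\ i| = a by have := cardsD1 i A; rewrite iA cA => -[].
rewrite (card_supportedS _ iA) IHa // cAi cA [RHS]big_nat_recr //.
apply: (congr2 addn) => //; rewrite card_supported cA /e_num -bin_sub; last by lia.
by congr 'C(_, _); lia.
Qed.

Lemma card_multi_index_sum m : (0 < m)%N ->
  #|multi_index n m| = (\sum_(1 <= l < n.+1) e_num m l)%N.
Proof.
move=> m0; have <- : #|supported_in finset.setT m| = #|multi_index n m|.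
  apply: eq_card => e; rewrite [RHS]inE; apply/supported_inP => j.
  by rewrite inE.
by rewrite card_supported_sum // cardsT card_ord.
Qed.

Lemma card_e_num m : (0 < n)%N -> (0 < m)%N -> #|multi_index n m.-1| = e_num m n.
Proof.
move=> n0 m0; rewrite card_multi_index /e_num -bin_sub; last by lia.
by congr 'C(_, _); lia.
Qed.

Lemma card_f_num m : (0 < n)%N -> #|multi_index n m| = f_num m n.
Proof.
move=> n0; rewrite card_multi_index /f_num -bin_sub; last by lia.
by congr 'C(_, _); lia.
Qed.
End MultiIndex.

(** * The conditions cut out by a lattice *)

Section Level.
Variables (o : idomainType) (pi : o) (q : nat).
Hypothesis lp : local_parameter pi.
Hypothesis hq : has_index (principal pi) q.

(** The [e] for which the index is [q ^ e], when there is one; the logarithm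
    makes it a total function. *)
Definition level (M : zmodType) (L : set M) : nat := trunc_log q (submod_index L).

Lemma level_has_index (V : lmodType o) (L : set V) e : is_submodule L ->
  has_index L (q ^ e) -> level L = e.
Proof.
move=> sL hL; have [_ idx] := has_index_finite (submodule_subgroup sL) hL.
by rewrite /level idx trunc_expnK // (q_gt1 lp hq).
Qed.

Lemma lattice_level (I : finType) (L : set {ffun I -> o^o}) : lattice pi L ->
  has_index L (q ^ level L).
Proof.
move=> lL; have [_ [e he]] := lattice_free lp hq lL.
by rewrite (level_has_index lL.1 he).
Qed.

Lemma level_image (I : finType) (h : {ffun I -> o^o} -> {ffun I -> o^o})
    (L : set {ffun I -> o^o}) e :
  linear h -> injective h -> has_index (range h) (q ^ e) -> lattice pi L ->
  level (h @` L) = (e + level L)%N.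
Proof.
move=> lh ih hr lL; apply: level_has_index; first exact: submodule_image lL.1.
rewrite expnD; apply: has_index_image => //; first exact: linB lh.
exact: lattice_level.
Qed.

Lemma level_setT (V : lmodType o) : level [set: V] = 0%N.
Proof. by apply: level_has_index; [apply: submodule_setT | apply: has_index_setT]. Qed.

Lemma level_transvection (I : finType) k (u : {ffun I -> o^o}) L :
  u k = 0 -> lattice pi L -> level (transvection k u @` L) = level L.
Proof.
move=> uk lL; rewrite (level_image (linear_transvection k u) _ (e := 0)) //.
  exact: can_inj (transvectionK uk).
by rewrite transvection_image_setT //; apply: has_index_setT.
Qed.

Lemma level_scale_on (I : finType) (C : {set I}) (L : set {ffun I -> o^o}) :
  lattice pi L -> level (scale_on pi C @` L) = (#|C| + level L)%N.
Proof.
move=> lL; apply: level_image => //; first exact: linear_scale_on.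
  exact: scale_on_inj (lp_neq0 lp).
exact: has_index_scale_on (lp_neq0 lp) hq.
Qed.

Lemma level_scaling_weight (I : finType) :
  scaling_weight pi (@level {ffun I -> o^o}) id.
Proof.
split=> [|k u L uk lL|C L [lL _ _]]; first exact: level_setT.
  exact: level_transvection.
exact: level_scale_on.
Qed.

Section Conditions.
Variables n k : nat.
Local Notation V := {ffun 'I_n -> o^o}.
Local Notation Em := (multi_index n k).
Local Notation Fm := (multi_index n k.+1).
Implicit Types (L : set V) (a : {ffun Em -> o^o}) (b : {ffun Fm -> o^o}).

(** Extension by zero to the monomials of other degrees, so that substitutions
    of variables can be written for all degrees at once. *)
Definition extend d (b : {ffun multi_index n d -> o^o}) (f : 'I_n -> nat) : o :=
  \sum_(F | [forall j, mval F j == f j]) b F.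

Lemma extendE d (b : {ffun multi_index n d -> o^o}) F : extend b (mval F) = b F.
Proof.
rewrite /extend (big_pred1 F) // => G; apply/forallP/eqP => [h|-> //].
by apply: mval_inj => j; apply/eqP.
Qed.

Lemma extend0 d (b : {ffun multi_index n d -> o^o}) (f : 'I_n -> nat) :
  \sum_j f j != d -> extend b f = 0.
Proof.
move=> fd; rewrite /extend big1 // => F /forallP h; case/eqP: fd.
by rewrite -[RHS](mval_sum F); apply: eq_bigr => j _; apply/esym/eqP.
Qed.

Lemma extend_linear d (x : o) (b c : {ffun multi_index n d -> o^o}) f :
  extend (x *: b + c) f = x * extend b f + extend c f.
Proof.
by rewrite /extend mulr_sumr -big_split; apply: eq_bigr => F _; rewrite !ffunE.
Qed.

Lemma extendP d (f : 'I_n -> nat) : \sum_j f j = d ->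
  exists F : multi_index n d, f = mval F.
Proof. by move=> /multi_index_ex[F hF]; exists F; apply/funext => j. Qed.

(** The bracket of the vector [a] of coefficients of the [x_e] with [y_f]. *)
Definition bracket_x a (f : Fm) : V := [ffun i => \sum_(e | @differ_by k.+1 n e f i) a e].

(** The bracket of [x_e] with the vector [b] of coefficients of the [y_f]. *)
Definition bracket_y b (e : Em) : V := [ffun i => \sum_(f | @differ_by k.+1 n e f i) b f].

Definition cond_x L : set {ffun Em -> o^o} := [set a | forall f, L (bracket_x a f)].
Definition cond_y L : set {ffun Fm -> o^o} := [set b | forall e, L (bracket_y b e)].

Lemma bracket_x_linear x a a' f : bracket_x (x *: a + a') f = x *: bracket_x a f + bracket_x a' f.
Proof.
apply/ffunP => i; rewrite !ffunE scaler_sumr -big_split.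
by apply: eq_bigr => e _; rewrite !ffunE.
Qed.

Lemma bracket_y_linear x b b' e : bracket_y (x *: b + b') e = x *: bracket_y b e + bracket_y b' e.
Proof.
apply/ffunP => i; rewrite !ffunE scaler_sumr -big_split.
by apply: eq_bigr => f _; rewrite !ffunE.
Qed.

Lemma bracket_xZ x a f : bracket_x (x *: a) f = x *: bracket_x a f.
Proof. exact: (linZ (f := fun a => bracket_x a f)) (fun x a a' => bracket_x_linear x a a' f) x a. Qed.

Lemma bracket_yZ x b e : bracket_y (x *: b) e = x *: bracket_y b e.
Proof. exact: (linZ (f := fun b => bracket_y b e)) (fun x b b' => bracket_y_linear x b b' e) x b. Qed.

Lemma cond_x_lattice L : lattice pi L -> lattice pi (cond_x L).
Proof.
move=> [sL [M hM]]; split; last by exists M => a f; rewrite bracket_xZ.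
apply/submoduleP; split=> [f|x a a' La La' f].
  by rewrite -[0](scale0r (0 : {ffun Em -> o^o})) bracket_xZ scale0r; apply: sm0.
by rewrite bracket_x_linear; apply: smD => //; apply: smZ.
Qed.

Lemma cond_y_lattice L : lattice pi L -> lattice pi (cond_y L).
Proof.
move=> [sL [M hM]]; split; last by exists M => b e; rewrite bracket_yZ.
apply/submoduleP; split=> [e|x b b' Lb Lb' e].
  by rewrite -[0](scale0r (0 : {ffun Fm -> o^o})) bracket_yZ scale0r; apply: sm0.
by rewrite bracket_y_linear; apply: smD => //; apply: smZ.
Qed.

(** Multiplication by a variable of smaller index adds more, which orders the
    system in [cond_x_unit]. *)
Definition mweight (e : Em) : nat := (\sum_j mval e j * (n - j))%N.

Lemma mweight_raise (e e' : Em) (i j : 'I_n) :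
  raise j (mval e) =1 raise i (mval e') -> (j < i)%N -> (mweight e < mweight e')%N.
Proof.
have sumS l (e1 : Em) : (\sum_x raise l (mval e1) x * (n - x) = mweight e1 + (n - l))%N.
  rewrite /raise /mweight; under eq_bigr do rewrite mulnDl.
  rewrite big_split /= ; congr (_ + _)%N.
  by rewrite (bigD1 l) //= eqxx mul1n big1 ?addn0 // => x /negPf->.
move=> h ji; have : (mweight e + (n - j) = mweight e' + (n - i))%N.
  by rewrite -!sumS; apply: eq_bigr => x _; rewrite h.
have := ltn_ord i; lia.
Qed.

(** If some coefficient of [a] is a unit, the brackets of [a] with the [y_f]
    span the whole module: at the unit coefficient of largest weight they form
    a triangular system modulo [pi]. *)
Lemma cond_x_unit L a e0 : lattice pi L -> cond_x L a -> a e0 \is a GRing.unit ->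
  L = [set: V].
Proof.
move=> [sL [M hM]] La ue0.
case: (@arg_maxnP _ e0 (fun e => a e \is a GRing.unit) mweight ue0) => e ue maxe.
(* [P] is [L + pi V]; it is enough to show that it is everything, and then to
   iterate modulo higher powers of [pi]. *)
pose P : set V := [set v | exists w, L (v + pi *: w)].
have sP : is_submodule P.
  apply/submoduleP; split; first by exists 0; rewrite scaler0 addr0; apply: sm0.
  move=> x u v [u' Lu] [v' Lv]; exists (x *: u' + v').
  rewrite scalerDr scalerA [pi * x]mulrC -scalerA addrACA -scalerDr.
  by apply: smD => //; apply: smZ.
have Punit j : P (unit_vec o j).
  move: {2}(nat_of_ord j) (erefl (nat_of_ord j)) => N; elim/ltn_ind: N j => N IHN j jN.
  have [f hf] := raise_ex e j.
  have aj : bracket_x a f j = a e.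
    rewrite ffunE (big_pred1 e) // => e'; apply/differ_byP/eqP => [h|-> //].
    by apply: mval_inj => l; apply: (@addIn (l == j)); rewrite -[LHS]h hf.
  have ai (i : 'I_n) : (j < i)%N -> principal pi (bracket_x a f i).
    move=> ji; rewrite ffunE; apply: (sm_sum (principal_ideal pi)) => e' /differ_byP he'.
    have [//|np] := pselect (principal pi (a e')).
    have /maxe hle := (unit_not_principal lp (a e')).2 np.
    have : (mweight e < mweight e')%N.
      by apply: (@mweight_raise _ _ i j) => // l; rewrite -hf he'.
    by rewrite ltnNge => /negP; case.
  have Pb : P (bracket_x a f) by exists 0; rewrite scaler0 addr0.
  have : P (a e *: unit_vec o j).
    have e1 : bracket_x a f = a e *: unit_vec o j +
        \sum_(i | i != j) bracket_x a f i *: unit_vec o i.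
      by rewrite [LHS]sum_unit_vec (bigD1 j) //= aj.
    rewrite e1 in Pb; apply: (smDr sP _ Pb); apply: (sm_sum sP) => i ij.
    have [ij'|ji|/val_inj e2] := ltngtP i j; last by rewrite e2 eqxx in ij.
      by apply: (smZ sP); apply: (IHN i) => //; rewrite -jN.
    have [d _ <-] := ai i ji; exists (- (d *: unit_vec o i)).
    by rewrite scalerN scalerA subrr; apply: sm0.
  by move=> /(smZ sP (a e)^-1); rewrite scalerA mulVr // scale1r.
have PT v : P v.
  by rewrite (sum_unit_vec v); apply: (sm_sum sP) => i _; apply: (smZ sP).
have Pn N : forall v, exists w, L (v + pi ^+ N *: w).
  elim: N => [|N IHN] v; first by exists (- v); rewrite scale1r subrr; apply: sm0.
  have [w Lw] := IHN v; have [w' Lw'] := PT w; exists (- w').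
  rewrite exprSr -scalerA scalerN.
  have -> : v + pi ^+ N *: - (pi *: w') = (v + pi ^+ N *: w) - pi ^+ N *: (w + pi *: w').
    by rewrite scalerDr opprD addrA addrK scalerN.
  by apply: smB => //; apply: smZ.
apply/seteqP; split=> // v _; have [w Lw] := Pn M v.
exact: (smDr sL (hM w) Lw).
Qed.

(** If some coefficient is a unit then [L] is everything; otherwise [a] is
    divisible by [pi], and the quotient satisfies the condition for the larger
    lattice of vectors that [pi] maps to [L]. *)
Lemma cond_xE L : lattice pi L ->
  cond_x L = [set a | forall e v, L (a e *: v)].
Proof.
move=> lL; apply/seteqP; split=> a; last first.
  move=> h f; rewrite (sum_unit_vec (bracket_x a f)); apply: (sm_sum lL.1) => i _.
  rewrite ffunE scaler_suml; apply: (sm_sum lL.1) => e _; exact: h.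
move: L a lL => L a [sL [M hM]]; elim: M L a sL hM => [|M IHM] L a sL hM La e v.
  by have := hM (a e *: v); rewrite scale1r.
have [[e0 ue0]|nu] := pselect (exists e0, a e0 \is a GRing.unit).
  have lL : lattice pi L by split=> //; exists M.+1.
  by rewrite (cond_x_unit lL La ue0).
have /choice[c hc] : forall e, exists x, a e = pi * x.
  by move=> e'; case: lp => _ _ /(_ (a e'))[ue|//]; case: nu; exists e'.
pose a' : {ffun Em -> o^o} := [ffun e => c e].
have aa' : a = pi *: a' by apply/ffunP => e'; rewrite !ffunE hc.
have lin : linear (fun v : V => pi *: v).
  by move=> x u w; rewrite scalerDr !scalerA mulrC.
have := IHM ((fun v => pi *: v) @^-1` L) a' (submodule_preimage lin sL).
rewrite /= => h; have := h _ _ e v.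
rewrite aa' !ffunE -scalerA scalerA; apply=> [w|f] /=.
  by rewrite scalerA -exprS.
by rewrite -bracket_xZ -aa'.
Qed.

Lemma lattice_transvection j (u : V) L : u j = 0 -> lattice pi L ->
  lattice pi (transvection j u @` L).
Proof.
move=> uj [sL [M hM]]; split; first exact: (submodule_image (linear_transvection j u) sL).
by exists M => v; rewrite transvection_image //= (linZ (linear_transvection j _)).
Qed.

Lemma cond_x_transvection j (u : V) L : u j = 0 -> lattice pi L ->
  cond_x (transvection j u @` L) = cond_x L.
Proof.
move=> uj lL; have lL' := lattice_transvection uj lL.
rewrite !cond_xE // transvection_image //; apply/seteqP; split=> a h e v.
  rewrite -(transvectionK uj (a e *: v)) (linZ (linear_transvection j u)).
  exact: h.
by rewrite /= (linZ (linear_transvection j _)); apply: h.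
Qed.

(** By [cond_xE] the condition on each coefficient is the same, and as [C] is
    nonempty each coefficient has to be divisible by [pi]. *)
Lemma cond_x_scale C L : C != finset.set0 ->
  lattice_class pi finset.set0 (~: C)%SET L ->
  cond_x (scale_on pi C @` L) = scale_on pi finset.setT @` cond_x L.
Proof.
move=> /finset.set0Pn[j jC] LL; have [lL LA _] := LL; have sL := lL.1.
have [lL' LA' _] := scale_on_class LL; have sL' := lL'.1.
rewrite !cond_xE //.
have inj := scale_on_inj (lp_neq0 lp) (C := C).
have hC i x : i \in C -> scale_on pi C (x *: unit_vec o i) = (pi * x) *: unit_vec o i.
  move=> iC; apply/ffunP => l; rewrite !ffunE; case: eqP => [->|_].
    by rewrite iC /GRing.scale /= mulrA.
  by rewrite /GRing.scale /= !mulr0 if_same.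
apply/seteqP; split=> [a h|_ [a h <-] e v] /=.
  have /choice[c hc] : forall e, exists x, a e = pi * x.
    move=> e; have [x Lx /(congr1 (fun v : V => v j))] := h e (unit_vec o j).
    by rewrite !ffunE jC eqxx [_ *: _]mulr1 => <-; exists (x j).
  exists [ffun e => c e]; last by apply/ffunP => e; rewrite !ffunE inE hc.
  move=> e v; rewrite ffunE (sum_unit_vec v) scaler_sumr; apply: (sm_sum sL) => i _.
  rewrite scalerA mulrC -scalerA; apply: (smZ sL).
  have [iC|iC] := boolP (i \in C); last by apply: (smZ sL); apply: LA; rewrite inE.
  have [x Lx] := h e (unit_vec o i).
  by rewrite hc -hC // => /inj <-.
rewrite ffunE inE (sum_unit_vec v) scaler_sumr; apply: (sm_sum sL') => i _.
rewrite scalerA mulrC -scalerA; apply: (smZ sL').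
have [iC|iC] := boolP (i \in C); last by apply: (smZ sL'); apply: LA'; rewrite inE.
by exists (a e *: unit_vec o i); [apply: h | rewrite hC].
Qed.

(** Reading [b] as a linear form on polynomials, [subst d b] is its composition
    with the substitution of [X_l + d X_j] for [X_l].  On the monomial [f] this
    expands [(X_l + d X_j) ^ f_l] one factor at a time, which is what the iteration
    of [combine] does. *)
Section Substitution.
Variables (j l : 'I_n) (c : o).
Hypothesis jl : j != l.
Implicit Types (y : ('I_n -> nat) -> o) (f : 'I_n -> nat).

Definition zero_at f : 'I_n -> nat := fun i => if i == l then 0%N else f i.
Definition combine (d : o) y : ('I_n -> nat) -> o :=
  fun f => y (raise l f) + d * y (raise j f).
Definition subst (d : o) y : ('I_n -> nat) -> o :=
  fun f => iter (f l) (combine d) y (zero_at f).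

Lemma zero_at_raise i f : i != l -> zero_at (raise i f) = raise i (zero_at f).
Proof.
move=> il; apply/funext => x; rewrite /zero_at /raise; case: eqP => // ->.
by rewrite eq_sym (negPf il).
Qed.

Lemma iter_combine_raise d p i y f :
  iter p (combine d) y (raise i f) = iter p (combine d) (fun g => y (raise i g)) f.
Proof.
elim: p f => //= p IH f; rewrite /combine -!IH.
by rewrite (raiseC l) (raiseC j).
Qed.

Lemma subst_raise d i y f : i != l ->
  subst d y (raise i f) = subst d (fun g => y (raise i g)) f.
Proof.
move=> il; rewrite /subst zero_at_raise // -iter_combine_raise.
by rewrite {1}/raise eq_sym (negPf il) addn0.
Qed.

Lemma iter_combineD d p y y' x f :
  iter p (combine d) (fun g => y g + x * y' g) f =
  iter p (combine d) y f + x * iter p (combine d) y' f.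
Proof. by elim: p f => //= p IH f; rewrite /combine !IH; ring. Qed.

(** Multiplying by [X_l] before the substitution is multiplying by [X_l + d X_j]
    after it. *)
Lemma subst_raise_l d y f : subst d y (raise l f) =
  subst d (fun g => y (raise l g)) f + d * subst d (fun g => y (raise j g)) f.
Proof.
rewrite /subst -iter_combineD.
have -> : raise l f l = (f l).+1 by rewrite /raise eqxx addn1.
rewrite (_ : zero_at (raise l f) = zero_at f) ?iterSr //.
by apply/funext => x; rewrite /zero_at /raise; case: eqP => // _; rewrite addn0.
Qed.

Lemma substK y : subst (- c) (subst c y) = y.
Proof.
apply/funext => f; rewrite {1}/subst.
have comb y' : combine (- c) (subst c y') = subst c (fun g => y' (raise l g)).
  apply/funext => g; rewrite /combine subst_raise_l subst_raise //.
  by rewrite mulNr addrK.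
have it p y' : iter p (combine (- c)) (subst c y') =
    subst c (iter p (fun z g => z (raise l g)) y').
  by elim: p y' => // p IH y'; rewrite !iterSr comb IH.
have zz : zero_at (zero_at f) = zero_at f.
  by apply/funext => x; rewrite /zero_at; case: eqP.
rewrite it /subst zz {1}/zero_at eqxx /=.
have sh p g : iter p (fun z g => z (raise l g)) y g = y (fun x => g x + (x == l) * p)%N.
  elim: p g => [|p IH] g /=; first by congr y; apply/funext => x; rewrite muln0 addn0.
  by rewrite IH; congr y; apply/funext => x; rewrite /raise mulnS addnA.
rewrite sh; congr y; apply/funext => x; rewrite /zero_at.
by case: eqP => [->|_]; rewrite ?mul1n ?mul0n ?addn0.
Qed.

Lemma subst_degree d y N : (forall f, (\sum_i f i != N)%N -> y f = 0) ->
  forall f, (\sum_i f i != N)%N -> subst d y f = 0.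
Proof.
move=> y0 f fN; rewrite /subst.
have it p g : (\sum_i g i + p != N)%N -> iter p (combine d) y g = 0.
  elim: p g => [|p IH] g gN /=; first by rewrite addn0 in gN; apply: y0.
  by rewrite /combine !IH ?mulr0 ?addr0 // sum_raise addSnnS.
apply: it; have -> // : (\sum_i zero_at f i + f l = \sum_i f i)%N.
rewrite (bigD1 l) //= [RHS](bigD1 l) //= addnC /zero_at eqxx; congr (_ + _)%N.
by apply: eq_bigr => i /negPf->.
Qed.

Lemma subst_in L d (ys : 'I_n -> ('I_n -> nat) -> o) : is_submodule L ->
  (forall f, L [ffun i => ys i f]) -> forall f, L [ffun i => subst d (ys i) f].
Proof.
move=> sL hy f; rewrite /subst.
suff h p g : L [ffun i => iter p (combine d) (ys i) g] by apply: h.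
elim: p g => [|p IH] g /=; first exact: hy.
have -> : [ffun i => combine d (iter p (combine d) (ys i)) g] =
    d *: ([ffun i => iter p (combine d) (ys i) (raise j g)] : V) +
    [ffun i => iter p (combine d) (ys i) (raise l g)].
  by apply/ffunP => i; rewrite !ffunE /combine addrC.
by apply: smD => //; apply: smZ.
Qed.

Lemma bracket_yE b e : bracket_y b e = [ffun i => extend b (raise i (mval e))].
Proof. by []. Qed.

Lemma cond_y_extend L b : is_submodule L -> cond_y L b <->
  forall f, L [ffun i => extend b (raise i f)].
Proof.
move=> sL; split=> [Lb f|h e]; last exact: h.
have [/extendP[e ->]|fk] := eqVneq (\sum_i f i)%N k; first exact: Lb.
have -> : [ffun i => extend b (raise i f)] = 0 :> V; last exact: sm0.
by apply/ffunP => i; rewrite !ffunE extend0 // sum_raise eqSS.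
Qed.

Definition subst_map d b : {ffun Fm -> o^o} := [ffun F => subst d (extend b) (mval F)].

Lemma extend_subst_map d b : extend (subst_map d b) = subst d (extend b).
Proof.
apply/funext => f; have [/extendP[F ->]|fk] := eqVneq (\sum_i f i)%N k.+1.
  by rewrite extendE ffunE.
by rewrite extend0 //; apply/esym/(@subst_degree d _ k.+1) => // g; apply: extend0.
Qed.

Lemma linear_subst_map d : linear (subst_map d).
Proof.
move=> x b b'; apply/ffunP => F; rewrite !ffunE.
have -> : extend (x *: b + b') = fun g => extend b' g + x * extend b g.
  by apply/funext => g; rewrite extend_linear addrC.
by rewrite /subst iter_combineD addrC.
Qed.

(** The vector of the [subst d b] at the raises of [f] is the transvection of the
    vector of substitutions of the shifted forms, and the latter are combinations
    of vectors in [L]. *)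
Lemma subst_map_cond d L b : is_submodule L -> cond_y L b ->
  cond_y (transvection j (d *: unit_vec o l) @` L) (subst_map d b).
Proof.
move=> sL /(cond_y_extend _ sL) Lb.
apply/cond_y_extend; first exact: (submodule_image (linear_transvection j _) sL).
move=> f; rewrite extend_subst_map.
exists [ffun i => subst d (fun g => extend b (raise i g)) f].
  exact: (subst_in d sL).
apply/ffunP => i; rewrite !ffunE; have [->|il] := eqVneq i l.
  by rewrite subst_raise_l /GRing.scale /= mulr1 mulrC.
by rewrite subst_raise // /GRing.scale /= !mulr0 addr0.
Qed.
End Substitution.

Lemma subst_mapK (j l : 'I_n) c : j != l ->
  cancel (subst_map j l c) (subst_map j l (- c)).
Proof.
move=> jl b; apply/ffunP => F; rewrite ffunE extend_subst_map substK //.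
exact: extendE.
Qed.

Lemma level_cond_y_elementary (j l : 'I_n) c L : j != l -> lattice pi L ->
  level (cond_y (transvection j (c *: unit_vec o l) @` L)) = level (cond_y L).
Proof.
move=> jl lL; set u := c *: _; have uj : u j = 0.
  by rewrite !ffunE (negPf jl) [_ *: _]mulr0.
have -> : cond_y (transvection j u @` L) = subst_map j l c @` cond_y L.
  apply/seteqP; split=> [b hb|_ [b hb <-]]; last first.
    exact: (@subst_map_cond j l c _ _ lL.1 hb).
  exists (subst_map j l (- c) b); last first.
    by rewrite -{1}(opprK c) subst_mapK.
  have sL' := submodule_image (linear_transvection j u) lL.1.
  have := @subst_map_cond j l (- c) _ _ sL' hb; rewrite scaleNr -/u.
  have -> // : transvection j (- u) @` (transvection j u @` L) = L.
  apply/seteqP; split=> [_ [_ [x Lx <-] <-]|x Lx]; first by rewrite transvectionK.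
  by exists (transvection j u x); [exists x | rewrite transvectionK].
rewrite (level_image (linear_subst_map j l c) (can_inj (subst_mapK c jl)) (e := 0)) //.
  have -> : range (subst_map j l c) = [set: {ffun Fm -> o^o}].
    apply/seteqP; split=> // b _; exists (subst_map j l (- c) b) => //.
    by rewrite -{1}(opprK c) subst_mapK.
  exact: has_index_setT.
exact: cond_y_lattice.
Qed.

(** A transvection along [j] is a product of elementary ones. *)
Lemma level_cond_y_transvection j (u : V) L : u j = 0 -> lattice pi L ->
  level (cond_y (transvection j u @` L)) = level (cond_y L).
Proof.
move=> uj.
have -> : u = \sum_(i | i != j) u i *: unit_vec o i.
  by rewrite {1}(sum_unit_vec u) (bigD1 j) //= uj scale0r add0r.
move: L; pose P (w : V) := w j = 0 /\ forall L, lattice pi L ->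
  level (cond_y (transvection j w @` L)) = level (cond_y L).
suff : P (\sum_(i | i != j) u i *: unit_vec o i) by case.
elim/big_ind: _ => [|w w' [wj hw] [wj' hw']|i ij].
- split=> [|L lL]; first by rewrite ffunE.
  congr (level (cond_y _)); apply/seteqP; split=> v.
    by move=> [x Lx <-]; rewrite transvection0.
  by exists v; rewrite ?transvection0.
- split=> [|L lL]; first by rewrite ffunE wj wj' addr0.
  rewrite -(hw' _ lL) -(hw _ (lattice_transvection wj' lL)).
  congr (level (cond_y _)); apply/seteqP; split=> v.
    move=> [x Lx <-]; exists (transvection j w' x); first by exists x.
    exact: transvectionD.
  by move=> [_ [x Lx <-] <-]; exists x; rewrite ?transvectionD.
- split=> [|L lL]; first by rewrite !ffunE eq_sym (negPf ij) [_ *: _]mulr0.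
  by apply: level_cond_y_elementary; rewrite // eq_sym.
Qed.

(** The [f] for which [y_f] has a bracket with nonzero coefficient at some [z_i],
    [i] in [C]. *)
Definition meets (C : {set 'I_n}) : {set Fm} := ~: supported_in (~: C)%SET k.+1.

Lemma meetsP (C : {set 'I_n}) F :
  reflect (exists2 i, i \in C & (0 < mval F i)%N) (F \in meets C).
Proof.
rewrite /meets inE; apply: (iffP idP) => [|[i iC Fi]]; last first.
  apply/negP => /supported_inP /(_ i); rewrite inE negbK => /(_ iC) F0.
  by rewrite F0 in Fi.
have [//|no /negP[]] := pselect (exists2 i, i \in C & (0 < mval F i)%N).
apply/supported_inP => i; rewrite inE negbK => iC.
by apply/eqP; rewrite -leqn0 leqNgt; apply/negP => Fi; apply: no; exists i.
Qed.

(** Outside [C] the lattice contains all unit vectors and imposes nothing; inside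
    [C] every coordinate of [bracket_y b e] is a [b_F] with [F] in [meets C]. *)
Lemma cond_y_scale C L : lattice_class pi finset.set0 (~: C)%SET L ->
  cond_y (scale_on pi C @` L) = scale_on pi (meets C) @` cond_y L.
Proof.
move=> LL; have [lL LA _] := LL; have sL := lL.1.
have [lL' LA' LC'] := scale_on_class LL; have sL' := lL'.1.
have inj := scale_on_inj (lp_neq0 lp) (C := C).
have eqb b : cond_y (scale_on pi C @` L) (scale_on pi (meets C) b) <-> cond_y L b.
  suff h e : (scale_on pi C @` L) (bracket_y (scale_on pi (meets C) b) e) <->
             L (bracket_y b e).
    by split=> hb e; apply/h; apply: hb.
  set v := bracket_y _ e; set v' := bracket_y b e.
  have vv' i : i \in C -> v i = scale_on pi C v' i.
    move=> iC; have [F hF] := raise_ex e i.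
    have FE : raise i (mval e) = mval F by apply/funext.
    rewrite /v /v' !bracket_yE !ffunE iC FE !extendE ffunE.
    by case: (meetsP C F) => // -[]; exists i; rewrite // hF /raise eqxx addn1.
  have diff : (scale_on pi C @` L) (v - scale_on pi C v').
    rewrite (sum_unit_vec (v - _)); apply: (sm_sum sL') => i _.
    have [iC|iC] := boolP (i \in C).
      have vB (x y : V) : (x - y) i = x i - y i by rewrite !ffunE.
      by rewrite vB vv' // subrr scale0r; apply: sm0.
    by apply: (smZ sL'); apply: LA'; rewrite inE.
  split=> [Lv|Lv'].
    have : (scale_on pi C @` L) (scale_on pi C v').
      by have := smB sL' Lv diff; rewrite opprB addrC subrK.
    by move=> [x Lx /inj <-].
  by rewrite -(subrK (scale_on pi C v') v); apply: smD => //; exists v'.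
apply/seteqP; split=> [b hb|_ [b hb <-]]; last exact/eqb.
have : range (scale_on pi (meets C)) b.
  rewrite range_scale_on => F /meetsP[i iC Fi].
  have [e he] := lower_ex Fi; have := LC' _ _ (hb e) iC.
  by rewrite bracket_yE ffunE (_ : raise i (mval e) = mval F) ?extendE //; apply/funext.
by move=> [b' _ bb']; exists b' => //; apply/eqb; rewrite bb'.
Qed.

Definition lie_weight L : nat := (level L + (level (cond_x L) + level (cond_y L)))%N.

(** The exponent [b_i] of the Igusa function, for [i = n - j]; scaling on the
    empty set changes nothing, hence the separate value at 0. *)
Definition lie_beta (j : nat) : nat := if j is 0 then 0%N else b_num k.+1 n (n - j).

Lemma card_meets C : (0 < n)%N ->
  (#|meets C| = \sum_(n - #|C| + 1 <= l < n + 1) e_num k.+1 l)%N.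
Proof.
move=> n0; rewrite /meets.
have := finset.cardsC (supported_in (~: C)%SET k.+1).
rewrite card_supported_sum // card_multi_index_sum // => e.
apply/(@addnI (\sum_(1 <= l < #|~: C|.+1) e_num k.+1 l)); rewrite e !addn1.
have cC : (#|~: C| = n - #|C|)%N by rewrite finset.cardsCs finset.setCK card_ord.
by rewrite cC -big_cat_nat //= ltnS leq_subr.
Qed.

Lemma lie_scaling_weight : (0 < n)%N -> scaling_weight pi lie_weight lie_beta.
Proof.
move=> n0; split=> [|j u L uj lL|C L LL].
- rewrite /lie_weight level_setT.
  have -> : cond_x [set: V] = [set: {ffun Em -> o^o}] by apply/seteqP.
  have -> : cond_y [set: V] = [set: {ffun Fm -> o^o}] by apply/seteqP.
  by rewrite !level_setT.
- rewrite /lie_weight level_transvection // cond_x_transvection //.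
  by rewrite level_cond_y_transvection.
have [lL _ _] := LL; have [C0|Cn0] := eqVneq C finset.set0.
  rewrite C0 finset.cards0 add0n; congr lie_weight.
  apply/seteqP; split=> v; first by move=> [x Lx <-]; rewrite scale_on0.
  by exists v; rewrite ?scale_on0.
rewrite /lie_weight level_scale_on // cond_x_scale // cond_y_scale //.
rewrite !level_scale_on; [|exact: cond_y_lattice|exact: cond_x_lattice].
rewrite finset.cardsT card_meets // -/(multi_index n k) (@card_e_num n k.+1) //.
have Cn : (0 < #|C| <= n)%N.
  by rewrite card_gt0 Cn0 /= -[X in (_ <= X)%N](card_ord n) max_card.
rewrite /lie_beta; case: #|C| Cn => // c Cn; rewrite /b_num subKn //; lia.
Qed.
End Conditions.
End Level.

(** * Graded ideals *)

Section GradedIdeals.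
Variables (o : idomainType) (pi : o) (q : nat).
Hypothesis lp : local_parameter pi.
Hypothesis hq : has_index (principal pi) q.
Variables n k : nat.
Hypothesis n0 : (0 < n)%N.
Local Notation m := k.+1.
Local Notation Em := (multi_index n k).
Local Notation Fm := (multi_index n k.+1).
Local Notation J := (Em + Fm)%type.
Local Notation V1 := {ffun J -> o^o}.
Local Notation V2 := {ffun 'I_n -> o^o}.
Local Notation Lie := (lie_ring m n o).
Local Notation br := (@lie_bracket m n o).
Local Notation B := (brackets br).

Lemma lie_bracket_inl u v a : br u v (inl a) = 0.
Proof.
by rewrite ffunE big1 // => -[[?|?]|?] _; rewrite big1 // => -[[?|?]|?] _;
  rewrite /= mulr0z mulr0.
Qed.

Lemma lie_bracket_unit a b : br (unit_vec o a) (unit_vec o b) =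
  [ffun c => (structure_constant a b c)%:~R].
Proof.
apply/ffunP => c; rewrite !ffunE (bigD1 a) //= [X in _ + X]big1 => [|a' aa']; last first.
  by rewrite big1 // => b' _; rewrite !ffunE (negPf aa') !mul0r.
rewrite addr0 (bigD1 b) //= [X in _ + X]big1 => [|b' bb']; last first.
  by rewrite !ffunE (negPf bb') mulr0 mul0r.
by rewrite !ffunE !eqxx !mul1r addr0.
Qed.

(** Each [z_i] is a bracket: raise any exponent vector of degree [m - 1] at [i]. *)
Lemma derivedP (w : Lie) : reflect (forall a, w (inl a) = 0) (w \in submod_span B).
Proof.
apply: (iffP idP) => [/asboolP h a|w0].
  apply: (h [set w : Lie | forall a, w (inl a) = 0]).
    apply/submoduleP; split=> [b|x u v hu hv b]; rewrite !ffunE //.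
    by rewrite hu hv [_ *: _]mulr0 addr0.
  by move=> _ [u [v ->]] b; apply: lie_bracket_inl.
rewrite (sum_unit_vec w); apply: rpred_sum => c _.
case: c => [a|i]; first by rewrite w0 scale0r rpred0.
have [e he] := @multi_index_ex n k (fun j => if j == Ordinal n0 then k else 0%N)
  ltac:(by rewrite -big_mkcond big_pred1_eq).
have [f hf] := raise_ex e i.
apply: rpredZ; have -> : unit_vec o (inr i) =
    br (unit_vec o (inl (inl e))) (unit_vec o (inl (inr f))); last exact: br_derived.
rewrite lie_bracket_unit; apply/ffunP => -[[?|?]|j]; rewrite !ffunE //=.
have -> : (inr j == inr i :> lie_basis m n) = (j == i) by [].
case: eqP => [->|ji]; first by case: differ_byP.
case: differ_byP => // h; case: ji; apply/eqP.
by have := h j; rewrite hf /raise eqxx; case: (j == i) => // /addnI.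
Qed.

Definition coord1 (p : quotmod B) : V1 := [ffun a => repr p (inl a)].
Definition coord2 (s : submod B) : V2 := [ffun i => submod_val s (inr i)].

Lemma coord1_pi (w : Lie) : coord1 (\pi_(quotmod B) w) = [ffun a => w (inl a)].
Proof.
apply/ffunP => a; rewrite !ffunE; apply/subr0_eq.
have : repr (\pi_(quotmod B) w) - w \in submod_span B by apply/quotmod_eqP; rewrite reprK.
by move=> /derivedP/(_ a); rewrite !ffunE.
Qed.

Lemma linear_coord1 : linear coord1.
Proof.
move=> x p p'; rewrite -[p in LHS]reprK -[p' in LHS]reprK.
have -> : x *: \pi_(quotmod B) (repr p) = \pi_(quotmod B) (x *: repr p).
  by rewrite pi_quotmod_scale.
by rewrite -pi_quotmodD coord1_pi; apply/ffunP => a; rewrite !ffunE.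
Qed.

Lemma coord1_inj : injective coord1.
Proof.
move=> p p' pp'; rewrite -[p]reprK -[p']reprK; apply/quotmod_eqP/derivedP => a.
have := congr1 (fun v : V1 => v a) pp'; rewrite !ffunE => ->.
by rewrite subrr.
Qed.

Lemma coord1_surj x : exists p, coord1 p = x.
Proof.
exists (\pi_(quotmod B) [ffun c => if c is inl a then x a else 0]).
by rewrite coord1_pi; apply/ffunP => a; rewrite !ffunE.
Qed.

Lemma linear_coord2 : linear coord2.
Proof. by move=> x s s'; apply/ffunP => i; rewrite !ffunE. Qed.

Lemma coord2_inj : injective coord2.
Proof.
move=> [s hs] [s' hs'] ss'; apply: val_inj; apply/ffunP => -[a|i] /=.
  by rewrite (derivedP _ hs) (derivedP _ hs').
by have := congr1 (fun v : V2 => v i) ss'; rewrite !ffunE.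
Qed.

Lemma coord2_surj x : exists s, coord2 s = x.
Proof.
have h : [ffun c => if c is inr i then x i else 0] \in submod_span B.
  by apply/derivedP => a; rewrite ffunE.
by exists (Submod h); apply/ffunP => i; rewrite !ffunE.
Qed.

Definition bracket_coord (x x' : V1) : V2 :=
  [ffun i => \sum_a \sum_b x a * x' b * (@structure_constant m n (inl a) (inl b) (inr i))%:~R].

Lemma coord2_bracket (p p' : gr br) :
  coord2 (gr_bracket p p').2 = bracket_coord (coord1 p.1) (coord1 p'.1).
Proof.
apply/ffunP => i; rewrite !ffunE /=.
rewrite big_sumType /= [X in _ + X]big1 ?addr0; last first.
  by move=> j _; rewrite big1 // => b _; rewrite mulr0z mulr0.
apply: eq_bigr => a _; rewrite big_sumType /= [X in _ + X]big1 ?addr0; last first.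
  by move=> j _; case: a => a; rewrite mulr0z mulr0.
by apply: eq_bigr => b _; rewrite !ffunE.
Qed.

Definition part_x (x : V1) : {ffun Em -> o^o} := [ffun e => x (inl e)].
Definition part_y (x : V1) : {ffun Fm -> o^o} := [ffun f => x (inr f)].

Lemma bracket_coordE (x' x : V1) : bracket_coord x' x =
  \sum_e x' (inl e) *: bracket_y (part_y x) e - \sum_f x' (inr f) *: bracket_x (part_x x) f.
Proof.
apply/ffunP => i; rewrite !ffunE !sum_ffunE big_sumType /=; congr (_ + _).
  apply: eq_bigr => e _; rewrite big_sumType /= [X in X + _]big1 ?add0r; last first.
    by move=> ? _; rewrite mulr0z mulr0.
  rewrite !ffunE scaler_sumr [RHS]big_mkcond; apply: eq_bigr => f _; rewrite ffunE.
  by case: ifP => _; rewrite ?mulr1z ?mulr1 ?mulr0z ?mulr0.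
rewrite -sumrN; apply: eq_bigr => f _; rewrite big_sumType /= [X in _ + X]big1 ?addr0;
  last by move=> ? _; rewrite mulr0z mulr0.
rewrite !ffunE scaler_sumr -sumrN [RHS]big_mkcond; apply: eq_bigr => e _.
by rewrite ffunE; case: ifP => _; rewrite ?mulrN1z ?mulrN ?mulr1 ?mulr0z ?mulr0.
Qed.

(** The largest submodule that forms a graded ideal together with [L]. *)
Definition centralizer (L : set V2) : set V1 := [set x | forall x', L (bracket_coord x' x)].

Lemma centralizerE L : is_submodule L ->
  centralizer L = [set x | cond_x L (part_x x) /\ cond_y L (part_y x)].
Proof.
move=> sL; apply/seteqP; split=> [x h|x [hx hy] x']; last first.
  by rewrite bracket_coordE; apply: smB => //; apply: sm_sum => // ? _; apply: smZ.
split=> [f|e].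
  have := h (unit_vec o (inr f)); rewrite bracket_coordE (bigD1 f) //= !big1.
  - rewrite sub0r addr0 ffunE eqxx scale1r => /(smN sL); by rewrite opprK.
  - by move=> f' ff'; rewrite ffunE (_ : (_ == _) = false) ?scale0r //; apply/negbTE.
  - by move=> e _; rewrite ffunE scale0r.
have := h (unit_vec o (inl e)); rewrite bracket_coordE (bigD1 e) //= !big1.
- by rewrite addr0 subr0 ffunE eqxx scale1r.
- by move=> f _; rewrite ffunE scale0r.
- by move=> e' ee'; rewrite ffunE (_ : (_ == _) = false) ?scale0r //; apply/negbTE.
Qed.

Lemma centralizer_submodule L : is_submodule L -> is_submodule (centralizer L).
Proof.
move=> sL; apply/submoduleP; rewrite centralizerE //.
have lx : linear part_x by move=> a x y; apply/ffunP => e; rewrite !ffunE.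
have ly : linear part_y by move=> a x y; apply/ffunP => f; rewrite !ffunE.
have sx : is_submodule (cond_x (k := k) L).
  apply/submoduleP; split=> [f|a x y hx hy f]; last first.
    by rewrite bracket_x_linear; apply: smD => //; apply: smZ.
  by rewrite -[0](scale0r (0 : {ffun Em -> o^o})) bracket_xZ scale0r; apply: sm0.
have sy : is_submodule (cond_y (k := k) L).
  apply/submoduleP; split=> [f|a x y hx hy f]; last first.
    by rewrite bracket_y_linear; apply: smD => //; apply: smZ.
  by rewrite -[0](scale0r (0 : {ffun Fm -> o^o})) bracket_yZ scale0r; apply: sm0.
split=> [|a x y [hx hy] [hx' hy']] /=.
  by rewrite (lin0 lx) (lin0 ly); split; apply: sm0.
by rewrite lx ly; split;
  [apply: (smD sx); [apply: (smZ sx)|] | apply: (smD sy); [apply: (smZ sy)|]].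
Qed.

Lemma centralizer_lattice L : lattice pi L -> lattice pi (centralizer L).
Proof.
move=> lL; split; first exact: centralizer_submodule lL.1.
have [_ [M1 h1]] := cond_x_lattice k lL; have [_ [M2 h2]] := cond_y_lattice k lL.
exists (M1 + M2)%N => x; rewrite (centralizerE lL.1) /=.
have -> : part_x (pi ^+ (M1 + M2) *: x) = pi ^+ M1 *: (pi ^+ M2 *: part_x x).
  by rewrite scalerA -exprD; apply/ffunP => e; rewrite !ffunE.
have -> : part_y (pi ^+ (M1 + M2) *: x) = pi ^+ M2 *: (pi ^+ M1 *: part_y x).
  by rewrite scalerA -exprD addnC; apply/ffunP => e; rewrite !ffunE.
by split; [apply: h1 | apply: h2].
Qed.

Lemma level_centralizer L : lattice pi L ->
  level q (centralizer L) = (level q (cond_x (k := k) L) + level q (cond_y (k := k) L))%N.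
Proof.
move=> lL; apply: (level_has_index lp hq (centralizer_submodule lL.1)).
rewrite (centralizerE lL.1).
pose h (x : V1) := (part_x x, part_y x).
have -> : [set x | cond_x L (part_x x) /\ cond_y L (part_y x)] =
  h @^-1` [set p | cond_x L p.1 /\ cond_y L p.2] by [].
apply: has_index_preimage.
- by move=> x y; congr pair; apply/ffunP => a; rewrite !ffunE.
- move=> [a b]; exists [ffun c => match c with inl e => a e | inr f => b f end].
  by congr pair; apply/ffunP => c; rewrite !ffunE.
rewrite expnD; apply: has_index_setX; apply: (lattice_level lp hq).
  exact: cond_x_lattice.
exact: cond_y_lattice.
Qed.

(** The direct sum of a piece of degree one and a piece of degree two, both
    given in coordinates. *)
Definition graded_sum (L1 : set V1) (L2 : set V2) : set (gr br) :=
  [set p | L1 (coord1 p.1) /\ L2 (coord2 p.2)].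

Lemma graded_sum_submodule L1 L2 : is_submodule L1 -> is_submodule L2 ->
  is_submodule (graded_sum L1 L2).
Proof.
move=> s1 s2; apply/submoduleP; split=> [|a p p' [h1 h2] [h1' h2']].
  split; first by rewrite (lin0 linear_coord1); apply: sm0.
  by rewrite (lin0 linear_coord2); apply: sm0.
split; first by rewrite [coord1 _]linear_coord1; apply: smD => //; apply: smZ.
by rewrite [coord2 _]linear_coord2; apply: smD => //; apply: smZ.
Qed.

Lemma graded_sum_ideal L1 L2 : is_submodule L1 -> is_submodule L2 ->
  L1 `<=` centralizer L2 ->
  is_lie_ideal (graded_sum L1 L2) /\ is_graded (graded_sum L1 L2).
Proof.
move=> s1 s2 L12; have sI := graded_sum_submodule s1 s2.
split; first split=> // p p' [h1 h2].
  split; first by rewrite (lin0 linear_coord1); apply: sm0.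
  by rewrite coord2_bracket; apply: L12.
apply/seteqP; split=> [p [h1 h2]|_ [p [hp _]] [p' [hp' _]] <-]; last exact: smD.
exists (p.1, 0); first split=> //.
  by split=> //=; rewrite (lin0 linear_coord2); apply: sm0.
exists (0, p.2); first split=> //.
  by split=> //=; rewrite (lin0 linear_coord1); apply: sm0.
by case: p {h1 h2} => p p'; congr pair; rewrite /= ?addr0 ?add0r.
Qed.

(** A graded submodule is the sum of its two pieces, and closure under brackets
    is a condition on the piece of degree one only, as the other is central. *)
Lemma graded_idealP (I : set (gr br)) : is_lie_ideal I -> is_graded I ->
  exists L1 L2, [/\ is_submodule L1, is_submodule L2, L1 `<=` centralizer L2
                 & I = graded_sum L1 L2].
Proof.
move=> [sI lieI] grI.
have /choice[g1 hg1] := coord1_surj; have /choice[g2 hg2] := coord2_surj.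
have g1K p : g1 (coord1 p) = p by apply: coord1_inj; rewrite hg1.
have g2K s : g2 (coord2 s) = s by apply: coord2_inj; rewrite hg2.
have lin1 : linear (fun x => (g1 x, 0) : gr br).
  move=> a x y; congr pair; last by rewrite /= [RHS]addr0 scaler0.
  by apply: coord1_inj; rewrite [RHS]linear_coord1 !hg1.
have lin2 : linear (fun x => (0, g2 x) : gr br).
  move=> a x y; congr pair; first by rewrite /= [RHS]addr0 scaler0.
  by apply: coord2_inj; rewrite [RHS]linear_coord2 !hg2.
exists ((fun x => (g1 x, 0) : gr br) @^-1` I), ((fun x => (0, g2 x) : gr br) @^-1` I).
split; [exact: (submodule_preimage lin1 sI)|exact: (submodule_preimage lin2 sI)| |].
  move=> x Ix x'; have := lieI (g1 x', 0) _ Ix.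
  set b := gr_bracket _ _; have -> // : b = (0, g2 (bracket_coord x' x)).
  congr pair; apply: coord2_inj; rewrite hg2.
  have := coord2_bracket (g1 x', 0) (g1 x, 0); rewrite /= !hg1 => <-.
  by [].
apply/seteqP; split=> [p Ip|p []] /=.
  rewrite grI in Ip; have [u [Iu u2] [v [Iv v1] uv]] := Ip.
  rewrite /graded_sum /= g1K g2K -uv /=.
  have -> : u.1 + v.1 = u.1 by rewrite v1 addr0.
  have -> : u.2 + v.2 = v.2 by rewrite u2 add0r.
  have e1 : (u.1, 0) = u :> gr br by rewrite -u2; case: (u).
  have e2 : (0, v.2) = v :> gr br by rewrite -v1; case: (v).
  by rewrite e1 e2.
rewrite g1K g2K => I1 I2.
have -> : p = (p.1, 0) + (0, p.2) :> gr br.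
  by case: p {I1 I2} => p p'; congr pair; rewrite /= ?addr0 ?add0r.
exact: smD.
Qed.

Lemma graded_sum_has_index L1 L2 a b : has_index L1 a -> has_index L2 b ->
  has_index (graded_sum L1 L2) (a * b).
Proof.
move=> h1 h2; have := has_index_setX h1 h2.
apply: (@has_index_preimage _ _ (fun p : gr br => (coord1 p.1, coord2 p.2))).
  by move=> p p'; congr pair; [rewrite (linB linear_coord1) | rewrite (linB linear_coord2)].
move=> [x y]; have [p hp] := coord1_surj x; have [s hs] := coord2_surj y.
by exists (p, s); rewrite /= hp hs.
Qed.

Lemma graded_sum_inj L1 L2 L1' L2' :
  is_submodule L1 -> is_submodule L2 -> is_submodule L1' -> is_submodule L2' ->
  graded_sum L1 L2 = graded_sum L1' L2' -> L1 = L1' /\ L2 = L2'.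
Proof.
have sub M1 M2 M1' M2' : is_submodule M1 -> is_submodule M2 ->
    graded_sum M1 M2 = graded_sum M1' M2' -> M1 `<=` M1' /\ M2 `<=` M2'.
  move=> s1 s2 e; split=> x hx.
    have [p hp] := coord1_surj x.
    have : graded_sum M1 M2 (p, 0).
      by split; rewrite /= ?hp // (lin0 linear_coord2); apply: sm0.
    by rewrite e => -[]; rewrite /= hp.
  have [s hs] := coord2_surj x.
  have : graded_sum M1 M2 (0, s).
    by split; rewrite /= ?hs // (lin0 linear_coord1); apply: sm0.
  by rewrite e => -[]; rewrite /= hs.
move=> s1 s2 s1' s2' e; have [h1 h2] := sub _ _ _ _ s1 s2 e.
by have [h1' h2'] := sub _ _ _ _ s1' s2' (esym e); split; apply/seteqP.
Qed.
End GradedIdeals.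

(** * Dirichlet series over sets of submodules *)

Section ComplexPower.
Variable R : realType.
Implicit Types (x y : R) (z w : R[i]).

Lemma cpowD x z w : 0 < x -> cpow x (z + w) = cpow x z * cpow x w.
Proof.
move=> x0; case: z => a b; case: w => c d; rewrite /cpow /=.
have -> : x `^ (a + c) = x `^ a * x `^ c by rewrite powRD // (gt_eqF x0) implybT.
have -> : (b + d) * ln x = b * ln x + d * ln x by rewrite mulrDl.
rewrite cosD sinD; simpc.
by congr (_ +i* _); ring.
Qed.

Lemma cpow0 x : cpow x 0 = 1.
Proof. by rewrite /cpow /= powRr0 mul0r cos0 sin0; simpc. Qed.

Lemma cpow1 z : cpow 1 z = 1 :> R[i].
Proof. by rewrite /cpow powR1 ln1 mulr0 cos0 sin0; simpc. Qed.

Lemma cpowM x y z : 0 < x -> 0 < y -> cpow (x * y) z = cpow x z * cpow y z.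
Proof.
move=> x0 y0; case: z => a b; rewrite /cpow /=.
rewrite powRM ?ltW // lnM ?posrE // mulrDr cosD sinD; simpc.
by congr (_ +i* _); ring.
Qed.

Lemma cpowX x z k : 0 < x -> cpow (x ^+ k) z = cpow x z ^+ k.
Proof.
move=> x0; elim: k => [|k IH]; first by rewrite !expr0 cpow1.
by rewrite !exprS cpowM ?exprn_gt0 // IH.
Qed.

Lemma cpow_mulrn x z k : 0 < x -> cpow x (z *+ k) = cpow x z ^+ k.
Proof.
move=> x0; elim: k => [|k IH]; first by rewrite mulr0n expr0 cpow0.
by rewrite mulrS exprS cpowD // IH.
Qed.

Lemma cpow_nat x k : 0 <= x -> cpow x k%:R = (x ^+ k)%:C.
Proof.
move=> x0; have -> : k%:R = k%:R%:C :> R[i] by rewrite rmorph_nat.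
by rewrite /cpow /= powR_mulrn // mul0r cos0 sin0; simpc.
Qed.

Lemma modulus_cpow x z : modulus (cpow x z) = x `^ complex.Re z.
Proof.
rewrite /modulus normc_def /cpow; simpc => /=.
rewrite !exprMn -mulrDr cos2Dsin2 mulr1 sqrtr_sqr ger0_norm //.
exact: powR_ge0.
Qed.

Lemma Re_le_modulus z : `|complex.Re z| <= modulus z.
Proof. by rewrite -lecR -modulusE normc_ge_Re. Qed.

Lemma Im_le_modulus z : `|complex.Im z| <= modulus z.
Proof.
case: z => a b; rewrite /modulus normc_def /= -sqrtr_sqr ler_sqrt ?lerDr ?sqr_ge0 //.
by rewrite addr_ge0 ?sqr_ge0.
Qed.

Lemma modulus_le z : modulus z <= `|complex.Re z| + `|complex.Im z|.
Proof.
case: z => a b; have -> : a +i* b = a%:C + 'i%C * b%:C by simpc.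
apply: le_trans (modulusD _ _) _; rewrite modulusM /=; simpc.
have mR (c : R) : modulus c%:C = `|c|.
  by rewrite /modulus normc_def /= expr0n addr0 sqrtr_sqr.
have -> : modulus 'i%C = 1 :> R.
  by rewrite /modulus normc_def /= expr0n add0r expr1n sqrtr1.
by rewrite mul1r !mR.
Qed.
End ComplexPower.

Section UnconditionalSums.
Variables (R : realType) (I : choiceType) (f : I -> R[i]) (Z : R[i]).
Local Notation S B := (\sum_(i <- B) f i).

Definition unconditional_sum : Prop :=
  partial_sum (f : I -> R[i]^o) @ totally --> (Z : R[i]^o).

Lemma unconditional_sumP : unconditional_sum <->
  forall r : R, 0 < r -> exists A : {fset I}, forall B : {fset I},
    (A `<=` B)%fset -> modulus (Z - S B) < r.
Proof.
have pS B : partial_sum (f : I -> R[i]^o) B = S B by rewrite /partial_sum big_seq_fsetE.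
have tF : Filter (@totally I) by exact: (@filter_filter _ _ totally_filter).
split=> [|h].
  rewrite /unconditional_sum => /cvgrPdist_lt h r r0.
  have r0' : 0 < r%:C :> R[i] by rewrite ltcR.
  case: (h _ r0') => A _ hA; exists A => B AB.
  by have := hA B AB; rewrite /= pS modulusE ltcR.
apply/cvgrPdist_lt => e e0.
have [r r0 ->] : exists2 r : R, 0 < r & e = r%:C.
  by move: e0; case: e => x y; rewrite ltcE /= => /andP[/eqP-> x0]; exists x.
have [A hA] := h r r0; exists A => // B AB.
by rewrite /= pS modulusE ltcR; apply: hA.
Qed.

(** Separate the positive from the negative terms. *)
Lemma sum_abs_le (g : I -> R) (D : {fset I}) (c : R) :
  (forall D' : {fset I}, (D' `<=` D)%fset -> `|\sum_(i <- D') g i| <= c) ->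
  \sum_(i <- D) `|g i| <= c + c.
Proof.
move=> h; rewrite (big_fsetID _ (fun i => 0 <= g i)) /=.
apply: lerD.
  rewrite (eq_big_seq (fun i => g i)) => [|i].
    by apply: le_trans (ler_norm _) (h _ _); apply: fset_sub.
  by rewrite !inE /= => /andP[_ gi]; rewrite ger0_norm.
rewrite (eq_big_seq (fun i => - g i)) => [|i].
  rewrite sumrN; apply: le_trans (ler_norm _) _; rewrite normrN.
  by apply: h; apply: fset_sub.
by rewrite !inE /= -ltNge => /andP[_ gi]; rewrite ltr0_norm.
Qed.

(** Beyond the finite set [A] of the convergence criterion all finite partial sums
    have modulus at most 2, hence so have their real and imaginary parts. *)
Lemma unconditional_sum_bounded : unconditional_sum ->
  exists c : R, forall B : {fset I}, \sum_(i <- B) modulus (f i) <= c.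
Proof.
move=> /unconditional_sumP/(_ 1 ltr01)[A hA].
have small (D : {fset I}) : (forall i, i \in D -> i \notin A) -> modulus (S D) <= 2.
  move=> DA; have h1 := hA A (fsubset_refl A).
  have h2 := hA (A `|` D)%fset (fsubsetUl A D).
  have -> : S D = (Z - S A) - (Z - S (A `|` D)%fset).
    suff -> : S (A `|` D)%fset = S A + S D by ring.
    rewrite (big_fsetID _ (mem A) (A `|` D)%fset) /=.
    have -> : [fset x in (A `|` D)%fset | x \in A]%fset = A.
      by apply/fsetP => i; rewrite !inE /=; case: (i \in A); rewrite ?andbT ?andbF.
    have -> : [fset x in (A `|` D)%fset | x \notin A]%fset = D.
      apply/fsetP => i; rewrite !inE /=; case iA: (i \in A) => /=; rewrite ?andbT //.
      by apply/esym/negbTE/negP => /DA; rewrite iA.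
    by [].
  have := modulusD (Z - S A) (- (Z - S (A `|` D)%fset)).
  have -> : modulus (- (Z - S (A `|` D)%fset)) = modulus (Z - S (A `|` D)%fset).
    by apply: complexI; rewrite -!modulusE normrN.
  lra.
exists (\sum_(i <- A) modulus (f i) + 8) => B.
rewrite (big_fsetID _ (mem A)) /=; apply: lerD.
  rewrite [leRHS](big_fsetID _ (mem B)) /=.
  have -> : [fset x in B | x \in A]%fset = [fset x in A | x \in B]%fset.
    by apply/fsetP => i; rewrite !inE /= andbC.
  by rewrite lerDl sumr_ge0 // => i _; apply: modulus_ge0.
set D := [fset x in B | x \notin A]%fset.
have DA (D' : {fset I}) : (D' `<=` D)%fset -> modulus (S D') <= 2.
  move=> /fsubsetP D'D; apply: small => i /D'D.
  by rewrite !inE /= => /andP[].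
have hRe : \sum_(i <- D) `|complex.Re (f i)| <= 2 + 2.
  apply: sum_abs_le => D' /DA; apply: le_trans.
  by rewrite -raddf_sum; apply: Re_le_modulus.
have hIm : \sum_(i <- D) `|complex.Im (f i)| <= 2 + 2.
  apply: sum_abs_le => D' /DA; apply: le_trans.
  by rewrite -raddf_sum; apply: Im_le_modulus.
apply: (@le_trans _ _ (\sum_(i <- D) (`|complex.Re (f i)| + `|complex.Im (f i)|))).
  by apply: ler_sum => i _; apply: modulus_le.
rewrite big_split /=; lra.
Qed.
End UnconditionalSums.

(** The unconditional sum of the [T ^+ h i] over [P] and the power series in [T]
    that counts the levels of [h] in [P] have the same value; the sum of the
    moduli decides the convergence of both. *)
Section LevelSeries.
Variables (R : realType) (I : choiceType) (P : set I) (h : I -> nat) (T : R[i]).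
Local Notation t := (modulus T).
Hypothesis t0 : 0 < t.
Let f i := if i \in P then T ^+ h i else 0.

Definition level_count (k : nat) : R := fine (\esum_(i in P `&` h @^-1` [set k]) (1%:E : \bar R))%E.

Definition level_sum : \bar R := (\esum_(i in P) (t ^+ h i)%:E)%E.

Lemma level_sumE : (level_sum =
  \sum_(0 <= k <oo) ((\esum_(i in P `&` h @^-1` [set k]) 1%:E) * (t ^+ k)%:E))%E.
Proof.
rewrite -(@esum_levels _ _ _ (fun=> 1)) // => [|k]; last by rewrite exprn_ge0 // ltW.
by apply: eq_esum => i _; rewrite mul1r.
Qed.

Lemma unconditional_sum_level_sum Z : unconditional_sum f Z -> (level_sum < +oo)%E.
Proof.
move=> /unconditional_sum_bounded[c hc]; apply: (@le_lt_trans _ _ c%:E); last exact: ltry.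
apply: ge_ereal_sup => _ [X [finX XP] <-].
rewrite fsbig_finite //= sumEFin lee_fin; apply: le_trans (hc (fset_set X)).
rewrite le_eqVlt; apply/orP; left; apply/eqP.
apply: eq_big_seq => i; rewrite in_fset_set // inE => /XP Pi.
by rewrite /f mem_set // modulusX.
Qed.

Hypothesis fin : (level_sum < +oo)%E.

Lemma level_esum_fin k : (\esum_(i in P `&` h @^-1` [set k]) (1%:E : \bar R))%E \is a fin_num.
Proof.
rewrite ge0_fin_numE; last exact: esum_ge0.
have ge0 i : (0 <= (\esum_(j in P `&` h @^-1` [set i]) 1%:E) * (t ^+ i)%:E)%E.
  by apply: mule_ge0; [apply: esum_ge0 | rewrite lee_fin exprn_ge0 // ltW].
have : ((\esum_(i in P `&` h @^-1` [set k]) 1%:E) * (t ^+ k)%:E < +oo)%E.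
  apply: le_lt_trans fin; rewrite level_sumE.
  apply: le_trans (nneseries_lim_ge k.+1 (fun i _ _ => ge0 i)).
  by rewrite big_nat_recr //= leeDr // sume_ge0.
have : (0 <= \esum_(i in P `&` h @^-1` [set k]) (1%:E : \bar R))%E by apply: esum_ge0.
case: (esum _ _) => // [r *|]; first by rewrite ltry.
by move=> _; rewrite gt0_mulye // lte_fin exprn_gt0.
Qed.

Lemma level_finite k : finite_set (P `&` h @^-1` [set k]).
Proof.
apply: contrapT => inf; have := level_esum_fin k.
rewrite ge0_fin_numE; last exact: esum_ge0.
set e := esum _ _ => efin.
have big n : (n%:R%:E <= e)%E.
  have [B BP nB] := infinite_set_fset n inf; apply: esum_ge; exists [set` B] => //.
  rewrite fsbig_finite //= set_fsetK sumEFin lee_fin big_const_seq count_predT.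
  by rewrite iter_addr addr0 ler_nat.
move: efin big; case: e => [r _ big| |_ big]; [|by []|by have := big 0%N].
have := big (Num.truncn r).+1; rewrite lee_fin leNgt => /negP; apply.
exact: truncnS_gt.
Qed.

Lemma level_countE k : level_count k = (#|` fset_set (P `&` h @^-1` [set k])|)%:R.
Proof.
have fk := level_finite k; rewrite /level_count esum_fset //.
rewrite fsbig_finite //= sumEFin big_const_seq count_predT.
by rewrite iter_addr addr0.
Qed.

Lemma level_count_ge0 k : 0 <= level_count k.
Proof. by rewrite level_countE. Qed.

Lemma level_count_psummable : psummable level_count t.
Proof.
apply: psummable_ereal; [exact: ltW | exact: level_count_ge0 |].
apply: le_lt_trans fin; rewrite level_sumE le_eqVlt; apply/orP; left; apply/eqP.
by apply: eq_eseriesr => k _; rewrite EFinM /level_count fineK // level_esum_fin.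
Qed.

Let below K := P `&` [set i | (h i < K)%N].

Let belowS K : below K.+1 = below K `|` (P `&` h @^-1` [set K]).
Proof.
apply/seteqP; split=> i; rewrite /below /=.
  by move=> [Pi]; rewrite ltnS leq_eqVlt => /orP[/eqP hi|hi]; [right|left].
by move=> [[Pi hi]|[Pi /= ->]]; split=> //; apply: ltnW.
Qed.

Let below_finite K : finite_set (below K).
Proof.
elim: K => [|K IH]; first by rewrite (_ : below 0 = set0) //; apply/seteqP; split=> i [].
by rewrite belowS finite_setU; split=> //; apply: level_finite.
Qed.

Let belowP K i : (i \in fset_set (below K)) = (i \in P) && (h i < K)%N.
Proof. by rewrite in_fset_set // in_setI; congr (_ && _); apply/idP/idP; rewrite inE. Qed.

Lemma sum_below (A : nzRingType) (x : A) K :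
  \sum_(i <- fset_set (below K)) x ^+ h i =
  \sum_(k < K) (#|` fset_set (P `&` h @^-1` [set (k : nat)])|)%:R * x ^+ k.
Proof.
elim: K => [|K IH].
  rewrite big_ord0 (_ : below 0 = set0) ?fset_set0 ?big_seq_fset0 //.
  by apply/seteqP; split=> i [].
have fK := level_finite K.
rewrite big_ord_recr -IH /= -!fsbig_finite //= belowS fsbigU0 //.
- congr (_ + _); rewrite fsbig_finite //=.
  rewrite (eq_big_seq (fun=> x ^+ K)) => [|i]; last first.
    by rewrite in_fset_set // => /set_mem[_ /= ->].
  by rewrite big_const_seq count_predT iter_addr addr0 mulr_natl.
- by move=> i [[_ /= hi] [_ /= e]]; move: hi; rewrite e ltnn.
Qed.

Let sum_f K : \sum_(i <- fset_set (below K)) f i = psum level_count T K.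
Proof.
rewrite /psum; under [RHS]eq_bigr do rewrite level_countE rmorph_nat.
rewrite -sum_below; apply: eq_big_seq => i; rewrite belowP => /andP[Pi _].
by rewrite /f Pi.
Qed.

(** Once all of [A] lies below level [K], adding the rest of [A] to the partial sum
    adds only zero terms. *)
Lemma unconditional_sum_clim Z : unconditional_sum f Z -> clim (psum level_count T) Z.
Proof.
move=> /unconditional_sumP hZ; apply: climI => r /hZ[A hA].
exists (\max_(i <- A) (h i).+1)%N => K AK; rewrite -sum_f.
have := hA (fset_set (below K) `|` A)%fset (fsubsetUr _ _).
congr (modulus (_ - _) < _); apply/esym/big_fset_incl; first exact: fsubsetUl.
move=> i; rewrite in_fsetU => /orP[->//|iA]; rewrite belowP => ni.
rewrite /f; case: ifP => // Pi; move: ni; rewrite Pi /= -leqNgt => Kh.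
have : ((h i).+1 <= K)%N by apply: leq_trans AK; rewrite (big_fsetD1 i) //= leq_maxl.
by rewrite ltnNge Kh.
Qed.

(** A finite set containing all indices below level [K] differs from these by
    terms whose moduli sum to at most a tail of the power series. *)
Lemma clim_unconditional_sum Z : clim (psum level_count T) Z -> unconditional_sum f Z.
Proof.
move=> hZ; apply/unconditional_sumP => r r0.
have r2 : 0 < r / 2 by lra.
have [N1 hN1] := climP hZ r2.
have [d d0 hd] := psummable_tail (ltW t0) level_count_ge0 level_count_psummable.
have /cvgrPdist_lt/(_ _ r2)[N2 _ hN2] := d0.
set K := (N1 + N2)%N; exists (fset_set (below K)) => B KB.
have hK1 := hN1 K (leq_addr _ _).
have hK2 : d K < r / 2.
  have := hN2 K (leq_addl _ _); rewrite /= sub0r normrN.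
  exact: le_lt_trans (ler_norm _).
pose M := maxn K (\max_(i <- B) (h i).+1)%N.
have KM : (K <= M)%N by apply: leq_maxl.
have BM i : i \in B -> (h i < M)%N.
  by move=> iB; apply: leq_trans (leq_maxr _ _); rewrite (big_fsetD1 i) //= leq_maxl.
have splitB (A : nmodType) (F : I -> A) : \sum_(i <- B) F i =
    \sum_(i <- fset_set (below K)) F i +
    \sum_(i <- [fset x in B | x \notin fset_set (below K)]%fset) F i.
  rewrite (big_fsetID _ (mem (fset_set (below K)))) /=; congr (_ + _).
  apply: eq_fbigl => i; rewrite !inE /=; apply/andP/idP => [[]//|iK].
  by split=> //; apply: (fsubsetP KB).
rewrite splitB sum_f opprD addrA.
set D := [fset x in B | _]%fset.
apply: le_lt_trans (modulusD _ _) _.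
have -> : modulus (- \sum_(i <- D) f i) = modulus (\sum_(i <- D) f i).
  by apply: complexI; rewrite -!modulusE normrN.
suff : modulus (\sum_(i <- D) f i) <= d K by lra.
apply: le_trans (modulus_sum _ _ _) _; apply: le_trans (hd K M).
have -> : \sum_(K <= k < M) level_count k * t ^+ k =
    \sum_(i <- fset_set (below M)) t ^+ h i - \sum_(i <- fset_set (below K)) t ^+ h i.
  rewrite !sum_below -!(big_mkord xpredT (fun k => (#|` fset_set (P `&` h @^-1` [set k])|)%:R * t ^+ k)).
  rewrite (@big_cat_nat _ _ _ K 0 M) //= addrAC subrr add0r.
  by apply: eq_bigr => k _; rewrite level_countE.
rewrite (big_fsetID _ (mem (fset_set (below K))) (fset_set (below M))) /=.
have -> : [fset x in fset_set (below M) | x \in fset_set (below K)]%fset = fset_set (below K).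
  apply/fsetP => i; rewrite !inE /= !belowP; case: (i \in P) => //=.
  by apply/andP/idP => [[]//|iK]; split=> //; apply: leq_trans KM.
rewrite addrAC subrr add0r.
set D' := [fset x in fset_set (below M) | _]%fset.
have -> : \sum_(i <- D) modulus (f i) = \sum_(i <- [fset x in D | x \in P]%fset) t ^+ h i.
  rewrite (big_fsetID _ (fun x => x \in P) D) /= [X in _ + X]big_seq [X in _ + X]big1 ?addr0.
    by apply: eq_big_seq => i; rewrite !inE /= => /andP[_ Pi]; rewrite /f Pi modulusX.
  by move=> i; rewrite !inE /= => /andP[_ /negPf Pi]; rewrite /f Pi modulusR.
rewrite [leRHS](big_fsetID _ (fun x => x \in B) D') /=.
have -> : [fset x in D' | x \in B]%fset = [fset x in D | x \in P]%fset.
  apply/fsetP => i; rewrite !inE /= !belowP.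
  case iP: (i \in P); rewrite ?andbF //= !andbT andbC.
  by case iB: (i \in B) => //=; rewrite BM.
by rewrite lerDl sumr_ge0 // => i _; rewrite exprn_ge0 // ltW.
Qed.
End LevelSeries.

(** * Zeta functions as level series *)

Section LevelTransfer.
Variables (R : realType) (I J : choiceType) (P : set I) (Q : set J) (e : I -> J).
Variables (g : I -> nat) (h : J -> nat).
Hypothesis bij_e : set_bij P Q e.
Hypothesis he : forall i, P i -> h (e i) = g i.

Lemma level_sum_bij (T : R[i]) : level_sum Q h T = level_sum P g T.
Proof.
rewrite /level_sum (reindex_esum _ _ _ _ bij_e).
by apply: eq_esum => i Pi; rewrite he.
Qed.

Lemma level_count_bij : level_count R Q h = level_count R P g.
Proof.
apply/funext => k; rewrite /level_count !esum_mkcondr (reindex_esum _ _ _ _ bij_e).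
congr fine; apply: eq_esum => i Pi.
by congr (if _ then _ else _); apply/idP/idP; rewrite !inE /= he.
Qed.
End LevelTransfer.

Section ZetaValues.
Variables (R : realType) (o : idomainType) (pi : o) (q : nat).
Hypothesis lp : local_parameter pi.
Hypothesis hq : has_index (principal pi) q.

Let qR0 : 0 < q%:R :> R.
Proof. by rewrite ltr0n (has_index_gt0 hq). Qed.

Lemma zeta_value_level (M : zmodType) (F : set (set M)) (s Z : R[i]) :
  (forall N, F N -> finite_index N -> submod_index N = (q ^ level q N)%N) ->
  zeta_value F s Z <->
  unconditional_sum (fun N => if N \in F `&` @finite_index M
                              then cpow q%:R (- s) ^+ level q N else 0) Z.
Proof.
move=> FN; rewrite /zeta_value /unconditional_sum.
have -> // : (fun N : set M => if N \in F `&` @finite_index M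
    then (cpow (submod_index N)%:R (- s) : R[i]^o) else 0) =
  (fun N => if N \in F `&` @finite_index M then cpow q%:R (- s) ^+ level q N else 0).
apply/funext => N; case: ifP => // /set_mem[FN' fN].
by rewrite (FN _ FN' fN) natrX cpowX.
Qed.

Lemma modulus_cpowq_gt0 (s : R[i]) : 0 < modulus (cpow (q%:R : R) (- s)).
Proof. by rewrite modulus_cpow powR_gt0. Qed.

Section LatticeWeights.
Variable I : finType.
Local Notation V := {ffun I -> o^o}.
Local Notation lattices := [set L : set V | lattice pi L].

Lemma lattice_class00 : lattice_class pi finset.set0 finset.set0 = lattices.
Proof.
apply/seteqP; split=> L /= => [[]//|lL]; split=> // [k|v l _]; by rewrite inE.
Qed.

Lemma level_sum_lattices (wt : set V -> nat) (T : R[i]) :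
  level_sum lattices wt T =
  class_sum pi wt finset.set0 finset.set0 (fun k => (modulus T ^+ k)%:E).
Proof.
rewrite /level_sum /class_sum lattice_class00; apply: eq_esum => L _.
by rewrite finset.cards0 expn0 mul1e.
Qed.

Lemma class_coef00 (wt : set V -> nat) k :
  class_coef R pi wt finset.set0 finset.set0 k =
  (\esum_(L in lattices `&` wt @^-1` [set k]) 1%:E)%E.
Proof.
rewrite /class_coef lattice_class00; apply: eq_esum => L _.
by rewrite finset.cards0 expn0.
Qed.

Lemma level_count_lattices (wt : set V -> nat) :
  level_count R lattices wt = coef R pi wt finset.set0 finset.set0.
Proof. by apply/funext => k; rewrite /level_count /coef class_coef00. Qed.

Lemma class_sum_lattices (wt : set V -> nat) (G : nat -> \bar R) :
  class_sum pi wt finset.set0 finset.set0 G = (\esum_(L in lattices) G (wt L))%E.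
Proof.
rewrite /class_sum lattice_class00; apply: eq_esum => L _.
by rewrite finset.cards0 expn0 mul1e.
Qed.

Lemma lattice_sum_gt0 (wt : set V -> nat) (t : R) : 0 < t ->
  (0 < \esum_(L in lattices) (t ^+ wt L)%:E)%E.
Proof.
move=> t0; apply: (@lt_le_trans _ _ (t ^+ wt [set: V])%:E); first by rewrite lte_fin exprn_gt0.
apply: esum_ge; exists [set [set: V]]; last by rewrite fsbig_set1.
by split=> [|_ ->]; [exact: finite_set1 | exact: lattice_setT].
Qed.
End LatticeWeights.

(** Rows and functions on [I] are two models of the same free module; the
    submodules of finite index of the first are the lattices of the second. *)
Section FreeZeta.
Variables (I : finType) (d : nat).
Hypothesis dI : #|I| = d.
Local Notation V := {ffun I -> o^o}.
Local Notation lattices := [set L : set V | lattice pi L].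

Definition vec_of_row (r : 'rV[o]_d) : V := [ffun j => r 0 (cast_ord dI (enum_rank j))].

Let vrow_linear : linear vec_of_row.
Proof. by move=> a u v; apply/ffunP => j; rewrite !ffunE !mxE. Qed.

Let vrow_inj : injective vec_of_row.
Proof.
move=> u v uv; apply/rowP => i.
have := congr1 (fun w : V => w (enum_val (cast_ord (esym dI) i))) uv.
by rewrite !ffunE enum_valK cast_ordKV.
Qed.

Let vrow_surj v : exists r, vec_of_row r = v.
Proof.
exists (\row_i v (enum_val (cast_ord (esym dI) i))); apply/ffunP => j.
by rewrite ffunE mxE cast_ordK enum_rankK.
Qed.

Lemma preimage_row_index L : lattice pi L -> has_index (vec_of_row @^-1` L) (q ^ level q L).
Proof.
move=> lL; apply: has_index_preimage; last exact: (lattice_level lp hq).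
  exact: (linB vrow_linear).
exact: vrow_surj.
Qed.

Lemma row_lattice_bij : set_bij lattices
  (@is_submodule o 'rV[o]_d `&` @finite_index _) (fun L => vec_of_row @^-1` L).
Proof.
split=> [L lL|L L' /set_mem lL /set_mem lL' e|N [sN fN]].
- have sL := submodule_preimage vrow_linear lL.1; split=> //.
  by have [] := has_index_finite (submodule_subgroup sL) (preimage_row_index lL).
- apply/seteqP; split=> v Lv; have [r rv] := vrow_surj v.
    by have : (vec_of_row @^-1` L) r; [rewrite /= rv | rewrite e /= rv].
  by have : (vec_of_row @^-1` L') r; [rewrite /= rv | rewrite -e /= rv].
- have [_ [M hM]] := lattice_finite_index lp sN fN; exists (vec_of_row @` N).
    split; first exact: (submodule_image vrow_linear).
    exists M => v; have [r <-] := vrow_surj v; exists (pi ^+ M *: r) => //.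
    exact: (linZ vrow_linear).
  by apply/seteqP; split=> [r [r' Nr' /vrow_inj <-]//|r Nr]; exists r.
Qed.

Lemma level_preimage_row L : lattice pi L -> level q (vec_of_row @^-1` L) = level q L.
Proof.
move=> lL; apply: (level_has_index lp hq); last exact: preimage_row_index.
exact: (submodule_preimage vrow_linear lL.1).
Qed.

Lemma free_module_zeta (s W : R[i]) :
  (level_sum lattices (@level q V) (cpow q%:R (- s)%R) < +oo)%E ->
  clim (psum (level_count R lattices (@level q V)) (cpow q%:R (- s))) W ->
  free_module_zeta_value o d s W.
Proof.
move=> fin hW; apply/zeta_value_level => [N sN fN|].
  have [_ _ /(_ N (conj sN fN))[L lL <-]] := row_lattice_bij.
  rewrite level_preimage_row //.
  have sL := submodule_preimage vrow_linear lL.1.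
  by have [] := has_index_finite (submodule_subgroup sL) (preimage_row_index lL).
have hlev := level_preimage_row.
apply: clim_unconditional_sum; first exact: modulus_cpowq_gt0.
  by rewrite (level_sum_bij row_lattice_bij hlev).
by rewrite (level_count_bij _ row_lattice_bij hlev).
Qed.
End FreeZeta.
End ZetaValues.

(** * The zeta function of graded ideals *)

Section GradedZeta.
Variables (R : realType) (o : idomainType) (pi : o) (q : nat).
Hypothesis lp : local_parameter pi.
Hypothesis hq : has_index (principal pi) q.
Variables n k : nat.
Hypothesis n0 : (0 < n)%N.
Local Notation m := k.+1.
Local Notation V1 := {ffun (multi_index n k + multi_index n k.+1)%type -> o^o}.
Local Notation V2 := {ffun 'I_n -> o^o}.
Local Notation br := (@lie_bracket m n o).
Local Notation lattices1 := [set L : set V1 | lattice pi L].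
Local Notation lattices2 := [set L : set V2 | lattice pi L].
Local Notation weight := (@lie_weight o q n k).
Local Notation ideal_level := (@level q (gr br)).
Definition graded_ideals : set (set (gr br)) :=
  [set I | is_lie_ideal I /\ is_graded I] `&` @finite_index _.

(** The centralizers are free of full rank; a simultaneous choice of bases turns
    the pairs of lattices into a product. *)
Lemma centralizer_param : exists th : set V2 -> V1 -> V1, forall L, lattice pi L ->
  [/\ linear (th L), injective (th L) & centralizer L = range (th L)].
Proof.
suff /choice[th hth] : forall L : set V2, exists th : V1 -> V1, lattice pi L ->
    [/\ linear th, injective th & centralizer L = range th] by exists th.
move=> L.
have [lL|nL] := pselect (lattice pi L); last by exists id.
by have [[th hth] _] := lattice_free lp hq (centralizer_lattice k lL); exists th.
Qed.

Section Parametrized.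
Variable th : set V2 -> V1 -> V1.
Hypothesis hth : forall L, lattice pi L ->
  [/\ linear (th L), injective (th L) & centralizer L = range (th L)].

Definition ideal_of (p : set V2 * set V1) : set (gr br) :=
  graded_sum (th p.1 @` p.2) p.1.

Lemma ideal_of_submodule p : lattice pi p.1 -> lattice pi p.2 ->
  is_submodule (ideal_of p).
Proof.
move=> l1 l2; have [lth _ _] := hth l1.
exact: graded_sum_submodule (submodule_image lth l2.1) l1.1.
Qed.

Lemma ideal_of_index p : lattice pi p.1 -> lattice pi p.2 ->
  has_index (ideal_of p) (q ^ (weight p.1 + level q p.2)).
Proof.
case: p => L N /= lL lN; have [lth ith cth] := hth lL.
have hc : has_index (range (th L)) (q ^ level q (@centralizer o n k L)).
  by rewrite -cth; exact: (lattice_level lp hq (centralizer_lattice k lL)).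
have := graded_sum_has_index n0 (has_index_image (linB lth) ith hc (lattice_level lp hq lN))
  (lattice_level lp hq lL).
rewrite -!expnD (level_centralizer lp hq k lL) /lie_weight.
by congr (has_index _ (q ^ _)); rewrite addnC addnA.
Qed.

Lemma level_ideal_of p : lattice pi p.1 -> lattice pi p.2 ->
  level q (ideal_of p) = (weight p.1 + level q p.2)%N.
Proof.
move=> l1 l2; apply: (level_has_index lp hq); last exact: ideal_of_index.
exact: ideal_of_submodule.
Qed.

Lemma ideal_of_bij : set_bij (lattices2 `*` lattices1) graded_ideals ideal_of.
Proof.
split=> [[L N] [/= lL lN]|[L N] [L' N'] /set_mem[/= lL lN] /set_mem[/= lL' lN']|I [[hI gI] fI]].
- have [lth _ cth] := hth lL; split.
    apply: graded_sum_ideal => //; first exact: submodule_image lN.1.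
      exact: lL.1.
    by rewrite cth => _ [v _ <-]; exists v.
  have sI := ideal_of_submodule (p := (L, N)) lL lN.
  by have [] := has_index_finite (submodule_subgroup sI) (ideal_of_index (p := (L, N)) lL lN).
- have [lth ith _] := hth lL; have [lth' _ _] := hth lL'.
  move=> /graded_sum_inj[] //; [exact: submodule_image lN.1|exact: lL.1|
    exact: submodule_image lN'.1|exact: lL'.1|].
  rewrite /= => e1 e2; subst L'; congr (_, _).
  by apply/seteqP; split=> v Nv;
    [have : (th L @` N') (th L v) by rewrite -e1; exists v
    |have : (th L @` N) (th L v) by rewrite e1; exists v] => -[w Nw /ith <-].
- have [L1 [L2 [s1 s2 L12 eI]]] := graded_idealP n0 hI gI.
  have [sI [M hM]] := lattice_finite_index lp hI.1 fI.
  have l2 : lattice pi L2.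
    split=> //; exists M => v; have [p <-] := coord2_surj k n0 v.
    have := hM (0, p); rewrite eI => -[_] /=.
    by rewrite (linZ (@linear_coord2 o n k)).
  have h1 v : L1 (pi ^+ M *: v).
    have [p <-] := coord1_surj n0 v.
    have := hM (p, 0); rewrite eI => -[] /=.
    by rewrite (linZ (@linear_coord1 o n k n0)).
  have [lth ith cth] := hth l2; exists (L2, th L2 @^-1` L1).
    split=> //; split; first exact: submodule_preimage.
    by exists M => v; rewrite /= (linZ lth).
  rewrite eI /ideal_of /=; congr graded_sum.
  apply/seteqP; split=> [_ [v Lv <-]//|v Lv].
  by have := L12 v Lv; rewrite cth => -[w _ e]; exists w; rewrite //= e.
Qed.

(** The fibers over [L] of the sum over ideals are indexed by all lattices [N] of
    the same free module. *)
Lemma ideal_sum (G : nat -> \bar R) : (forall i, 0 <= G i)%E ->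
  (\esum_(I in graded_ideals) G (ideal_level I) =
   \esum_(L in lattices2) \esum_(N in lattices1) G (weight L + level q N)%N)%E.
Proof.
move=> G0; rewrite (reindex_esum _ _ _ _ ideal_of_bij) esum_esum //.
by apply: eq_esum => -[L N] [/= lL lN]; rewrite (level_ideal_of (p := (L, N))).
Qed.
End Parametrized.

Lemma graded_ideal_index I : [set I : set (gr br) | is_lie_ideal I /\ is_graded I] I ->
  finite_index I -> submod_index I = (q ^ level q I)%N.
Proof.
move=> gI fI; have [th hth] := centralizer_param.
have [_ _ /(_ I (conj gI fI))[[L N] [/= lL lN] <-]] := ideal_of_bij hth.
rewrite (level_ideal_of hth (p := (L, N))) //.
have sI := ideal_of_submodule hth (p := (L, N)) lL lN.
by have [] := has_index_finite (submodule_subgroup sI) (ideal_of_index hth (p := (L, N)) lL lN).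
Qed.

Local Notation E2 t := (\esum_(L in lattices2) (t ^+ weight L)%:E)%E.
Local Notation E1 t := (\esum_(N in lattices1) (t ^+ level q N)%:E)%E.

(** An identity of extended nonnegative reals, so that it also serves to deduce
    finiteness of either side from that of the other. *)
Lemma level_sum_ideals (T : R[i]) : 0 < modulus T ->
  (level_sum graded_ideals ideal_level T = E1 (modulus T) * E2 (modulus T))%E.
Proof.
move=> t0; have [th hth] := centralizer_param; set t := modulus T.
have tk j : 0 <= t ^+ j by rewrite exprn_ge0 // ltW.
have E1_0 : (0 <= E1 t)%E by apply: esum_ge0 => N _; rewrite lee_fin.
have inner L : (\esum_(N in lattices1) (t ^+ (weight L + level q N))%:E =
    (t ^+ weight L)%:E * E1 t)%E.
  rewrite -esumZl ?exprn_gt0 //; last by move=> N; rewrite lee_fin.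
  by apply: eq_esum => N _; rewrite exprD EFinM.
rewrite /level_sum -/t (ideal_sum hth (G := fun j => (t ^+ j)%:E)); last by move=> i; rewrite lee_fin.
under eq_esum do rewrite inner muleC.
have := @lattice_sum_gt0 R o pi _ (@level q V1) t t0.
case: (esum _ _) E1_0 => [r r0|_ _|//].
  by rewrite lte_fin => r1; rewrite esumZl // => L; rewrite lee_fin.
rewrite gt0_mulye ?lattice_sum_gt0 //; apply/eqP; rewrite -leye_eq.
apply: esum_ge; exists [set [set: V2]].
  by split=> [|_ ->]; [exact: finite_set1 | exact: lattice_setT].
by rewrite fsbig_set1 gt0_mulye // lte_fin exprn_gt0.
Qed.

Section Series.
Variable T : R[i].
Local Notation t := (modulus T).
Hypothesis t0 : 0 < t.
Hypothesis fin1 : (class_sum pi (@level q V1) finset.set0 finset.set0 (fun k => (t ^+ k)%:E) < +oo)%E.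
Hypothesis fin2 : (class_sum pi weight finset.set0 finset.set0 (fun k => (t ^+ k)%:E) < +oo)%E.
Local Notation c1 := (coef R pi (@level q V1) finset.set0 finset.set0).
Local Notation c2 := (coef R pi weight finset.set0 finset.set0).

(** Splits the ideals of index [q ^ j] by the weight of their second piece. *)
Lemma level_count_ideals j : level_count R graded_ideals ideal_level j =
  \sum_(i < j.+1) c2 i * c1 (j - i)%N.
Proof.
have [th hth] := centralizer_param.
have fin_1 i : (c1 i)%:E = class_coef R pi (@level q V1) finset.set0 finset.set0 i.
  rewrite fineK //; apply: (class_coef_fin lp hq (level_scaling_weight lp hq _) t0 fin1).
  by rewrite finset.set0I.
have fin_2 i : (c2 i)%:E = class_coef R pi weight finset.set0 finset.set0 i.
  rewrite fineK //; apply: (class_coef_fin lp hq (lie_scaling_weight lp hq _ n0) t0 fin2).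
  by rewrite finset.set0I.
rewrite /level_count.
have -> : (\esum_(i in graded_ideals `&` ideal_level @^-1` [set j]) (1 : \bar R) =
    \esum_(I in graded_ideals) (delta R j (ideal_level I))%:E)%E.
  rewrite esum_mkcondr; apply: eq_esum => I _; rewrite /delta.
  have -> : (I \in ideal_level @^-1` [set j]) = (ideal_level I == j) by apply/idP/eqP; rewrite inE.
  by case: eqP.
rewrite (ideal_sum hth (G := fun i => (delta R j i)%:E)); last by move=> i; rewrite lee_fin.
pose h i := if (i <= j)%N then c1 (j - i)%N else 0.
have h0 i : 0 <= h i by rewrite /h; case: ifP => // _; apply: coef_ge0.
have inner L : (\esum_(N in lattices1) (delta R j (weight L + level q N))%:E = (h (weight L))%:E)%E.
  rewrite /h; case: leqP => wj.
    rewrite fin_1 class_coefE class_sum_lattices; apply: eq_esum => N _ /=.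
    by rewrite /delta -{1}(subnKC wj) eqn_add2l.
  apply: esum1 => N _; rewrite /delta; case: eqP => // e; lia.
under eq_esum do rewrite inner.
have := @class_sum_series R o pi 'I_n weight finset.set0 finset.set0 h h0.
rewrite class_sum_lattices => ->.
rewrite (nneseries_split 0 j.+1) => [|i _]; last first.
  by apply: mule_ge0; rewrite ?class_coef_ge0 // lee_fin.
rewrite [X in (_ + X)%E]eseries0 ?adde0 => [|i ij _]; last first.
  by rewrite /h leqNgt ij /= mule0.
rewrite add0n big_mkord.
under eq_bigr => i _ do rewrite -fin_2 -EFinM /h -ltnS ltn_ord.
by rewrite sumEFin.
Qed.

Lemma level_sum_ideals_fin : (level_sum graded_ideals ideal_level T < +oo)%E.
Proof.
have f1 := fin1; have f2 := fin2; rewrite !class_sum_lattices in f1 f2.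
rewrite level_sum_ideals //.
have e0 (J : finType) (L : set (set {ffun J -> o^o})) wt : (0 <= \esum_(N in L) (t ^+ wt N)%:E)%E.
  by apply: esum_ge0 => N _; rewrite lee_fin exprn_ge0 // ltW.
by rewrite lte_mul_pinfty // ge0_fin_numE.
Qed.

Lemma graded_ideals_clim (Wi W : R[i]) :
  clim (psum c2 T) Wi -> clim (psum c1 T) W ->
  clim (psum (level_count R graded_ideals ideal_level) T) (W * Wi).
Proof.
move=> h2 h1; rewrite mulrC.
apply: (psum_mul (t := t) _ _ _ level_count_ideals _ h2 h1) => // [i|i|]; try exact: coef_ge0.
exact: level_count_psummable level_sum_ideals_fin.
Qed.
End Series.
End GradedZeta.

Lemma lie_beta_gt0 n k j : (0 < n)%N -> (0 < j)%N -> (0 < lie_beta n k j)%N.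
Proof.
move=> n0; case: j => // j _; rewrite /lie_beta /b_num.
have : (0 < e_num k.+1 n)%N by rewrite /e_num bin_gt0; lia.
by lia.
Qed.

Lemma eq_igusa (K : fieldType) n (Y : K) (X X' : nat -> K) :
  (forall j, (0 < j <= n)%N -> X j = X' j) -> igusa n Y X = igusa n Y X'.
Proof.
move=> XX'; apply: eq_bigr => J _; congr (_ * _).
by apply: eq_bigr => i _; rewrite XX' //= ltn_ord.
Qed.

Section GradedIdealZeta.
Variables (R : realType) (o : idomainType) (pi : o) (q : nat).
Hypothesis lp : local_parameter pi.
Hypothesis hq : has_index (principal pi) q.
Variables n k : nat.
Hypothesis n0 : (0 < n)%N.
Local Notation V1 := {ffun (multi_index n k + multi_index n k.+1)%type -> o^o}.
Local Notation V2 := {ffun 'I_n -> o^o}.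
Local Notation weight := (@lie_weight o q n k).
Local Notation ideal_level := (@level q (gr (@lie_bracket k.+1 n o))).
Local Notation T s := (cpow (q%:R : R) (- s)).
Local Notation sum1 t :=
  (class_sum pi (@level q V1) finset.set0 finset.set0 (fun k => (t ^+ k)%:E)).
Local Notation sum2 t :=
  (class_sum pi weight finset.set0 finset.set0 (fun k => (t ^+ k)%:E)).
Local Notation series1 := (coef R pi (@level q V1) finset.set0 finset.set0).
Local Notation series2 := (coef R pi weight finset.set0 finset.set0).
Local Notation igusa_factor s := (igusa n (q%:R)^-1
  (fun j : nat => let i := (n - j)%N in
     cpow (q%:R : R) ((i * (n - i))%:R - s * (b_num k.+1 n i)%:R))).

Let qR0 : 0 < q%:R :> R.
Proof. by rewrite ltr0n (has_index_gt0 hq). Qed.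

Lemma lie_scale_ratio (s : R[i]) j : (0 < j <= n)%N ->
  scale_ratio q 'I_n (lie_beta n k) (T s) j =
  cpow q%:R (((n - j) * (n - (n - j)))%:R - s * (b_num k.+1 n (n - j))%:R).
Proof.
move=> /andP[j0 jn]; rewrite /scale_ratio card_ord cpowD // (cpow_nat _ (ltW qR0)).
rewrite mulr_natr -mulNrn cpow_mulrn // rmorphXn /= rmorph_nat subKn // mulnC.
by case: j j0 jn.
Qed.

Lemma lie_series (s : R[i]) : (sum2 (modulus (T s)) < +oo)%E ->
  clim (psum series2 (T s)) (igusa_factor s).
Proof.
move=> fin; have := @coef_series_igusa R o pi q 'I_n lp hq _ _ (lie_scaling_weight lp hq k n0)
  (T s) _ (modulus_cpowq_gt0 hq s) erefl fin finset.set0.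
rewrite finset.setC0 finset.cardsT card_ord.
by congr clim; apply: eq_igusa => j jn; apply: lie_scale_ratio.
Qed.

Lemma level_series (s : R[i]) : (sum1 (modulus (T s)) < +oo)%E ->
  exists W, clim (psum series1 (T s)) W.
Proof.
move=> fin; eexists; exact: (@coef_series_igusa R o pi q _ lp hq _ _ (level_scaling_weight lp hq _)
  (T s) _ (modulus_cpowq_gt0 hq s) erefl fin finset.set0).
Qed.

Lemma graded_zeta_level (s Z : R[i]) :
  graded_ideal_zeta_value o k.+1 n s Z <->
  unconditional_sum (fun I => if I \in @graded_ideals o n k then T s ^+ ideal_level I else 0) Z.
Proof.
apply: (zeta_value_level hq) => I; exact: (graded_ideal_index lp hq n0).
Qed.

(** Both factors of the sum of moduli are positive, so neither can be infinite. *)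
Lemma graded_zeta_fin (s Z : R[i]) : graded_ideal_zeta_value o k.+1 n s Z ->
  (sum1 (modulus (T s)) < +oo)%E /\ (sum2 (modulus (T s)) < +oo)%E.
Proof.
have t0 := modulus_cpowq_gt0 (R := R) hq s.
move=> /(graded_zeta_level _ _) /unconditional_sum_level_sum.
rewrite (level_sum_ideals lp hq k n0) // !class_sum_lattices.
have := lattice_sum_gt0 pi (@level q V1) t0; have := lattice_sum_gt0 pi weight t0.
set x := esum _ _; set y := esum _ _ => x0 y0; rewrite !ltey => xy.
by split; apply: contra_neqN xy => /eqP->; rewrite ?gt0_mulye ?gt0_muley.
Qed.

Lemma graded_zeta_clim (s W : R[i]) :
  (sum1 (modulus (T s)) < +oo)%E -> (sum2 (modulus (T s)) < +oo)%E ->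
  clim (psum series1 (T s)) W ->
  clim (psum (level_count R (@graded_ideals o n k) ideal_level) (T s)) (W * igusa_factor s).
Proof.
move=> fin1 fin2 hW; apply: (graded_ideals_clim lp hq n0 (modulus_cpowq_gt0 hq s)) => //.
exact: lie_series.
Qed.

Lemma graded_zeta_product (s Z : R[i]) : graded_ideal_zeta_value o k.+1 n s Z ->
  exists W, free_module_zeta_value o (d_num k.+1 n) s W /\ Z = W * igusa_factor s.
Proof.
move=> hZ; have [fin1 fin2] := graded_zeta_fin hZ.
have [W hW] := level_series fin1; exists W; split.
  apply: (@free_module_zeta R o pi q lp hq (multi_index n k + multi_index n k.+1)%type).
  - by rewrite card_sum (@card_e_num n k.+1) // card_f_num.
  - by rewrite level_sum_lattices.
  - by rewrite level_count_lattices.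
have t0 := modulus_cpowq_gt0 (R := R) hq s.
apply: clim_uniq (graded_zeta_clim fin1 fin2 hW).
apply: unconditional_sum_clim => //; first exact: (level_sum_ideals_fin lp hq n0).
exact/graded_zeta_level.
Qed.

(** As [B < q ^ B], the modulus of [T] is at most [1 / B] once the real part of [s]
    exceeds [B]. *)
Lemma graded_zeta_converges : exists sigma : R, forall s : R[i],
  sigma < complex.Re s -> exists Z, graded_ideal_zeta_value o k.+1 n s Z.
Proof.
pose bound (I : finType) := (q ^ (#|I| * #|I|) * 2 ^ #|I|)%N.
pose B := (bound 'I_n + bound (multi_index n k + multi_index n k.+1)%type)%N.
exists B%:R => s sB; have t0 := modulus_cpowq_gt0 (R := R) hq s.
have tB : modulus (T s) * B%:R <= 1.
  have -> : modulus (T s) = (q%:R `^ complex.Re s)^-1.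
    rewrite modulus_cpow -powRN; congr (_ `^ _).
    by case: (s).
  rewrite mulrC ler_pdivrMr ?powR_gt0 // mul1r.
  apply: (@le_trans _ _ (q%:R `^ B%:R)).
    rewrite (powR_mulrn _ (ltW qR0)) -natrX ler_nat.
    by apply: ltnW; apply: ltn_expl; apply: q_gt1 lp hq.
  by apply: ler_powR; [rewrite ler1n (has_index_gt0 hq) | exact: ltW].
have small b : (b <= B)%N -> modulus (T s) * b%:R <= 1.
  by move=> bB; apply: le_trans tB; rewrite ler_pM2l // ler_nat.
have fin1 : (sum1 (modulus (T s)) < +oo)%E.
  apply: (class_sum_lty lp hq (level_scaling_weight lp hq _)) => //.
  exact: small (leq_addl _ _).
have fin2 : (sum2 (modulus (T s)) < +oo)%E.
  apply: (class_sum_lty lp hq (lie_scaling_weight lp hq k n0)) => //.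
    by move=> j; apply: lie_beta_gt0.
  exact: small (leq_addr _ _).
have [W hW] := level_series fin1; exists (W * igusa_factor s).
apply/graded_zeta_level; apply: clim_unconditional_sum => //.
  exact: (level_sum_ideals_fin lp hq n0).
exact: graded_zeta_clim.
Qed.
End GradedIdealZeta.

Theorem theorem3p10 (R : realType) (m n : nat) (hm : (1 <= m)%N) (hn : (1 <= n)%N)
  (o : idomainType) (pi : o) (q : nat)
  (hdvr : is_dvr o) (hpi : uniformizer pi)
  (hcompact : adic_compact pi)
  (hq : residue_field_card pi q) :
  (exists sigma : R, forall s : R[i], sigma < complex.Re s ->
     exists Z : R[i], graded_ideal_zeta_value o m n s Z) /\
  (forall s Z : R[i], graded_ideal_zeta_value o m n s Z ->
     exists W : R[i], free_module_zeta_value o (d_num m n) s W /\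
       Z = W * igusa n (q%:R)^-1
         (fun j : nat => let i := (n - j)%N in
            cpow q%:R ((i * (n - i))%:R - s * (b_num m n i)%:R))).
Proof.
have lp := dvr_local_parameter hdvr hpi; have hq' := residue_has_index hq.
case: m hm => // k _; split; first exact: (graded_zeta_converges R lp hq' k hn).
by move=> s Z; apply: (graded_zeta_product lp hq' hn).
Qed.
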